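(* Let $G$ be a connected Poisson Lie group and let $U\subset G^*$ be an open subset invariant under the dressing action of $G$. Then $$H^0_{\pi,G}(U)=C^\infty(U)^G\quad\text{and}\quad H^{n}_{\pi,G}(U)=0\ \text{ for all } n>0.$$
   Context: $G$ is a Poisson Lie group with Lie algebra $\mathfrak g$, $\delta\colon\mathfrak g\to\wedge^2\mathfrak g$ is the linearization of its Poisson structure at $e$, and $G^*$ is the dual Poisson Lie group, with Lie algebra $\mathfrak g^*$ and bracket $\delta^*$, and Poisson structure $\pi$. $\mathcal X^\star(U)$ denotes multi-vector fields on $U$. The map $\pi^\#$ is given by $\beta(\pi^\#\alpha)=\pi(\alpha,\beta)$, and one-forms carry the Lie bracket $\{\alpha,\beta\}=L_{\pi^\#\alpha}\beta-i_{\pi^\#\beta}d\alpha$. The differential $d_\pi\colon\mathcal X^q\to\mathcal X^{q+1}$ is $$(d_\pi w)(\alpha_0,\dots,\alpha_q)=\sum_i(-1)^i L_{\pi^\#\alpha_i}\,w(\dots,\widehat{\alpha_i},\dots)+\sum_{i<j}(-1)^{i+j}w(\{\alpha_i,\alpha_j\},\dots,\widehat{\alpha_i},\dots,\widehat{\alpha_j},\dots)$$ (up to sign, the Schouten bracket with $\pi$). For a one-form $\alpha$, $i_\alpha$ is contraction with $\alpha$ and $\mathcal L_\alpha=i_\alpha d_\pi+d_\pi i_\alpha$. For $\xi\in\mathfrak g=T^*_eG^*$, $\theta_\xi$ is the left-invariant one-form on $G^*$ extending $\xi$; $\{\theta_\xi,\theta_\zeta\}=\theta_{[\xi,\zeta]}$.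 The dressing action of $\xi$ on $G^*$ is given by the vector field $-\pi^\#\theta_\xi$, and $\mathrm{id}$ is an equivariant momentum mapping for it. $C^\infty(U)^G$ is the space of smooth functions $f$ on $U$ invariant under the dressing action, i.e. $L_{\pi^\#\theta_\xi}f=0$ for all $\xi\in\mathfrak g$. Equivariant Poisson cohomology. $(\mathcal X^\star(U),d_\pi)$ with contractions $i_\xi=i_{\theta_\xi}$ and action $L_\xi=\mathcal L_{\theta_\xi}$, $\xi\in\mathfrak g$, is a $\mathfrak g$-differential complex: $i_\xi i_\zeta+i_\zeta i_\xi=0$, $i_{[\xi,\zeta]}=L_\xi i_\zeta-i_\zeta L_\xi$, $L_\xi=di_\xi+i_\xi d$. $H^\star_{\pi,G}(U)$ is the cohomology of $(\mathcal X^\star(U)\otimes S^\star\mathfrak g^* )^{\mathfrak g}$ (invariants of the diagonal action, $\deg(\mathcal X^n\otimes S^m\mathfrak g^* )=n+2m$) with differential $(d_G\alpha)(\xi)=d_\pi(\alpha(\xi))-i_\xi\alpha(\xi)$, elements being viewed as polynomial maps $\mathfrak g\to\mathcal X^\star(U)$. *)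

(* Defs.v *)
From HB Require Import structures.
From mathcomp Require Import all_boot all_order all_algebra.
From mathcomp Require Import all_classical all_reals all_analysis.

Set Implicit Arguments.
Unset Strict Implicit.
Unset Printing Implicit Defensive.

Import Order.TTheory GRing.Theory Num.Theory.
Import numFieldNormedType.Exports.

Local Open Scope classical_set_scope.
Local Open Scope ring_scope.

#[short(type="topologicalGroupDataType")]
HB.structure Definition TopologicalGroupData := {G of Topological G & Group G}.

Section SmoothEuclidean.
Variable R : realType.

(* f is of class C^k on the open set W: C^(k+1) means Frechet differentiable
   with all directional derivatives of class C^k. *)
Fixpoint Ck (n k : nat) (W : set 'rV[R]_n) (f : 'rV[R]_n -> R^o) : Prop :=
  if k is k'.+1 then
    (forall x, W x -> differentiable f x) /\
    (forall v : 'rV[R]_n, Ck k' W ('D_v f))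
  else forall x, W x -> {for x, continuous f}.

Definition Cinfty (n : nat) (W : set 'rV[R]_n) (f : 'rV[R]_n -> R^o) : Prop :=
  forall k, Ck k W f.

End SmoothEuclidean.

(* An atlas is indexed by the points of M: chart c has domain cdom c (an open
   neighbourhood of c), coordinate map coord c and local inverse param c.
   The tangent space at p is 'rV[R]_n and the cotangent space is 'cV[R]_n, in
   the coordinates of the chart indexed by p; they pairing by v *m a. *)
Record atlas (R : realType) (n : nat) (M : topologicalType) := Atlas {
  cdom : M -> set M;
  coord : M -> M -> 'rV[R]_n;
  param : M -> 'rV[R]_n -> M }.

Definition prod_atlas (R : realType) (m n : nat) (M N : topologicalType)
    (C : atlas R m M) (D : atlas R n N) : atlas R (m + n) (M * N)%type :=
  {| cdom := fun c => cdom C c.1 `*` cdom D c.2;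
     coord := fun c p => row_mx (coord C c.1 p.1) (coord D c.2 p.2);
     param := fun c z => (param C c.1 (lsubmx z), param D c.2 (rsubmx z)) |}.

Record is_manifold (R : realType) (n : nat) (M : topologicalType)
    (C : atlas R n M) : Prop := IsManifold {
  mfd_hausdorff : hausdorff_space M;
  mfd_second_countable : @second_countable M;
  mfd_dom_open : forall c, open (cdom C c);
  mfd_dom_center : forall c, cdom C c c;
  mfd_coordK : forall c p, cdom C c p -> param C c (coord C c p) = p;
  mfd_coord_continuous : forall c, {within cdom C c, continuous (coord C c)};
  mfd_image_open : forall c, open (coord C c @` cdom C c);
  mfd_param_continuous :
    forall c, {within coord C c @` cdom C c, continuous (param C c)};
  mfd_transition : forall c d i,
    Cinfty (coord C c @` (cdom C c `&` cdom C d))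
           (fun z => coord C d (param C c z) 0 i) }.

(* Functions, vector fields and forms on an open set U are given by total
   functions on M of which only the values at points of U matter. *)
Section Manifold.
Context (R : realType) (n : nat) (M : topologicalType) (C : atlas R n M).

Definition vfield := M -> 'rV[R]_n.
Definition form := M -> 'cV[R]_n.
Implicit Types (U V W : set M) (f h : M -> R) (X Y : vfield) (a b : form).

Definition smooth U f : Prop :=
  forall c, Cinfty (coord C c @` (cdom C c `&` U)) (f \o param C c).

Definition pairing (v : 'rV[R]_n) (a : 'cV[R]_n) : R := (v *m a) 0 0.

Definition dir f (p : M) (v : 'rV[R]_n) : R :=
  'D_v (f \o param C p : 'rV[R]_n -> R^o) (coord C p p).

Definition df f : form := fun p => \col_i dir f p (delta_mx 0 i).

Definition smooth_vfield U X : Prop :=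
  forall V f, open V -> V `<=` U -> smooth V f ->
    smooth V (fun p => dir f p (X p)).

Definition smooth_form U a : Prop :=
  forall V X, open V -> V `<=` U -> smooth_vfield V X ->
    smooth V (fun p => pairing (X p) (a p)).

(* The commutator [X, Y], read off its action on the coordinates at p. *)
Definition vbracket X Y : vfield := fun p =>
  \row_i (dir (fun q => dir (fun r => coord C p r 0 i) q (Y q)) p (X p)
        - dir (fun q => dir (fun r => coord C p r 0 i) q (X q)) p (Y p)).

(* The vector field with constant components v in the chart indexed by p. *)
Definition const_vfield (p : M) (v : 'rV[R]_n) : vfield := fun q =>
  \row_j 'D_v (fun z => coord C q (param C p z) 0 j : R^o) (coord C p q).

Definition ext_d a X Y (p : M) : R :=
  dir (fun q => pairing (Y q) (a q)) p (X p)
  - dir (fun q => pairing (X q) (a q)) p (Y p)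
  - pairing (vbracket X Y p) (a p).

Definition lie_form X b Y (p : M) : R :=
  dir (fun q => pairing (Y q) (b q)) p (X p) - pairing (vbracket X Y p) (b p).

Section Bivector.
Variable pi : M -> 'M[R]_n.

(* pi p is the matrix of the bivector at p: pi(a, b) = a^T *m pi p *m b, so
   that b (pi^# a) = pi (a, b). *)
Definition sharp a : vfield := fun p => (a p)^T *m pi p.

Definition pbracket f h (p : M) : R := pairing (sharp (df f) p) (df h p).

Record is_poisson : Prop := IsPoisson {
  pi_antisym : forall p, (pi p)^T = - pi p;
  pi_smooth : forall U a b, open U -> smooth_form U a -> smooth_form U b ->
    smooth U (fun p => pairing (sharp a p) (b p));
  pi_jacobi : forall U (f g h : M -> R), open U ->
    smooth U f -> smooth U g -> smooth U h -> forall p, U p ->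
    pbracket f (pbracket g h) p + pbracket g (pbracket h f) p
      + pbracket h (pbracket f g) p = 0 }.

(* {a, b} = L_(pi^# a) b - i_(pi^# b) d a. *)
Definition fbracket a b : form := fun p =>
  \col_i (lie_form (sharp a) b (const_vfield p (delta_mx 0 i)) p
        - ext_d a (sharp b) (const_vfield p (delta_mx 0 i)) p).

(* An inhomogeneous multivector field w is a function of finite sequences of
   one-forms; its component of degree q is its restriction to the sequences
   of length q. *)
Definition mvfield := seq form -> M -> R.
Implicit Types (w : mvfield) (s : seq form).

Definition nthf s (i : nat) : form := nth (fun=> 0) s i.

Definition smooth_forms U s : Prop :=
  forall i, (i < size s)%N -> smooth_form U (nthf s i).

(* The component of degree q of w is an alternating C^oo(U)-multilinear map
   from one-forms on U to C^oo(U). *)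
Record is_multivector U (q : nat) w : Prop := IsMultivector {
  mv_smooth : forall s, size s = q -> smooth_forms U s -> smooth U (w s);
  mv_linear : forall s1 s2 f a b, (size s1 + size s2).+1 = q ->
    smooth_forms U (s1 ++ s2) -> smooth U f -> smooth_form U a ->
    smooth_form U b -> forall p, U p ->
    w (s1 ++ (fun p => f p *: a p + b p) :: s2) p
      = f p * w (s1 ++ a :: s2) p + w (s1 ++ b :: s2) p;
  mv_alternating : forall s1 s2 s3 a, (size (s1 ++ s2 ++ s3)).+2 = q ->
    smooth_forms U (s1 ++ s2 ++ s3) -> smooth_form U a ->
    forall p, U p -> w (s1 ++ a :: s2 ++ a :: s3) p = 0 }.

Definition omit (i : nat) s : seq form := take i s ++ drop i.+1 s.

Definition d_pi w : mvfield := fun s p =>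
  \sum_(i < size s) (-1) ^+ i * dir (w (omit i s)) p (sharp (nthf s i) p)
  + \sum_(i < size s) \sum_(j < size s | (i < j)%N)
      (-1) ^+ (i + j)
      * w (fbracket (nthf s i) (nthf s j) :: omit i (omit j s)) p.

Definition contr a w : mvfield := fun s => w (a :: s).

Definition lie a w : mvfield := fun s p =>
  contr a (d_pi w) s p + d_pi (contr a w) s p.

Section Equivariant.
(* g is carried by 'rV[R]_k, with bracket br; theta maps g to one-forms. *)
Context (k : nat) (br : 'rV[R]_k -> 'rV[R]_k -> 'rV[R]_k).
Context (theta : 'rV[R]_k -> form) (U : set M).

Definition cochain := 'rV[R]_k -> mvfield.
Implicit Types A B : cochain.

Definition cochain_eq A B : Prop :=
  forall xi s, smooth_forms U s -> forall p, U p -> A xi s p = B xi s p.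

(* The component of A of multivector degree q is the polynomial map given by
   an element of X^q(U) (x) S^m g^*, i.e. by a finite sum of products of a
   multivector field with m linear forms on g (columns). *)
Definition in_tensor (q m : nat) A : Prop :=
  exists (r : nat) (l : 'I_r -> 'I_m -> 'cV[R]_k) (w : 'I_r -> mvfield),
    (forall j, is_multivector U q (w j)) /\
    forall xi s, size s = q -> smooth_forms U s -> forall p, U p ->
      A xi s p = \sum_(j < r) (\prod_(i < m) (xi *m l j i) 0 0) * w j s p.

(* The diagonal action of xi; the coadjoint action on a polynomial P on g is
   (xi . P)(zeta) = - (dP)_zeta [xi, zeta]. *)
Definition diag_act (xi : 'rV[R]_k) A : cochain := fun zeta s p =>
  lie (theta xi) (A zeta) s p
  - 'D_(br xi zeta) (fun eta => A eta s p : R^o) zeta.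

(* Invariant elements of total degree N; X^q (x) S^m has degree q + 2 m. *)
Record is_cochain (N : nat) A : Prop := IsCochain {
  cochain_tensor : forall q m, (q + 2 * m)%N = N -> in_tensor q m A;
  cochain_zero : forall q, (forall m, (q + 2 * m)%N <> N) ->
    forall xi s, size s = q -> smooth_forms U s -> forall p, U p ->
    A xi s p = 0;
  cochain_invariant : forall xi, cochain_eq (diag_act xi A) (fun _ _ _ => 0) }.

Definition d_G A : cochain := fun xi s p =>
  d_pi (A xi) s p - contr (theta xi) (A xi) s p.

Definition cocycle (N : nat) : set cochain :=
  [set A | is_cochain N A /\ cochain_eq (d_G A) (fun _ _ _ => 0)].

Definition coboundary (N : nat) : set cochain :=
  [set A | if N is N'.+1
           then exists B, is_cochain N' B /\ cochain_eq A (d_G B)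
           else cochain_eq A (fun _ _ _ => 0)].

Definition cohom_class (N : nat) A : set cochain :=
  [set B | cocycle N B /\ coboundary N (fun xi s p => B xi s p - A xi s p)].

Definition eq_cohomology (N : nat) : set (set cochain) :=
  [set cohom_class N A | A in cocycle N].

Definition invariant_functions : set (M -> R) :=
  [set f | smooth U f /\
           forall xi p, U p -> dir f p (sharp (theta xi) p) = 0].

Definition function_cochain f : cochain :=
  fun _ s p => if s is [::] then f p else 0.

(* gamma is an integral curve of X on the open interval (t0, t1). *)
Definition integral_curve X (gamma : R -> M) (t0 t1 : R) : Prop :=
  forall t, t0 < t < t1 -> {for t, continuous gamma} /\
    is_derive (t : R^o) (1 : R^o)
      (fun u : R^o => coord C (gamma t) (gamma u)) (X (gamma t)).

Definition dressing_field (xi : 'rV[R]_k) : vfield :=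
  fun p => - sharp (theta xi) p.

(* The dressing action may be only local; invariance of U is invariance under
   the flows of the dressing vector fields. *)
Definition dressing_invariant : Prop :=
  forall xi (gamma : R -> M) (t0 t1 : R),
    integral_curve (dressing_field xi) gamma t0 t1 ->
    forall t t', t0 < t < t1 -> t0 < t' < t1 -> U (gamma t) -> U (gamma t').

End Equivariant.
End Bivector.
End Manifold.

Definition smooth_map (R : realType) (m n : nat) (M N : topologicalType)
    (C : atlas R m M) (D : atlas R n N) (F : M -> N) : Prop :=
  continuous F /\
  forall V f, open V -> smooth D V f -> smooth C (F @^-1` V) (f \o F).

Definition tangent_map (R : realType) (m n : nat) (M N : topologicalType)
    (C : atlas R m M) (D : atlas R n N) (F : M -> N) (p : M)
    (v : 'rV[R]_m) : 'rV[R]_n :=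
  \row_j dir C (fun q => coord D (F p) (F q) 0 j) p v.

Section LieGroup.
Context (R : realType) (n : nat) (G : topologicalGroupDataType).
Variable C : atlas R n G.

Record is_lie_group : Prop := IsLieGroup {
  lie_manifold : is_manifold C;
  lie_mul : smooth_map (prod_atlas C C) C (fun x => x.1 * x.2)%g;
  lie_inv : smooth_map C C (fun x => x^-1)%g }.

Definition left_vfield (x : 'rV[R]_n) : vfield R n G :=
  fun g => tangent_map C C (fun h => g * h)%g 1%g x.

Definition left_form (a : 'cV[R]_n) : form R n G := fun g =>
  \col_j pairing (tangent_map C C (fun h => g^-1 * h)%g g (delta_mx 0 j)) a.

Definition lie_bracket (x y : 'rV[R]_n) : 'rV[R]_n :=
  vbracket C (left_vfield x) (left_vfield y) 1%g.

Variable pi : G -> 'M[R]_n.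

(* The multiplication G * G -> G is a Poisson map. *)
Definition is_multiplicative : Prop :=
  forall U f h, open U -> smooth C U f -> smooth C U h ->
  forall x y : G, U (x * y)%g ->
    pbracket C pi f h (x * y)%g
    = pbracket C pi (fun z => f (z * y)%g) (fun z => h (z * y)%g) x
      + pbracket C pi (fun z => f (x * z)%g) (fun z => h (x * z)%g) y.

(* The derivative at the unit, along x, of the bivector written in the chart
   at the unit, evaluated on the covectors a and b. *)
Definition delta (x : 'rV[R]_n) (a b : 'cV[R]_n) : R :=
  dir C (pbracket C pi (fun g => pairing (coord C 1%g g) a)
                       (fun g => pairing (coord C 1%g g) b)) 1%g x.

End LieGroup.

Record poissonLieGroup (R : realType) (n : nat) := PoissonLieGroup {
  pl_group :> topologicalGroupDataType;
  pl_atlas : atlas R n pl_group;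
  pl_pi : pl_group -> 'M[R]_n;
  pl_lie_group : is_lie_group pl_atlas;
  pl_poisson : is_poisson pl_atlas pl_pi;
  pl_multiplicative : is_multiplicative pl_atlas pl_pi }.

(* H is dual to G through the pairing <x, u> = x *m K *m u^T of the Lie algebras
   of G and H: the bracket of each one is the transpose of the linearization
   of the Poisson structure of the other. *)
Record is_dual (R : realType) (n : nat) (G H : poissonLieGroup R n)
    (K : 'M[R]_n) : Prop := IsDual {
  dual_perfect : K \in unitmx;
  dual_bracketH : forall x u v,
    pairing x (K *m (lie_bracket (pl_atlas H) u v)^T)
    = delta (pl_atlas G) (@pl_pi R n G) x (K *m u^T) (K *m v^T);
  dual_bracketG : forall x y u,
    pairing u ((lie_bracket (pl_atlas G) x y *m K)^T)
    = delta (pl_atlas H) (@pl_pi R n H) u ((x *m K)^T) ((y *m K)^T) }.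

(* The left-invariant one-form on H extending x, an element of the Lie algebra
   of G seen as a covector at the unit of H. *)
Definition theta (R : realType) (n : nat) (H : poissonLieGroup R n)
    (K : 'M[R]_n) (x : 'rV[R]_n) : form R n H :=
  left_form (pl_atlas H) ((x *m K)^T).

(* Main.v *)
(** The left-invariant forms [theta_x] are a global frame of one-forms on the dual group. Since [pi] is
multiplicative, the bracket of forms satisfies [{theta_x, theta_y} = theta_[x, y]], and by the Jacobi
identity the vector fields [pi^# theta_x] represent the Lie algebra g. As [d_pi w] is tensorial, an
equivariant cochain on [U] amounts to a g-invariant element of /\g* (x) S g* (x) C^oo(U), and
[d_G] becomes [d - iota] where [d] is the Chevalley-Eilenberg differential of g acting on C^oo(U) and
[iota] is the Koszul differential, which trades an exterior slot for a polynomial variable. Moving a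
derivative in the polynomial variable into an exterior slot gives an equivariant operator [h] such that
[iota h + h iota] multiplies by the sum of the exterior and polynomial degrees. The component of lowest
exterior degree of a cocycle of positive degree is killed by [iota], hence it is [iota h] of a
multiple of itself, and adding a coboundary removes it; finitely many such steps exhaust the cocycle. *)

From HB Require Import structures.
From mathcomp Require Import all_boot all_order all_algebra.
From mathcomp Require Import all_classical all_reals all_analysis.
From mathcomp Require Import ring lra zify.
Require Import Defs.

Set Implicit Arguments.
Unset Strict Implicit.
Unset Printing Implicit Defensive.

Import Order.TTheory GRing.Theory Num.Theory.
Import numFieldNormedType.Exports.

Local Open Scope classical_set_scope.
Local Open Scope ring_scope.

(** * Calculus on open subsets of Euclidean space *)

(** The Lie algebra structure is read off the dual group alone: the structure constants are the
    linearization of its [pi] at the unit, duality identifies them with the bracket of g, and their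
    antisymmetry and Jacobi identity come from those of the Poisson bracket. The identities for the
    frame rest on one formula, [key], which differentiates multiplicativity along the frame in
    coordinates translated from the unit. The frame is global, so the coefficients of a form smooth
    on [U] are smooth on all of [U]. A tensorial map may therefore have its arguments frozen at a
    point without any cut-off function. On sequences of Lie algebra elements, the Lie derivative,
    the differential and the homotopy are defined by recursion in the manner of Cartan's formula.
    Their identities then follow by induction on the sequence, without signed double sums.
    Invariance is essential: [d_G] squares to zero on invariant cochains only. The homotopy
    preserves invariance, so a corrected cocycle is again an invariant cocycle. The sum of the
    exterior and polynomial degrees is nonzero in positive total degree, hence invertible in the
    reals. *)

Section EuclideanCalculus.
Variable R : realType.

Lemma near_eq_differentiable (V W : normedModType R) (f g : V -> W) (x : V) :
  {near x, f =1 g} -> differentiable f x -> differentiable g x.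
Proof.
move=> fg df; rewrite (_ : g = f + (g - f)); last first.
  by apply/funext => y; rewrite !fctE addrC subrK.
apply: differentiableD => //.
(* The difference vanishes near [x], so it equals its own remainder term and its differential is
   zero. *)
set h := (g - f : V -> W).
have hx : h x = 0 by rewrite /h !fctE (nbhs_singleton fg) subrr.
have h0 : h \o shift x = cst (h x) + \0 +o_ (0 : V) id.
  apply/eqaddoP => e e0.
  have {}fg : \forall y \near (0:V), f (y + x) = g (y + x).
    by move: fg; rewrite (near_shift 0); apply: filterS => y /=; rewrite subr0.
  apply: filterS fg => y fg; rewrite (_ : _ y = h (y + x) - (h x + 0))//.
  by rewrite hx /h !fctE fg !subrr addr0 subrr normr0 mulr_ge0// ltW.
have dh : ('d h x : V -> W) = 0 by apply/diff_unique; first exact: cst_continuous.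
by apply/diff_locallyP; rewrite dh; split=> //; exact: cst_continuous.
Qed.

Lemma open_near (T : topologicalType) (W : set T) (P : T -> Prop) (x : T) :
  open W -> W x -> (forall y, W y -> P y) -> \forall y \near x, P y.
Proof. by move=> oW Wx WP; apply: filterS WP _; exact: open_nbhs_nbhs. Qed.

Lemma near_eq_continuous (T T' : topologicalType) (f g : T -> T') (x : T) :
  {near x, f =1 g} -> {for x, continuous f} -> {for x, continuous g}.
Proof.
move=> fg; rewrite /prop_for /continuous_at -(nbhs_singleton fg).
by apply: cvg_trans; apply: near_eq_cvg; apply: filterS fg => y ->.
Qed.

Lemma derive_addf (V : normedModType R) (f g : V -> R^o) x v :
  differentiable f x -> differentiable g x ->
  'D_v (fun y => f y + g y) x = 'D_v f x + 'D_v g x.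
Proof.
by move=> /(@diff_derivable _ _ _ _ _ v) df /(@diff_derivable _ _ _ _ _ v) dg; exact: deriveD.
Qed.

Lemma derive_mulf (V : normedModType R) (f g : V -> R^o) x v :
  differentiable f x -> differentiable g x ->
  'D_v (fun y => f y * g y) x = f x * 'D_v g x + g x * 'D_v f x.
Proof.
by move=> /(@diff_derivable _ _ _ _ _ v) df /(@diff_derivable _ _ _ _ _ v) dg; exact: deriveM.
Qed.

Lemma derive_coord m n (M : 'M[R]_(m, n)) (v : 'M[R]_(m, n)) i j :
  'D_v (fun x : 'M[R]_(m, n) => x i j : R^o) M = v i j.
Proof.
rewrite deriveE; last exact: differentiable_coord.
have @c : {linear 'M[R]_(m, n) -> R^o}.
  by exists (fun N : 'M[R]_(m, n) => N i j); do 2![eexists]; do ?[constructor];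
     rewrite ?mxE// => ? *; rewrite ?mxE//; move=> ?; rewrite !mxE.
by rewrite (_ : (fun x => _) = c)// diff_lin//; exact: coord_continuous.
Qed.

(** * Functions of class C^k *)

Section Ck.
Context (n : nat).
Implicit Types (W : set 'rV[R]_n) (f g : 'rV[R]_n -> R^o).

(** Derivatives are total functions, and openness of [W] is what carries an equality on [W] over to
    them at each stage of the induction. *)
Lemma Ck_ext k W f g : open W -> (forall x, W x -> f x = g x) ->
  Ck k W f -> Ck k W g.
Proof.
move=> oW; elim: k f g => [|k IH] f g fg /=.
  by move=> cf x Wx; apply: near_eq_continuous (open_near oW Wx fg) (cf x Wx).
move=> [df Df]; split=> [x Wx|v].
  exact: near_eq_differentiable (open_near oW Wx fg) (df x Wx).
by apply: IH (Df v) => x Wx; apply: near_eq_derive; exact: (open_near oW Wx fg).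
Qed.

Lemma Ck_sub k W W' f : W' `<=` W -> Ck k W f -> Ck k W' f.
Proof.
move=> WW'; elim: k f => [|k IH] f /=; first by move=> cf x /WW'; exact: cf.
by move=> [df Df]; split=> [x /WW'|v]; [exact: df|exact: IH].
Qed.

Lemma Ck_local k W f :
  (forall x, W x -> exists2 W', W' x & Ck k W' f) -> Ck k W f.
Proof.
elim: k f => [|k IH] f /= H.
  by move=> x Wx; have [W' W'x] := H x Wx; exact.
split=> [x Wx|v]; first by have [W' W'x []] := H x Wx => + _; exact.
by apply: IH => x Wx; have [W' W'x [_ ?]] := H x Wx; exists W'.
Qed.

Lemma CkW k W f : Ck k.+1 W f -> Ck k W f.
Proof.
elim: k f => [|k IH] f [df Df]; first by move=> x Wx; exact/differentiable_continuous/df.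
by split=> // v; apply/IH/Df.
Qed.

Lemma Ck_cst k W (c : R) : Ck k W (fun=> c : R^o).
Proof.
elim: k c => [|k IH] c /=; first by move=> x _; exact: cst_continuous.
split=> [x _|v]; first exact: differentiable_cst.
rewrite (_ : 'D_v _ = fun=> 0) //; apply/funext => x; exact: derive_cst.
Qed.

Lemma CkD k W f g : open W -> Ck k W f -> Ck k W g -> Ck k W (fun x => f x + g x).
Proof.
move=> oW; elim: k f g => [|k IH] f g /=.
  by move=> cf cg x Wx; apply: continuousD; [exact: cf|exact: cg].
move=> [df Df] [dg Dg]; split=> [x Wx|v].
  by apply: differentiableD; [exact: df|exact: dg].
apply: Ck_ext (IH _ _ (Df v) (Dg v)) => // x Wx.
by rewrite derive_addf//; [exact: df|exact: dg].
Qed.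

Lemma CkM k W f g : open W -> Ck k W f -> Ck k W g -> Ck k W (fun x => f x * g x).
Proof.
move=> oW; elim: k f g => [|k IH] f g.
  by move=> cf cg x Wx; apply: continuousM; [exact: cf|exact: cg].
move=> Cf Cg; have [df Df] := Cf; have [dg Dg] := Cg; split=> [x Wx|v].
  by apply: differentiableM; [exact: df|exact: dg].
apply: Ck_ext (CkD oW (IH _ _ (CkW Cf) (Dg v)) (IH _ _ (CkW Cg) (Df v))) => // x Wx.
by rewrite derive_mulf//; [exact: df|exact: dg].
Qed.

Lemma Ck_sum k W (I : Type) (r : seq I) (F : I -> 'rV[R]_n -> R^o) : open W ->
  (forall i, Ck k W (F i)) -> Ck k W (fun x => \sum_(i <- r) F i x).
Proof.
move=> oW CF; elim: r => [|i r IH].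
  by apply: Ck_ext (Ck_cst k W 0) => // x _; rewrite big_nil.
by apply: Ck_ext (CkD oW (CF i) IH) => // x _; rewrite big_cons.
Qed.

Lemma Ck_coord k W i : Ck k W (fun x : 'rV[R]_n => x 0 i : R^o).
Proof.
case: k => [|k]; first by move=> x _; exact: coord_continuous.
split=> [x _|v]; first exact: differentiable_coord.
rewrite (_ : 'D_v _ = fun=> v 0 i); first exact: Ck_cst.
by apply/funext => x; rewrite derive_coord.
Qed.

Lemma derive_linear f x : differentiable f x ->
  forall v, 'D_v f x = \sum_i v 0 i * 'D_(delta_mx 0 i) f x.
Proof.
move=> df v; rewrite deriveE// {1}(row_sum_delta v) linear_sum.
by apply: eq_bigr => i _; rewrite linearZ deriveE.
Qed.

End Ck.

(** * Chain rule and composition *)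

Section Comp.
Context (m n : nat).
Implicit Types (f : 'rV[R]_m -> R^o) (g : 'rV[R]_n -> 'rV[R]_m).

Lemma differentiable_rV g x :
  (forall i, differentiable (fun y => g y 0 i : R^o) x) -> differentiable g x.
Proof.
move=> dg; rewrite (_ : g = \sum_i (fun y => g y 0 i *: delta_mx 0 i)).
  by apply: differentiable_sum => i; exact: differentiableZl.
by apply/funext => y; rewrite fct_sumE [LHS]row_sum_delta.
Qed.

Lemma continuous_rV (T : topologicalType) (g : T -> 'rV[R]_m) (x : T) :
  (forall i, {for x, continuous (fun y => g y 0 i : R^o)}) ->
  {for x, continuous g}.
Proof.
move=> cg; rewrite (_ : g = \sum_i (fun y => g y 0 i *: delta_mx 0 i)); last first.
  by apply/funext => y; rewrite fct_sumE [LHS]row_sum_delta.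
elim/big_ind: _ => [|g1 g2|i _]; first exact: cst_continuous.
  exact: continuousD.
by apply: continuousZr_tmp; exact: cg.
Qed.

Lemma derive_compf f g x v : differentiable f (g x) ->
  (forall i, differentiable (fun y => g y 0 i : R^o) x) ->
  'D_v (f \o g) x
  = \sum_i 'D_v (fun y => g y 0 i : R^o) x * 'D_(delta_mx 0 i) f (g x).
Proof.
move=> df dg; have dg' := differentiable_rV dg.
rewrite deriveE; last exact: differentiable_comp.
rewrite diff_comp//= -deriveE// derive_linear//; apply: eq_bigr => i _.
congr (_ * _); rewrite -deriveE// derive_mx; last exact: diff_derivable.
by rewrite mxE.
Qed.

Lemma Ck_comp k (W : set 'rV[R]_m) (W' : set 'rV[R]_n) f g :
  open W' -> (forall x, W' x -> W (g x)) ->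
  Ck k W f -> (forall i, Ck k W' (fun y => g y 0 i)) -> Ck k W' (f \o g).
Proof.
move=> oW' gW; elim: k f => [|k IH] f Cf Cg.
  move=> x Wx; apply: continuous_comp; last exact/Cf/gW.
  by apply: continuous_rV => i; exact: (Cg i).
have [df Df] := Cf; split=> [x Wx|v].
  by apply: differentiable_comp; [apply: differentiable_rV => i; exact: (Cg i).1|exact/df/gW].
(* The chain rule expression of the derivative. Its second factors are compositions again, which is
   why the induction is over all [f]. *)
pose F := fun x => \sum_i 'D_v (fun y => g y 0 i : R^o) x * ('D_(delta_mx 0 i) f \o g) x.
have CF : Ck k W' F.
  apply: Ck_sum => // i; apply: CkM => //; first exact: (Cg i).2.
  by apply: IH => [|j]; [exact: Df|exact: CkW].
apply: Ck_ext CF => // x Wx; rewrite derive_compf//; first exact/df/gW.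
by move=> i; exact: (Cg i).1.
Qed.

End Comp.

Lemma is_derive_line (V : normedModType R) (f : V -> R^o) (y u : V) (t : R) :
  differentiable f (y + t *: u) ->
  is_derive (t : R^o) (1 : R^o) (fun s : R^o => f (y + s *: u)) ('D_u f (y + t *: u)).
Proof.
move=> df; have dl : is_diff (t : R^o) (fun s : R^o => y + s *: u) ( *:%R ^~ u).
  by apply: is_diff_eq; rewrite add0r.
have [dl1 dl2] := dl.
have dc : differentiable (fun s : R^o => f (y + s *: u)) (t : R^o).
  exact: (differentiable_comp dl1 df).
apply: DeriveDef; first exact: diff_derivable.
by rewrite deriveE// (diff_comp dl1 df)/= dl2 scale1r -deriveE.
Qed.

(** Two applications of the mean value theorem: first in [s] to the difference of [f] across the
    parallelogram, then in [t] to ['D_u f]. *)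
Lemma second_difference (V : normedModType R) (f : V -> R^o) (x u v : V) (h : R) :
  0 < h ->
  (forall s t, 0 <= s <= h -> 0 <= t <= h ->
     differentiable f (x + s *: u + t *: v) /\
     differentiable ('D_u f) (x + s *: u + t *: v)) ->
  exists s t, [/\ 0 <= s <= h, 0 <= t <= h &
    f (x + h *: u + h *: v) - f (x + h *: u) - f (x + h *: v) + f x
    = h ^+ 2 * 'D_v ('D_u f) (x + s *: u + t *: v)].
Proof.
move=> h0 D.
have hh : 0 <= h <= h by rewrite lexx ltW.
have h00 : 0 <= (0 : R) <= h by rewrite lexx ltW.
pose phi (s : R^o) : R^o := f ((x + h *: v) + s *: u) - f (x + s *: u).
have dphi (s : R^o) : 0 <= s <= h ->
    is_derive s (1 : R^o) phi ('D_u f (x + h *: v + s *: u) - 'D_u f (x + s *: u)).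
  move=> sh; apply: is_deriveB; apply: is_derive_line.
    by have [+ _] := D s h sh hh; rewrite addrAC.
  by have [+ _] := D s 0 sh h00; rewrite scale0r addr0.
have [||s] := @MVT R phi (fun s => 'D_u f (x + h *: v + s *: u) - 'D_u f (x + s *: u)) 0 h h0.
- by move=> s; rewrite in_itv/= => /andP[s0 sh]; apply: dphi; rewrite !ltW.
- apply: derivable_within_continuous => s; rewrite in_itv/= => sh.
  by have [] := dphi s sh.
rewrite in_itv/= => /andP[s0 sh].
have sh' : 0 <= s <= h by rewrite !ltW.
have [||t] := @MVT R (fun t : R^o => 'D_u f ((x + s *: u) + t *: v) : R^o)
  (fun t => 'D_v ('D_u f) (x + s *: u + t *: v)) 0 h h0.
- move=> t; rewrite in_itv/= => /andP[t0 th]; apply: is_derive_line.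
  by have [] := D s t sh' _; rewrite ?ltW.
- apply: derivable_within_continuous => t; rewrite in_itv/= => th.
  by have [] := @is_derive_line _ ('D_u f) (x + s *: u) v t (D s t sh' th).2.
rewrite in_itv/= => /andP[t0 th]; rewrite scale0r addr0 subr0 => E2.
rewrite /phi scale0r !addr0 [x + h *: v + s *: u]addrAC E2 => E1.
exists s, t; split => //; first by rewrite !ltW.
rewrite expr2 mulrC mulrA -E1.
by rewrite [x + h *: v + h *: u]addrAC; ring.
Qed.

Lemma near_parallelogram (V : normedModType R) (x u v : V) (P : V -> Prop) :
  (\forall y \near x, P y) ->
  exists2 d : R, 0 < d & forall s t, 0 <= s <= d -> 0 <= t <= d ->
    P (x + s *: u + t *: v).
Proof.
move=> /nbhs_ballP[r /= r0 rP].
(* The displacement has norm at most [d] times the sum of the two norms. The summand 1 keeps the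
   denominator positive when both directions vanish. *)
have uv0 : 0 < `|u| + `|v| + 1 by rewrite ltr_pwDr// addr_ge0.
exists (r / 2 / (`|u| + `|v| + 1)); first by rewrite !divr_gt0.
move=> s t /andP[s0 sd] /andP[t0 td]; apply: rP.
rewrite -ball_normE/= -addrA opprD addNKr normrN (le_lt_trans (ler_normD _ _))//.
rewrite !normrZ (ger0_norm s0) (ger0_norm t0).
set d := _ / _ in sd td.
have d0 : 0 < d by rewrite !divr_gt0.
have rd : d * (`|u| + `|v| + 1) = r / 2 by rewrite /d divfK// gt_eqF.
have := ler_wpM2r (normr_ge0 u) sd; have := ler_wpM2r (normr_ge0 v) td.
nra.
Qed.

End EuclideanCalculus.

(** * Symmetry of second derivatives *)

Section Schwarz.
Variable R : realType.
(** The second difference is symmetric in [u] and [v]. It equals [d ^+ 2] times either mixed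
    derivative, each taken at some point of the same small parallelogram, and continuity brings both
    points to [x]. *)
Lemma schwarz n (W : set 'rV[R]_n) (f : 'rV[R]_n -> R^o) (x u v : 'rV[R]_n) :
  open W -> W x -> Ck 2 W f -> 'D_u ('D_v f) x = 'D_v ('D_u f) x.
Proof.
move=> oW Wx [df Df]; apply/eqP; rewrite -subr_eq0 -normr_eq0; apply/eqP.
apply/le_anti; rewrite normr_ge0 andbT; apply/ler_addgt0Pl => e e0; rewrite addr0.
have cuv a b : {for x, continuous ('D_a ('D_b f))}.
  by have [_ /(_ a)] := Df b; exact.
have near_uv a b : \forall y \near x, `|'D_a ('D_b f) x - 'D_a ('D_b f) y| < e / 2.
  by have /cvgrPdist_lt := cuv a b; apply; rewrite divr_gt0.
have near_W : \forall y \near x, W y by exact: open_near oW Wx _.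
have [d d0 dP] := near_parallelogram u v
  (filterI near_W (filterI (near_uv u v) (near_uv v u))).
have [|s [t [sd td E1]]] := @second_difference R _ f x u v d d0.
  by move=> s t sd td; have [/[dup] /df ? /(Df u).1 ?] := dP s t sd td.
have [|s' [t' [sd' td' E2]]] := @second_difference R _ f x v u d d0.
  move=> s' t' sd' td'; have := dP t' s' td' sd'; rewrite addrAC.
  by move=> [/[dup] /df ? /(Df v).1 ?].
have [_ [_ +]] := dP s t sd td; have [_ [+ _]] := dP t' s' td' sd'.
have : 'D_v ('D_u f) (x + s *: u + t *: v) = 'D_u ('D_v f) (x + t' *: u + s' *: v).
  have eq_coef (p q r w a b : R) : p - q - r + w = d ^+ 2 * a ->
      p - r - q + w = d ^+ 2 * b -> a = b.
    move=> pa pb; have d2 : d ^+ 2 != 0 by rewrite expf_neq0// gt_eqF.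
    by apply: (mulfI d2); rewrite -pa -pb; ring.
  rewrite [x + t' *: u + _]addrAC; apply: eq_coef E1 _.
  by rewrite [x + d *: u + _]addrAC; exact: E2.
have ball2 (a b c : R) : `|a - c| < e / 2 -> `|b - c| < e / 2 -> `|a - b| <= e.
  move=> ac bc; rewrite ltW// (le_lt_trans (ler_distD c a b))// (distrC c).
  by rewrite (splitr e) ltrD.
by move=> -> ac bc; exact: ball2 ac bc.
Qed.

End Schwarz.

(** * Smooth functions on a manifold *)

Arguments mfd_dom_open {R n M C} _ c.
Arguments mfd_dom_center {R n M C} _ c.
Arguments mfd_image_open {R n M C} _ c {_} _.
Arguments mfd_coord_continuous {R n M C} _ c {_ _} _.
Arguments mfd_param_continuous {R n M C} _ c {_ _} _.

Section ManifoldCalculus.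
Context (R : realType) (n : nat) (M : topologicalType) (C : atlas R n M).
Hypothesis hC : is_manifold C.
Implicit Types (U V W : set M) (f g h : M -> R) (p q c : M).

Local Notation img c U := (coord C c @` (cdom C c `&` U)).

(** Inside the open image of the chart domain, this set is the preimage of [U] under the continuous
    inverse chart. *)
Lemma open_img c U : open U -> open (img c U).
Proof.
move=> oU; rewrite openE => z [q [cq Uq] <-].
have oW := mfd_image_open hC c.
have Wq : (coord C c @` cdom C c) (coord C c q) by exists q.
have cp := mfd_param_continuous hC c.
rewrite continuous_open_subspace// in cp.
have /= := cp _ (mem_set Wq); rewrite /continuous_at (mfd_coordK hC)//.
move=> /(_ U (open_nbhs_nbhs (conj oU Uq))) /= nU.
near=> y; have : (coord C c @` cdom C c) y by near: y; apply: open_nbhs_nbhs.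
move=> [r cr ry]; exists r => //; split=> //.
by rewrite -(mfd_coordK hC cr) ry; near: y; exact: nU.
Unshelve. all: by end_near. Qed.

Arguments open_img c {U} _.

Lemma mem_img c U q : cdom C c q -> U q -> img c U (coord C c q).
Proof. by move=> cq Uq; exists q. Qed.

Lemma smooth_ext U f g : open U -> (forall p, U p -> f p = g p) ->
  smooth C U f -> smooth C U g.
Proof.
move=> oU fg sf c k; apply: Ck_ext (sf c k); first exact: open_img.
by move=> z [q [cq Uq] <-] /=; rewrite (mfd_coordK hC)// fg.
Qed.

Lemma smooth_sub U V f : V `<=` U -> smooth C U f -> smooth C V f.
Proof.
move=> VU sf c k; apply: Ck_sub (sf c k).
by move=> z [q [cq /VU Uq] <-]; exists q.
Qed.

Lemma smooth_local U f : 
  (forall p, U p -> exists2 V, V p & smooth C V f) -> smooth C U f.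
Proof.
move=> H c k; apply: Ck_local => z [q [cq Uq] <-].
have [V Vq sV] := H q Uq; exists (img c V); last exact: sV.
exact: mem_img.
Qed.

Lemma smooth_cst U (a : R) : smooth C U (fun=> a).
Proof. by move=> c k; exact: Ck_cst. Qed.

Lemma smoothD U f g : open U -> smooth C U f -> smooth C U g ->
  smooth C U (fun p => f p + g p).
Proof.
by move=> oU sf sg c k; apply: CkD; [exact: open_img|exact: sf|exact: sg].
Qed.

Lemma smoothM U f g : open U -> smooth C U f -> smooth C U g ->
  smooth C U (fun p => f p * g p).
Proof.
by move=> oU sf sg c k; apply: CkM; [exact: open_img|exact: sf|exact: sg].
Qed.

Lemma smoothN U f : open U -> smooth C U f -> smooth C U (fun p => - f p).
Proof.
move=> oU sf; apply: smooth_ext (smoothM oU (smooth_cst U (-1)) sf) => //.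
by move=> p _; rewrite mulN1r.
Qed.

Lemma smooth_sum U (I : Type) (r : seq I) (P : pred I) (F : I -> M -> R) : open U ->
  (forall i, P i -> smooth C U (F i)) -> smooth C U (fun p => \sum_(i <- r | P i) F i p).
Proof.
move=> oU sF; elim: r => [|i r IH].
  by apply: smooth_ext (smooth_cst U 0) => // p _; rewrite big_nil.
have [Pi|Pi] := boolP (P i); last first.
  by apply: smooth_ext IH => // p _; rewrite big_cons (negbTE Pi).
by apply: smooth_ext (smoothD oU (sF i Pi) IH) => // p _; rewrite big_cons Pi.
Qed.

(** One chart covering [V] suffices: any other chart expression is the composite with a smooth
    transition map. *)
Lemma smooth_of_chart c V f : open V -> V `<=` cdom C c ->
  Cinfty (coord C c @` V) (f \o param C c) -> smooth C V f.
Proof.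
move=> oV Vc sf d k.
apply: (@Ck_ext _ _ _ _ ((f \o param C c) \o (coord C c \o param C d))).
- exact: open_img.
- by move=> z [q [dq Vq] <-] /=; rewrite (mfd_coordK hC dq) (mfd_coordK hC)//; exact: Vc.
apply: Ck_comp (sf k) _; first exact: open_img.
  by move=> z [q [dq Vq] <-] /=; exists q => //; rewrite (mfd_coordK hC dq).
move=> i; apply: Ck_sub (mfd_transition hC d c i k).
by move=> z [q [dq Vq] <-]; exists q => //; split=> //; exact: Vc.
Qed.

Lemma smooth_coord c i : smooth C (cdom C c) (fun q => coord C c q 0 i).
Proof. by move=> d k; exact: mfd_transition hC d c i k. Qed.

Lemma smooth_differentiable V f c q : V q -> cdom C c q -> smooth C V f ->
  differentiable (f \o param C c : _ -> R^o) (coord C c q).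
Proof. by move=> Vq cq sf; apply: (sf c 1%N).1; exact: mem_img. Qed.

Lemma near_chart c q V (P : 'rV[R]_n -> Prop) : open V -> V q -> cdom C c q ->
  (forall r, cdom C c r -> V r -> P (coord C c r)) ->
  \forall z \near coord C c q, P z.
Proof.
move=> oV Vq cq H; have HV z : img c V z -> P z.
  by move=> [r [cr Vr] <-]; exact: H.
exact: (open_near (open_img c oV) (mem_img cq Vq) HV).
Qed.

(** The chain rule for the transition map; the factorization through chart [d] only holds near the
    point. *)
Lemma derive_change_chart V f c d q v : open V -> V q -> cdom C c q -> cdom C d q ->
  smooth C V f ->
  'D_v (f \o param C c : _ -> R^o) (coord C c q) =
  \sum_j 'D_v (fun z => coord C d (param C c z) 0 j : R^o) (coord C c q)
     * 'D_(delta_mx 0 j) (f \o param C d : _ -> R^o) (coord C d q).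
Proof.
move=> oV Vq cq dq sf.
pose g := coord C d \o param C c.
have gq : g (coord C c q) = coord C d q by rewrite /g /= (mfd_coordK hC).
rewrite (@near_eq_derive _ _ _ _ ((f \o param C d) \o g)); last first.
  apply: (near_chart (openI oV (mfd_dom_open hC d)) (conj Vq dq)) => // r cr [Vr dr].
  by rewrite /g /= (mfd_coordK hC cr) (mfd_coordK hC dr).
rewrite derive_compf ?gq//; first exact: smooth_differentiable sf.
by move=> i; exact: smooth_differentiable (@smooth_coord d i).
Qed.

Lemma dir_linear V f p : open V -> V p -> smooth C V f ->
  forall v, dir C f p v = \sum_j v 0 j * dir C f p (delta_mx 0 j).
Proof.
move=> oV Vp sf v; apply: derive_linear.
exact: (smooth_differentiable Vp (mfd_dom_center hC p) sf).
Qed.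

Lemma dir_linearP V f p : open V -> V p -> smooth C V f ->
  forall a u v, dir C f p (a *: u + v) = a * dir C f p u + dir C f p v.
Proof.
move=> oV Vp sf a u v; rewrite !(dir_linear oV Vp sf (_ + _)).
rewrite (dir_linear oV Vp sf u) (dir_linear oV Vp sf v) mulr_sumr -big_split.
by apply: eq_bigr => i _; rewrite !mxE mulrDl mulrA.
Qed.

Lemma dir_ext V f g p v : open V -> V p -> (forall q, V q -> f q = g q) ->
  dir C f p v = dir C g p v.
Proof.
move=> oV Vp fg; apply: near_eq_derive.
apply: (near_chart oV Vp (mfd_dom_center hC p)) => r pr Vr /=.
by rewrite (mfd_coordK hC pr) fg.
Qed.

Lemma dir_cst (a : R) p v : dir C (fun=> a) p v = 0.
Proof. exact: derive_cst. Qed.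

Lemma dirD V f g p v : V p -> smooth C V f -> smooth C V g ->
  dir C (fun q => f q + g q) p v = dir C f p v + dir C g p v.
Proof.
by move=> Vp sf sg; apply: derive_addf; exact: smooth_differentiable Vp (mfd_dom_center hC p) _.
Qed.

Lemma dirM V f g p v : V p -> smooth C V f -> smooth C V g ->
  dir C (fun q => f q * g q) p v = f p * dir C g p v + g p * dir C f p v.
Proof.
move=> Vp sf sg; have cp := mfd_dom_center hC p.
rewrite /dir (derive_mulf v (smooth_differentiable Vp cp sf) (smooth_differentiable Vp cp sg)).
by rewrite /= (mfd_coordK hC cp).
Qed.

Lemma dirZ V (a : R) g p v : V p -> smooth C V g ->
  dir C (fun q => a * g q) p v = a * dir C g p v.
Proof.
by move=> Vp sg; rewrite (dirM _ Vp (smooth_cst V a) sg) dir_cst mulr0 addr0.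
Qed.

Lemma dirN V g p v : V p -> smooth C V g ->
  dir C (fun q => - g q) p v = - dir C g p v.
Proof.
move=> Vp sg; rewrite -mulN1r -(dirZ (-1) v Vp sg); congr (dir C _ p v).
by apply/funext => q; rewrite mulN1r.
Qed.

Lemma dir_sum V (I : Type) (r : seq I) (P : pred I) (F : I -> M -> R) p v :
  open V -> V p -> (forall i, P i -> smooth C V (F i)) ->
  dir C (fun q => \sum_(i <- r | P i) F i q) p v = \sum_(i <- r | P i) dir C (F i) p v.
Proof.
move=> oV Vp sF; elim: r => [|i r IH].
  rewrite big_nil -[RHS](dir_cst 0 p v); congr (dir C _ p v).
  by apply/funext => q; rewrite big_nil.
rewrite big_cons; have [Pi|Pi] := boolP (P i); last first.
  rewrite -IH; congr (dir C _ p v).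
  by apply/funext => q; rewrite big_cons (negbTE Pi).
rewrite -IH -(dirD v Vp (sF i Pi) (smooth_sum r oV sF)); congr (dir C _ p v).
by apply/funext => q; rewrite big_cons Pi.
Qed.

(** A tangent vector at [q] is given in the chart indexed by [q], so its components vary with the
    chart. Passing to one fixed chart [c] is what makes smoothness in [q] and second derivatives
    accessible. *)
Lemma dir_chart V f c q v : open V -> V q -> cdom C c q -> smooth C V f ->
  dir C f q v = \sum_j dir C (fun r => coord C c r 0 j) q v
     * 'D_(delta_mx 0 j) (f \o param C c : _ -> R^o) (coord C c q).
Proof. by move=> oV Vq cq sf; exact: (derive_change_chart v oV Vq (mfd_dom_center hC q) cq sf). Qed.

Lemma dir_coord p i v : dir C (fun r => coord C p r 0 i) p v = v 0 i.
Proof.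
rewrite /dir -[RHS](derive_coord (coord C p p) v 0 i); apply: near_eq_derive.
apply: (near_chart (mfd_dom_open hC p)) => [||r pr _ /=]; try exact: mfd_dom_center.
by rewrite (mfd_coordK hC pr).
Qed.

Lemma dir_const_vfield V f c q v : open V -> V q -> cdom C c q -> smooth C V f ->
  dir C f q (const_vfield C c v q) = 'D_v (f \o param C c : _ -> R^o) (coord C c q).
Proof.
move=> oV Vq cq sf; have qq := mfd_dom_center hC q.
rewrite (derive_change_chart v oV Vq cq qq sf) (dir_linear oV Vq sf).
by apply: eq_bigr => j _; rewrite mxE.
Qed.

Lemma const_vfield_center p v : const_vfield C p v p = v.
Proof.
by apply/rowP => i; rewrite mxE; exact: dir_coord.
Qed.

Lemma smooth_derive V f c v : open V -> V `<=` cdom C c -> smooth C V f ->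
  smooth C V (fun q => 'D_v (f \o param C c : _ -> R^o) (coord C c q)).
Proof.
move=> oV Vc sf; apply: (smooth_of_chart oV Vc) => k.
have -> : coord C c @` V = img c V by rewrite setIidr.
apply: Ck_ext ((sf c k.+1).2 v); first exact: open_img.
by move=> z [q [cq Vq] <-] /=; rewrite (mfd_coordK hC cq).
Qed.

Lemma smooth_const_vfield c v : smooth_vfield C (cdom C c) (const_vfield C c v).
Proof.
move=> V f oV Vc sf; apply: smooth_ext (smooth_derive v oV Vc sf) => // q Vq.
by rewrite (dir_const_vfield v oV Vq (Vc _ Vq) sf).
Qed.

Lemma smooth_dir V f X : open V -> smooth C V f -> smooth_vfield C V X ->
  smooth C V (fun q => dir C f q (X q)).
Proof. by move=> oV sf; apply. Qed.

Lemma smooth_vfield_sub U V X : V `<=` U -> smooth_vfield C U X -> smooth_vfield C V X.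
Proof. by move=> VU sX W f oW WV; apply: sX => // q /WV /VU. Qed.

Lemma smooth_form_sub U V a : V `<=` U -> smooth_form C U a -> smooth_form C V a.
Proof. by move=> VU sa W X oW WV; apply: sa => // q /WV /VU. Qed.

Lemma pairing_df V f p v : open V -> V p -> smooth C V f ->
  pairing v (df C f p) = dir C f p v.
Proof.
move=> oV Vp sf; rewrite (dir_linear oV Vp sf) /pairing mxE.
by apply: eq_bigr => i _; rewrite !mxE.
Qed.

Lemma smooth_df V f : open V -> smooth C V f -> smooth_form C V (df C f).
Proof.
move=> oV sf W X oW WV sX.
have sfW := smooth_sub WV sf.
apply: smooth_ext (smooth_dir oW sfW sX) => // p Wp.
by rewrite (pairing_df _ oW Wp sfW).
Qed.

End ManifoldCalculus.

(** * Maps between manifolds *)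

Arguments open_img {R n M C} _ c {U} _.

Lemma Ck_row_mx (R : realType) l m n k W (f : 'rV[R]_l -> 'rV[R]_m)
    (g : 'rV[R]_l -> 'rV[R]_n) :
  (forall i, Ck k W (fun s => f s 0 i)) -> (forall i, Ck k W (fun s => g s 0 i)) ->
  forall i, Ck k W (fun s => row_mx (f s) (g s) 0 i).
Proof.
move=> cf cg i; case: (split_ordP i) => j ->.
  by rewrite (_ : (fun s => _) = fun s => f s 0 j)//; apply/funext => s; rewrite row_mxEl.
by rewrite (_ : (fun s => _) = fun s => g s 0 j)//; apply/funext => s; rewrite row_mxEr.
Qed.

Section SmoothMaps.
Context (R : realType) (m n : nat) (M N : topologicalType).
Context (C : atlas R m M) (D : atlas R n N).
Hypotheses (hC : is_manifold C) (hD : is_manifold D).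

Lemma open_preimage (F : M -> N) V : smooth_map C D F -> open V -> open (F @^-1` V).
Proof. by move=> [cF _] oV; apply: open_comp => // p _; exact: cF. Qed.

(** The chain rule for [F] read in the charts at [p] and [F p], on a neighbourhood that [F] maps
    into the second chart. *)
Lemma dir_tangent_map (F : M -> N) V f p v : smooth_map C D F ->
  open V -> V (F p) -> smooth D V f ->
  dir D f (F p) (tangent_map C D F p v) = dir C (f \o F) p v.
Proof.
move=> sF oV Vp sf.
have pp := mfd_dom_center hC p; have qq := mfd_dom_center hD (F p).
pose W := F @^-1` (V `&` cdom D (F p)).
have oW : open W by apply: open_preimage => //; apply: openI => //; exact: mfd_dom_open.
have Wp : W p by split.
have sFj j : smooth C W (fun q => coord D (F p) (F q) 0 j).
  have sj : smooth D (V `&` cdom D (F p)) (fun r => coord D (F p) r 0 j).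
    by apply: smooth_sub (smooth_coord hD (F p) j) => ? [].
  exact: (sF.2 _ _ (openI oV (mfd_dom_open hD (F p))) sj).
rewrite (dir_linear hD oV Vp sf).
pose g := coord D (F p) \o F \o param C p.
have gp : g (coord C p p) = coord D (F p) (F p) by rewrite /g /= (mfd_coordK hC pp).
rewrite [RHS](@near_eq_derive _ _ _ _ ((f \o param D (F p)) \o g)); last first.
  apply: (near_chart hC oW Wp pp) => r pr [Vr Dr].
  by rewrite /g /= (mfd_coordK hC pr) (mfd_coordK hD Dr).
rewrite derive_compf ?gp; first by apply: eq_bigr => j _; rewrite mxE.
  exact: smooth_differentiable Vp qq sf.
by move=> j; exact: smooth_differentiable Wp pp (sFj j).
Qed.

(** The two difference quotients are the same function. *)
Lemma derive_rowr (f : 'rV[R]_(m + n) -> R^o) (s : 'rV[R]_m) (t v : 'rV[R]_n) :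
  'D_v (fun t => f (row_mx s t)) t = 'D_(row_mx 0 v) f (row_mx s t).
Proof.
rewrite /derive; set G := fun h => _; set H := fun h => _.
suff -> : G = H by []; apply/funext => h; rewrite /G /H /=; congr (_ *: (f _ - _)).
by rewrite scale_row_mx scaler0 add_row_mx add0r.
Qed.

Lemma derive_rowl (f : 'rV[R]_(m + n) -> R^o) (s u : 'rV[R]_m) (t : 'rV[R]_n) :
  'D_u (fun s => f (row_mx s t)) s = 'D_(row_mx u 0) f (row_mx s t).
Proof.
rewrite /derive; set G := fun h => _; set H := fun h => _.
suff -> : G = H by []; apply/funext => h; rewrite /G /H /=; congr (_ *: (f _ - _)).
by rewrite scale_row_mx scaler0 add_row_mx add0r.
Qed.

(** * Partial derivatives on a product of manifolds *)

Section Product.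
Variables (O : set (M * N)) (Phi : M * N -> R).
Hypotheses (oO : open O) (sPhi : smooth (prod_atlas C D) O Phi).

Local Notation chart c d := (fun z : 'rV[R]_(m + n) =>
  Phi (param C c (lsubmx z), param D d (rsubmx z)) : R^o).
Local Notation img c d :=
  (coord (prod_atlas C D) (c, d) @` (cdom (prod_atlas C D) (c, d) `&` O)).

(** Each point of [O] has a product of open sets around it, and their coordinate images are open in
    the two factors. *)
Lemma open_prod_img c d : open (img c d).
Proof.
rewrite openE => _ [[z h] [[/= cz dh] Ozh] <-] /=.
have : nbhs (z, h) (O `&` (cdom C c `*` cdom D d)).
  apply: filterI; first exact: open_nbhs_nbhs.
  by exists (cdom C c, cdom D d) => //; split; apply: open_nbhs_nbhs; split=> //;
     [exact: mfd_dom_open|exact: mfd_dom_open].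
move=> [[A B] /= [nA nB] AB].
have oA := open_interior A; have oB := open_interior B.
have zA : A° z by []; have hB : B° h by [].
have cl := @differentiable_continuous _ _ _ _ _
   (@differentiable_lsubmx R 1 m n (row_mx (coord C c z) (coord D d h))).
have cr := @differentiable_continuous _ _ _ _ _
   (@differentiable_rsubmx R 1 m n (row_mx (coord C c z) (coord D d h))).
have nl : \forall s \near coord C c z, (coord C c @` (cdom C c `&` A°)) s.
  exact: (near_chart hC oA zA cz (fun r cr Ar => mem_img cr Ar)).
have nr : \forall s \near coord D d h, (coord D d @` (cdom D d `&` B°)) s.
  exact: (near_chart hD oB hB dh (fun r cr Ar => mem_img cr Ar)).
rewrite /interior.
have nl' := cl _ _; have nr' := cr _ _.
move: nl' nr'; rewrite /= row_mxKl row_mxKr => /(_ _ nl) nl' /(_ _ nr) nr'.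
set w0 := row_mx _ _ in nl' nr' *.
have {}nl' : \forall w \near w0, (coord C c @` (cdom C c `&` A°)) (lsubmx w) := nl'.
have {}nr' : \forall w \near w0, (coord D d @` (cdom D d `&` B°)) (rsubmx w) := nr'.
near=> w; have : (coord C c @` (cdom C c `&` A°)) (lsubmx w) by near: w.
have : (coord D d @` (cdom D d `&` B°)) (rsubmx w) by near: w.
move=> [h' [dh' Bh'] eh] [z' [cz' Az'] ez].
exists (z', h') => /=; last by rewrite ez eh hsubmxK.
split=> //; have [] // := AB (z', h').
by split; [exact: interior_subset Az'|exact: interior_subset Bh'].
Unshelve. all: by end_near. Qed.

Lemma open_slicel h : open [set z | O (z, h)].
Proof.
apply: (@open_comp _ _ (fun z => (z, h)) O) => // z _.
by apply: cvg_pair => //=; exact: cvg_cst.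
Qed.

Lemma open_slicer z : open [set h | O (z, h)].
Proof.
apply: (@open_comp _ _ (fun h => (z, h)) O) => // h _.
by apply: cvg_pair => //=; exact: cvg_cst.
Qed.

Lemma smooth_slicer z : smooth D [set h | O (z, h)] (fun h => Phi (z, h)).
Proof.
move=> d k; apply: (@Ck_ext _ _ _ _ (chart z d \o (fun s => row_mx (coord C z z) s))).
- exact: (open_img hD d (open_slicer z)).
- by move=> s [h [dh Oh] <-]; rewrite /= row_mxKl row_mxKr (mfd_coordK hC) //;
  exact: mfd_dom_center.
apply: Ck_comp (sPhi (z, d) k) _; first exact: (open_img hD d (open_slicer z)).
  move=> s [h [dh Oh] <-]; exists (z, h) => //; do 2?split => //; exact: mfd_dom_center.
by apply: Ck_row_mx => i; [exact: Ck_cst|exact: Ck_coord].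
Qed.

Lemma dir_slicer_chart c q v s :
  dir D (fun h => Phi (param C c s, h)) q v
  = 'D_(row_mx 0 v) (chart c q) (row_mx s (coord D q q)).
Proof.
rewrite -(@derive_rowr (chart c q)).
have -> : (fun t => chart c q (row_mx s t)) = (fun h => Phi (param C c s, h)) \o param D q.
  by apply/funext => t; rewrite /= row_mxKl row_mxKr.
by [].
Qed.

Lemma dir_slicel_chart p d u t :
  dir C (fun z => Phi (z, param D d t)) p u
  = 'D_(row_mx u 0) (chart p d) (row_mx (coord C p p) t).
Proof.
rewrite -(@derive_rowl (chart p d)).
have -> : (fun s => chart p d (row_mx s t)) = (fun z => Phi (z, param D d t)) \o param C p.
  by apply/funext => s; rewrite /= row_mxKl row_mxKr.
by [].
Qed.

(** Applied to the multiplication at [q] the unit, this gives the smoothness of left-invariant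
    vector fields. *)
Lemma smooth_dir_slicer q v :
  smooth C [set z | O (z, q)] (fun z => dir D (fun h => Phi (z, h)) q v).
Proof.
move=> c k.
apply: (@Ck_ext _ _ _ _ ('D_(row_mx 0 v) (chart c q) \o (fun s => row_mx s (coord D q q)))).
- exact: (open_img hC c (open_slicel q)).
- by move=> s [z [cz Oz] <-]; rewrite /= dir_slicer_chart.
apply: Ck_comp ((sPhi (c, q) k.+1).2 _) _; first exact: (open_img hC c (open_slicel q)).
  move=> s [z [cz Oz] <-]; exists (z, q) => //; do 2?split => //; exact: mfd_dom_center.
by apply: Ck_row_mx => i; [exact: Ck_coord|exact: Ck_cst].
Qed.

Lemma smooth_dir_slicel p u :
  smooth D [set h | O (p, h)] (fun h => dir C (fun z => Phi (z, h)) p u).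
Proof.
move=> d k.
apply: (@Ck_ext _ _ _ _ ('D_(row_mx u 0) (chart p d) \o (fun t => row_mx (coord C p p) t))).
- exact: (open_img hD d (open_slicer p)).
- by move=> s [h [dh Oh] <-]; rewrite /= dir_slicel_chart.
apply: Ck_comp ((sPhi (p, d) k.+1).2 _) _; first exact: (open_img hD d (open_slicer p)).
  move=> s [h [dh Oh] <-]; exists (p, h) => //; do 2?split => //; exact: mfd_dom_center.
by apply: Ck_row_mx => i; [exact: Ck_cst|exact: Ck_coord].
Qed.

(** Both sides are iterated derivatives of one function in the product chart at [(p, q)], so
    [schwarz] applies. *)
Lemma dir_dirC p q u v : O (p, q) ->
  dir C (fun z => dir D (fun h => Phi (z, h)) q v) p u
  = dir D (fun h => dir C (fun z => Phi (z, h)) p u) q v.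
Proof.
move=> Opq; rewrite {1}/dir.
rewrite (_ : _ \o _ = fun s => 'D_(row_mx 0 v) (chart p q) (row_mx s (coord D q q))); last first.
  by apply/funext => s /=; rewrite dir_slicer_chart.
rewrite [RHS]/dir.
rewrite (_ : (fun h => _) \o _ =
    fun t => 'D_(row_mx u 0) (chart p q) (row_mx (coord C p p) t)); last first.
  by apply/funext => t /=; rewrite dir_slicel_chart.
transitivity ('D_(row_mx u 0) ('D_(row_mx 0 v) (chart p q)) (row_mx (coord C p p) (coord D q q))).
  exact: derive_rowl.
transitivity ('D_(row_mx 0 v) ('D_(row_mx u 0) (chart p q)) (row_mx (coord C p p) (coord D q q)));
  last first.
  by apply/esym; exact: derive_rowr.
apply: (schwarz (W := img p q)); first exact: open_prod_img.
  by exists (p, q) => //; do 2?split => //; exact: mfd_dom_center.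
exact: (sPhi (p, q) 2).
Qed.

(** The partial derivative is evaluated along a graph. With [iota] the group inverse and [Phi] a
    coordinate of the product, this is the smoothness of left-invariant forms. *)
Lemma smooth_dir_graph (iota : N -> M) V X : open V -> smooth_map D C iota ->
  (forall z, V z -> O (iota z, z)) -> smooth_vfield D V X ->
  smooth D V (fun z => dir D (fun h => Phi (iota z, h)) z (X z)).
Proof.
move=> oV si OV sX; apply: smooth_local => p Vp.
pose W := V `&` cdom D p `&` iota @^-1` (cdom C (iota p)).
have oi : open (iota @^-1` cdom C (iota p)).
  by apply: open_comp (mfd_dom_open hC _) => z _; exact: si.1.
have oW : open W by apply: openI => //; apply: openI => //; exact: mfd_dom_open.
have Wp : W p by split; [split=> //; exact: mfd_dom_center|exact: mfd_dom_center].
exists W => //.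
have sXW : smooth_vfield D W X by apply: smooth_vfield_sub sX => z [[]].
(* The same derivative in the fixed charts at [iota p] and [p]; [W] is small enough for both charts
   to apply. *)
pose F z := \sum_j dir D (fun r => coord D p r 0 j) z (X z) *
  'D_(row_mx 0 (delta_mx 0 j)) (chart (iota p) p)
     (row_mx (coord C (iota p) (iota z)) (coord D p z)).
have sF : smooth D W F.
  apply: smooth_sum => // j _; apply: smoothM => //.
    apply: smooth_dir => //; apply: smooth_sub (smooth_coord hD p j).
    by move=> z [[]].
  apply: (smooth_of_chart hD (c := p) oW) => [z [[]]//|k].
  pose g s := row_mx (coord C (iota p) (iota (param D p s))) s.
  have oim : open (coord D p @` W).
    rewrite (_ : W = cdom D p `&` W); first exact: open_img.
    by rewrite setIidr// => z [[]].
  apply: (@Ck_ext _ _ _ _ ('D_(row_mx 0 (delta_mx 0 j)) (chart (iota p) p) \o g)) => //.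
    by move=> s [z [[Vz pz] iz] <-]; rewrite /= /g (mfd_coordK hD).
  apply: Ck_comp ((sPhi (iota p, p) k.+1).2 _) _ => //.
    move=> s [z [[Vz pz] iz] <-]; exists (iota z, z); last by rewrite /g (mfd_coordK hD).
    by do 2?split => //; exact: OV.
  apply: Ck_row_mx => i; last exact: Ck_coord.
  have := si.2 _ _ (mfd_dom_open hC (iota p)) (smooth_coord hC (iota p) i) p k.
  by apply: Ck_sub => s [z [[Vz pz] iz] <-]; exists z.
apply: smooth_ext sF => // z [[Vz pz] iz].
rewrite /F (dir_chart hD _ (open_slicer (iota z)) (OV _ Vz) pz (smooth_slicer (iota z))).
apply: eq_bigr => j _; congr (_ * _); set s := coord C _ _.
transitivity ('D_(delta_mx 0 j) (fun t => chart (iota p) p (row_mx s t)) (coord D p z)).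
  by apply/esym; exact: derive_rowr.
have -> : (fun t => chart (iota p) p (row_mx s t)) = (fun h => Phi (iota z, h)) \o param D p.
  by apply/funext => t; rewrite /= row_mxKl row_mxKr (mfd_coordK hC).
by [].
Qed.

End Product.
End SmoothMaps.

(** * Vector fields, one-forms and Poisson brackets *)

Section Pairing.
Context (R : realType) (n : nat).
Implicit Types (v : 'rV[R]_n) (a : 'cV[R]_n).

Lemma pairingE v a : pairing v a = \sum_i v 0 i * a i 0.
Proof. by rewrite /pairing mxE. Qed.

Lemma pairingDl v w a : pairing (v + w) a = pairing v a + pairing w a.
Proof. by rewrite /pairing mulmxDl mxE. Qed.

Lemma pairingZl (c : R) v a : pairing (c *: v) a = c * pairing v a.
Proof. by rewrite /pairing -scalemxAl mxE. Qed.

Lemma pairingNl v a : pairing (- v) a = - pairing v a.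
Proof. by rewrite /pairing mulNmx mxE. Qed.

Lemma pairingDr v a b : pairing v (a + b) = pairing v a + pairing v b.
Proof. by rewrite /pairing mulmxDr mxE. Qed.

Lemma pairingZr (c : R) v a : pairing v (c *: a) = c * pairing v a.
Proof. by rewrite /pairing -scalemxAr mxE. Qed.

Lemma pairing_delta i a : pairing (delta_mx 0 i) a = a i 0.
Proof. by rewrite /pairing -rowE mxE. Qed.

End Pairing.

Section VectorFields.
Context (R : realType) (n : nat) (M : topologicalType) (C : atlas R n M).
Hypothesis hC : is_manifold C.
Implicit Types (U V W : set M) (f g h : M -> R) (p q c : M) (X Y : vfield R n M)
  (a b : form R n M).

(* Typing the derivative in [R] instead of [R^o] keeps the ring operations on it syntactically uniform. *)
Definition chart_deriv c (v : 'rV[R]_n) f q : R :=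
  'D_v (f \o param C c : _ -> R^o) (coord C c q).

Lemma dir_chart_deriv V f c q v : open V -> V q -> cdom C c q -> smooth C V f ->
  dir C f q v = \sum_j dir C (fun r => coord C c r 0 j) q v
     * chart_deriv c (delta_mx 0 j) f q.
Proof. exact: dir_chart. Qed.

Lemma smooth_chart_deriv V f c v : open V -> V `<=` cdom C c -> smooth C V f ->
  smooth C V (chart_deriv c v f).
Proof. exact: smooth_derive. Qed.

Lemma chart_derivC U f p u v : open U -> U p -> smooth C U f ->
  chart_deriv p u (chart_deriv p v f) p = chart_deriv p v (chart_deriv p u f) p.
Proof.
move=> oU Up sf; have pp := mfd_dom_center hC p.
have E u' v' : chart_deriv p u' (chart_deriv p v' f) p
    = 'D_u' ('D_v' (f \o param C p : _ -> R^o)) (coord C p p).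
  apply: near_eq_derive; apply: (near_chart hC oU Up pp) => r pr _.
  by rewrite /chart_deriv /= (mfd_coordK hC pr).
rewrite !E; apply: (schwarz (W := coord C p @` (cdom C p `&` U))).
- exact: open_img.
- exact: mem_img.
- exact: (sf p 2).
Qed.

Lemma smooth_coord_dir p X V j : open V -> V `<=` cdom C p -> smooth_vfield C V X ->
  smooth C V (fun q => dir C (fun r => coord C p r 0 j) q (X q)).
Proof.
by move=> oV Vp sX; apply: smooth_dir => //; apply: smooth_sub (smooth_coord hC p j).
Qed.

(** The bracket is defined by its action on coordinate functions. It acts as a commutator on every
    function because the second-order terms are symmetric in the two fields and cancel. *)
Lemma dir_vbracket U f X Y p : open U -> U p -> smooth C U f ->
  smooth_vfield C U X -> smooth_vfield C U Y ->
  dir C f p (vbracket C X Y p)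
  = dir C (fun q => dir C f q (Y q)) p (X p) - dir C (fun q => dir C f q (X q)) p (Y p).
Proof.
move=> oU Up sf sX sY.
pose V := U `&` cdom C p; have pp := mfd_dom_center hC p.
have oV : open V by apply: openI => //; exact: mfd_dom_open.
have Vp : V p by []; have Vd : V `<=` cdom C p by move=> ? [].
have VU : V `<=` U by move=> ? [].
have sfV := smooth_sub VU sf.
have sXV := smooth_vfield_sub VU sX; have sYV := smooth_vfield_sub VU sY.
pose xd (Z : vfield R n M) j q := dir C (fun r => coord C p r 0 j) q (Z q).
have sxd Z j : smooth_vfield C V Z -> smooth C V (xd Z j).
  by move=> sZ; exact: smooth_coord_dir.
pose D j := chart_deriv p (delta_mx 0 j) f.
have sD j : smooth C V (D j) by exact: smooth_chart_deriv.
have fE Z q : V q -> dir C f q (Z q) = \sum_j xd Z j q * D j q.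
  by move=> Vq; rewrite (dir_chart_deriv _ oV Vq (Vd q Vq) sfV).
have xdp Z j : xd Z j p = Z p 0 j by rewrite /xd (dir_coord hC).
pose D2 i j := chart_deriv p (delta_mx 0 i) (D j) p.
have D2C i j : D2 i j = D2 j i by exact: chart_derivC sfV.
have step Z T : smooth_vfield C V Z -> smooth_vfield C V T ->
    dir C (fun q => dir C f q (T q)) p (Z p)
    = \sum_j dir C (xd T j) p (Z p) * D j p + \sum_j \sum_i T p 0 j * Z p 0 i * D2 i j.
  move=> sZ sT; rewrite (dir_ext hC _ oV Vp (fE T)) (dir_sum hC _ _ oV Vp); last first.
    by move=> j _; apply: smoothM => //; exact: sxd.
  rewrite -big_split; apply: eq_bigr => j _ /=.
  rewrite (dirM hC _ Vp (sxd T j sT) (sD j)) addrC [D j p * _]mulrC; congr (_ + _).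
  rewrite xdp (dir_chart_deriv _ oV Vp pp (sD j)) mulr_sumr; apply: eq_bigr => i _.
  by rewrite (dir_coord hC) mulrA.
rewrite (step _ _ sXV sYV) (step _ _ sYV sXV).
(* The second-order parts of the two iterated derivatives agree by symmetry of [D2]. *)
have -> : \sum_j \sum_i X p 0 j * Y p 0 i * D2 i j
   = \sum_j \sum_i Y p 0 j * X p 0 i * D2 i j.
  rewrite exchange_big; apply: eq_bigr => j _; apply: eq_bigr => i _.
  by rewrite D2C; congr (_ * _); exact: mulrC.
have cancel (x y z : R) : x + z - (y + z) = x - y by ring.
rewrite cancel -sumrB (fE (fun=> vbracket C X Y p) p Vp).
by apply: eq_bigr => j _; rewrite xdp [vbracket _ _ _ _ _ _]mxE mulrBl.
Qed.

Lemma vbracketE X Y p j : vbracket C X Y p 0 j =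
  dir C (fun q => dir C (fun r => coord C p r 0 j) q (Y q)) p (X p)
  - dir C (fun q => dir C (fun r => coord C p r 0 j) q (X q)) p (Y p).
Proof. by rewrite mxE. Qed.

Lemma dir_dir_linear V g f X X' p v : open V -> V p -> smooth C V g -> smooth C V f ->
  smooth_vfield C V X -> smooth_vfield C V X' ->
  dir C (fun q => dir C g q (f q *: X q + X' q)) p v
  = f p * dir C (fun q => dir C g q (X q)) p v + dir C g p (X p) * dir C f p v
    + dir C (fun q => dir C g q (X' q)) p v.
Proof.
move=> oV Vp sg sf sX sX'.
rewrite (@dir_ext _ _ _ _ hC V _ (fun q => f q * dir C g q (X q) + dir C g q (X' q)) _ _ oV Vp).
  have sX1 := smooth_dir oV sg sX; have sX2 := smooth_dir oV sg sX'.
  by rewrite (dirD hC _ Vp (smoothM hC oV sf sX1) sX2) (dirM hC _ Vp sf sX1).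
by move=> q Vq; rewrite (dir_linearP hC oV Vq sg).
Qed.

Lemma vbracket_linear U f X X' Y p : open U -> U p -> smooth C U f ->
  smooth_vfield C U X -> smooth_vfield C U X' -> smooth_vfield C U Y ->
  vbracket C (fun q => f q *: X q + X' q) Y p
  = f p *: vbracket C X Y p + vbracket C X' Y p - dir C f p (Y p) *: X p.
Proof.
move=> oU Up sf sX sX' sY.
pose V := U `&` cdom C p; have pp := mfd_dom_center hC p.
have oV : open V by apply: openI => //; exact: mfd_dom_open.
have Vp : V p by []; have Vd : V `<=` cdom C p by move=> ? [].
have VU : V `<=` U by move=> ? [].
have sfV := smooth_sub VU sf.
have sXV := smooth_vfield_sub VU sX; have sYV := smooth_vfield_sub VU sY.
have sXV' := smooth_vfield_sub VU sX'.
apply/rowP => j.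
have lin (x y : R) (u v w : 'rV[R]_n) :
    (x *: u + v - y *: w) 0 j = x * u 0 j + v 0 j - y * w 0 j by rewrite !mxE.
apply: etrans (etrans (vbracketE _ _ _ _) _) (esym (lin _ _ _ _ _)).
pose vb Z := dir C (fun q => dir C (fun r => coord C p r 0 j) q (Y q)) p (Z p)
  - dir C (fun q => dir C (fun r => coord C p r 0 j) q (Z q)) p (Y p).
transitivity (f p * vb X + vb X' - dir C f p (Y p) * X p 0 j); last first.
  by congr (_ * _ + _ - _); apply/esym/vbracketE.
rewrite /vb.
have sx : smooth C V (fun r => coord C p r 0 j) by exact: smooth_sub (smooth_coord hC p j).
have sY' := smooth_coord_dir j oV Vd sYV.
rewrite (dir_dir_linear (Y p) oV Vp sx sfV sXV sXV').
rewrite (dir_linearP hC oV Vp sY') (dir_coord hC).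
set d1 := dir _ _ _ _; set d2 := dir _ _ _ _; set d3 := dir _ _ _ _.
set d4 := dir _ _ _ _; set d5 := dir _ _ _ _.
ring.
Qed.

Lemma vbracket_ext V X X' Y p : open V -> V p -> (forall q, V q -> X q = X' q) ->
  vbracket C X Y p = vbracket C X' Y p.
Proof.
move=> oV Vp XX'; apply/rowP => j.
apply: etrans (vbracketE _ _ _ _) (etrans _ (esym (vbracketE _ _ _ _))).
apply: (f_equal2 (fun x y : R => x - y)); first by rewrite (XX' _ Vp).
by apply: (dir_ext hC _ oV Vp) => q Vq; rewrite XX'.
Qed.

Lemma smooth_pairing U X a : open U -> smooth_vfield C U X -> smooth_form C U a ->
  smooth C U (fun q => pairing (X q) (a q)).
Proof. by move=> oU sX; apply. Qed.

Lemma smooth_form0 U : smooth_form C U (fun=> 0).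
Proof.
move=> W Y oW _ _; rewrite (_ : (fun p => _) = fun=> 0); first exact: smooth_cst.
by apply/funext => q; rewrite /pairing mulmx0 mxE.
Qed.

Lemma smooth_form_ext U a b : (forall q, U q -> a q = b q) -> smooth_form C U a ->
  smooth_form C U b.
Proof.
move=> ab sa W Y oW WU sY; apply: (smooth_ext hC oW) (sa W Y oW WU sY) => q Wq.
by rewrite ab//; exact: WU.
Qed.

Lemma smooth_form_linear U f a b : open U -> smooth C U f -> smooth_form C U a ->
  smooth_form C U b -> smooth_form C U (fun q => f q *: a q + b q).
Proof.
move=> oU sf sa sb W Y oW WU sY.
have s1 := smooth_pairing oW sY (smooth_form_sub WU sa).
have s2 := smooth_pairing oW sY (smooth_form_sub WU sb).
apply: (smooth_ext hC oW) (smoothD hC oW (smoothM hC oW (smooth_sub WU sf) s1) s2).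
by move=> q Wq; rewrite pairingDr pairingZr.
Qed.

Lemma ext_d_linear U f a a' X Y p : open U -> U p -> smooth C U f ->
  smooth_form C U a -> smooth_form C U a' ->
  smooth_vfield C U X -> smooth_vfield C U Y ->
  ext_d C (fun q => f q *: a q + a' q) X Y p
  = f p * ext_d C a X Y p + ext_d C a' X Y p + dir C f p (X p) * pairing (Y p) (a p)
    - dir C f p (Y p) * pairing (X p) (a p).
Proof.
move=> oU Up sf sa sa' sX sY; rewrite /ext_d.
have pE Z v : smooth_vfield C U Z ->
    dir C (fun q => pairing (Z q) (f q *: a q + a' q)) p v
    = f p * dir C (fun q => pairing (Z q) (a q)) p v + pairing (Z p) (a p) * dir C f p v
      + dir C (fun q => pairing (Z q) (a' q)) p v.
  move=> sZ; have s1 := smooth_pairing oU sZ sa; have s2 := smooth_pairing oU sZ sa'.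
  rewrite -(dirM hC _ Up sf s1) -(dirD hC _ Up (smoothM hC oU sf s1) s2).
  by congr (dir C _ p v); apply/funext => q; rewrite pairingDr pairingZr.
rewrite !pE// pairingDr pairingZr; ring.
Qed.

End VectorFields.

(** * The bracket of one-forms of a Poisson structure *)

Section Poisson.
Context (R : realType) (n : nat) (M : topologicalType) (C : atlas R n M).
Hypothesis hC : is_manifold C.
Variable pi : M -> 'M[R]_n.
Hypothesis hpi : is_poisson C pi.
Implicit Types (U V W : set M) (f g h : M -> R) (p q c : M) (X Y : vfield R n M)
  (a b : form R n M).

Lemma sharp_antisym a b p : pairing (sharp pi a p) (b p) = - pairing (sharp pi b p) (a p).
Proof.
rewrite /pairing /sharp -[in LHS](trmxK (_ *m b p)) [in LHS]mxE !trmx_mul trmxK.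
by rewrite (pi_antisym hpi) mulNmx mulmxN mxE mulmxA.
Qed.

Lemma smooth_sharp U a : open U -> smooth_form C U a -> smooth_vfield C U (sharp pi a).
Proof.
move=> oU sa V f oV VU sf.
apply: smooth_ext (pi_smooth hpi oV (smooth_form_sub VU sa) (smooth_df hC oV sf)) => //.
by move=> q Vq; rewrite (pairing_df hC _ oV Vq sf).
Qed.

Lemma smooth_pi U a b : open U -> smooth_form C U a -> smooth_form C U b ->
  smooth C U (fun p => pairing (sharp pi a p) (b p)).
Proof. exact: pi_smooth. Qed.

Lemma smooth_pbracket U f h : open U -> smooth C U f -> smooth C U h ->
  smooth C U (pbracket C pi f h).
Proof. by move=> oU sf sh; apply: smooth_pi => //; exact: smooth_df. Qed.

Lemma pbracketE U f h p : open U -> U p -> smooth C U h ->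
  pbracket C pi f h p = dir C h p (sharp pi (df C f) p).
Proof. by move=> oU Up sh; rewrite /pbracket (pairing_df hC _ oU Up sh). Qed.

Lemma pbracket_antisym f h p : pbracket C pi f h p = - pbracket C pi h f p.
Proof. exact: sharp_antisym. Qed.

Lemma fbracketE a b p i : fbracket C pi a b p i 0 =
  lie_form C (sharp pi a) b (const_vfield C p (delta_mx 0 i)) p
  - ext_d C a (sharp pi b) (const_vfield C p (delta_mx 0 i)) p.
Proof. by rewrite mxE. Qed.

Lemma fbracket_ext V a a' b b' p : open V -> V p -> (forall q, V q -> a q = a' q) ->
  (forall q, V q -> b q = b' q) -> fbracket C pi a b p = fbracket C pi a' b' p.
Proof.
move=> oV Vp aa' bb'; apply/colP => i; rewrite !fbracketE /lie_form /ext_d.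
have Sa q : V q -> sharp pi a q = sharp pi a' q by move=> Vq; rewrite /sharp aa'.
have Sb q : V q -> sharp pi b q = sharp pi b' q by move=> Vq; rewrite /sharp bb'.
set Y := const_vfield C p _.
have pE a1 a2 X1 X2 v : (forall q, V q -> a1 q = a2 q) -> (forall q, V q -> X1 q = X2 q) ->
    dir C (fun q => pairing (X1 q) (a1 q)) p v = dir C (fun q => pairing (X2 q) (a2 q)) p v.
  by move=> a12 X12; apply: (dir_ext hC _ oV Vp) => q Vq; rewrite a12// X12.
rewrite (pE b b' Y Y _ bb' (fun _ _ => erefl)) (pE a a' Y Y _ aa' (fun _ _ => erefl)).
rewrite (pE a a' _ _ _ aa' Sb) (vbracket_ext hC _ oV Vp Sa) (vbracket_ext hC _ oV Vp Sb).
by rewrite (Sa p Vp) (Sb p Vp) (aa' p Vp) (bb' p Vp).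
Qed.

Lemma fbracket_linearl U f a a' b p : open U -> U p -> smooth C U f ->
  smooth_form C U a -> smooth_form C U a' -> smooth_form C U b ->
  fbracket C pi (fun q => f q *: a q + a' q) b p
  = f p *: fbracket C pi a b p + fbracket C pi a' b p - dir C f p (sharp pi b p) *: a p.
Proof.
move=> oU Up sf sa sa' sb.
pose V := U `&` cdom C p; have pp := mfd_dom_center hC p.
have oV : open V by apply: openI => //; exact: mfd_dom_open.
have Vp : V p by []; have Vd : V `<=` cdom C p by move=> ? [].
have VU : V `<=` U by move=> ? [].
have sfV := smooth_sub VU sf.
have {}sa := smooth_form_sub VU sa; have {}sa' := smooth_form_sub VU sa'.
have {}sb := smooth_form_sub VU sb.
have sXa := smooth_sharp oV sa; have sXa' := smooth_sharp oV sa'.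
have sXb := smooth_sharp oV sb.
apply/colP => i; rewrite fbracketE; set Y := const_vfield C p _.
have sY : smooth_vfield C V Y.
  exact: smooth_vfield_sub Vd (smooth_const_vfield hC (c := p) (delta_mx 0 i)).
have Yp : Y p = delta_mx 0 i by exact: const_vfield_center.
rewrite (ext_d_linear hC oV Vp)// /lie_form.
have -> : sharp pi (fun q => f q *: a q + a' q)
   = fun q => f q *: sharp pi a q + sharp pi a' q.
  by apply/funext => q; rewrite /sharp linearD linearZ /= mulmxDl -scalemxAl.
rewrite (vbracket_linear hC oV Vp)// !mxE -/Y /lie_form.
rewrite (dir_linearP hC oV Vp (smooth_pairing oV sY sb)).
rewrite !pairingDl pairingNl !pairingZl (sharp_antisym a b) Yp pairing_delta.
have ringE (x A A' B B' y z E E' w c : R) :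
  x * A + A' - (x * B + B' - y * - z) - (x * E + E' + w * c - y * z)
  = x * (A - B - E) + (A' - B' - E') - w * c by ring.
exact: ringE.
Qed.

Lemma fbracket_antisym U a b p : open U -> U p ->
  smooth_form C U a -> smooth_form C U b ->
  fbracket C pi a b p = - fbracket C pi b a p.
Proof.
move=> oU Up sa sb; apply/colP => i; rewrite [RHS]mxE !fbracketE /lie_form /ext_d.
rewrite (_ : (fun q => pairing (sharp pi b q) (a q))
   = fun q => - pairing (sharp pi a q) (b q)); last first.
  by apply/funext => q; rewrite sharp_antisym.
rewrite (dirN hC _ Up (smooth_pi oU sa sb)).
have ringE (x y z t u : R) : x - y - (z - - u - t) = - (z - t - (x - u - y)) by ring.
exact: ringE.
Qed.

Lemma fbracket_linearr U f a b b' p : open U -> U p -> smooth C U f ->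
  smooth_form C U a -> smooth_form C U b -> smooth_form C U b' ->
  fbracket C pi a (fun q => f q *: b q + b' q) p
  = f p *: fbracket C pi a b p + fbracket C pi a b' p + dir C f p (sharp pi a p) *: b p.
Proof.
move=> oU Up sf sa sb sb'.
have sfb : smooth_form C U (fun q => f q *: b q + b' q).
  move=> V X oV VU sX.
  have s1 := smooth_pairing oV sX (smooth_form_sub VU sb).
  have s2 := smooth_pairing oV sX (smooth_form_sub VU sb').
  apply: smooth_ext (smoothD hC oV (smoothM hC oV (smooth_sub VU sf) s1) s2) => //.
  by move=> q Vq; rewrite pairingDr pairingZr.
rewrite (fbracket_antisym oU Up sa sfb) (fbracket_linearl oU Up sf sb sb' sa).
rewrite (fbracket_antisym oU Up sb sa) (fbracket_antisym oU Up sb' sa).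
by rewrite scalerN !opprD !opprK.
Qed.

(** The form [df f] is closed, and the Lie derivative along its Hamiltonian field commutes with the
    differential of [h]. On a coordinate field both facts are [dir_vbracket]. *)
Lemma fbracket_df U f h p : open U -> U p -> smooth C U f -> smooth C U h ->
  fbracket C pi (df C f) (df C h) p = df C (pbracket C pi f h) p.
Proof.
move=> oU Up sf sh.
pose V := U `&` cdom C p; have pp := mfd_dom_center hC p.
have oV : open V by apply: openI => //; exact: mfd_dom_open.
have Vp : V p by []; have Vd : V `<=` cdom C p by move=> ? [].
have VU : V `<=` U by move=> ? [].
have {}sf := smooth_sub VU sf; have {}sh := smooth_sub VU sh.
have sXf := smooth_sharp oV (smooth_df hC oV sf).
have sXh := smooth_sharp oV (smooth_df hC oV sh).
apply/colP => i; rewrite fbracketE; set Y := const_vfield C p _.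
have sY : smooth_vfield C V Y.
  exact: smooth_vfield_sub Vd (smooth_const_vfield hC (c := p) (delta_mx 0 i)).
have Yp : Y p = delta_mx 0 i by exact: const_vfield_center.
have pE g (Z : vfield R n M) v : smooth C V g -> smooth_vfield C V Z ->
  dir C (fun q => pairing (Z q) (df C g q)) p v = dir C (fun q => dir C g q (Z q)) p v.
  by move=> sg sZ; apply: (dir_ext hC _ oV Vp) => q Vq; rewrite (pairing_df hC _ oV Vq sg).
rewrite /lie_form /ext_d (pE h Y _ sh sY) (pE f Y _ sf sY) (pE f _ _ sf sXh).
have e1 := etrans (pairing_df hC _ oV Vp sh) (dir_vbracket hC oV Vp sh sXf sY).
have e2 := etrans (pairing_df hC _ oV Vp sf) (dir_vbracket hC oV Vp sf sXh sY).
have ringE (x y z t P Q D : R) : P = x - y -> Q = z - t -> y = D ->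
  x - P - (z - t - Q) = D by move=> -> -> <-; ring.
apply: ringE e1 e2 _; rewrite Yp mxE; apply: (dir_ext hC _ oV Vp) => q Vq.
by rewrite (pbracketE _ oV Vq sh).
Qed.

End Poisson.

(** * Invariant frames on a Lie group *)

(** The hypothesis says that [E *m T] is the identity; for square matrices [T *m E] then is too,
    which is the expansion. *)
Lemma dual_frame_expand (R : realType) n (E T : 'M[R]_n) (a : 'cV[R]_n) :
  (forall i j, pairing (row i E) (col j T) = (i == j)%:R) ->
  a = \sum_i pairing (row i E) a *: col i T.
Proof.
move=> ET; have {}ET : E *m T = 1%:M.
  apply/matrixP => i j; rewrite [RHS]mxE -ET /pairing !mxE.
  by apply: eq_bigr => k _; rewrite !mxE.
rewrite -[LHS]mul1mx -(mulmx1C ET) -mulmxA; apply/colP => i; rewrite mxE summxE.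
apply: eq_bigr => k _; rewrite !mxE mulrC; congr (_ * _).
by rewrite pairingE; apply: eq_bigr => l _; rewrite mxE.
Qed.

Section LieGroupFrame.
Context (R : realType) (n : nat) (G : topologicalGroupDataType) (C : atlas R n G).
Hypothesis hG : is_lie_group C.
Implicit Types (U V : set G) (f : G -> R) (g p : G).

Let hM := lie_manifold hG.

Lemma open_mul V : open V -> open [set x : G * G | V (x.1 * x.2)%g].
Proof. by move=> oV; apply: (open_comp (fun _ _ => (lie_mul hG).1 _)) => //. Qed.

Lemma smooth_mul V f : open V -> smooth C V f ->
  smooth (prod_atlas C C) [set x : G * G | V (x.1 * x.2)%g] (fun x => f (x.1 * x.2)%g).
Proof. by move=> oV sf; exact: (lie_mul hG).2 _ _ oV sf. Qed.

Lemma smooth_map_left g : smooth_map C C (fun h => g * h)%g.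
Proof.
split.
  move=> h; apply: (@continuous_comp _ _ _ (fun h => (g, h)) (fun x => x.1 * x.2)%g).
    by apply: cvg_pair => //=; exact: cvg_cst.
  exact: (lie_mul hG).1.
move=> V f oV sf; exact: (smooth_slicer hM hM (open_mul oV) (smooth_mul oV sf) g).
Qed.

Lemma dir_left_vfield V f g v : open V -> V g -> smooth C V f ->
  dir C f g (left_vfield C v g) = dir C (fun h => f (g * h)%g) 1%g v.
Proof.
move=> oV Vg sf.
have := dir_tangent_map hM hM (F := fun h => (g * h)%g) (p := 1%g) v (smooth_map_left g) oV _ sf.
by rewrite mulg1 => /(_ Vg).
Qed.

Lemma smooth_left_vfield U v : smooth_vfield C U (left_vfield C v).
Proof.
move=> V f oV VU sf.
have := smooth_dir_slicer hM hM (open_mul oV) (smooth_mul oV sf) 1%g v.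
rewrite (_ : [set z | _] = V); last first.
  by apply/seteqP; split => z /=; rewrite mulg1.
by apply: (smooth_ext hM oV) => g Vg; rewrite (dir_left_vfield _ oV Vg sf).
Qed.

(** The chart at the unit moved to [p] by left translation. The differentials of these functions at
    [p] are the left-invariant coframe, see [df_left_coord]. *)
Definition left_coord p i g : R := coord C 1%g (p^-1 * g)%g 0 i.

Definition left_dom p : set G := [set g | cdom C 1%g (p^-1 * g)%g].

Lemma open_left_dom p : open (left_dom p).
Proof.
exact: (open_preimage (smooth_map_left p^-1%g) (mfd_dom_open hM 1%g)).
Qed.

Lemma left_dom_center p : left_dom p p.
Proof. by rewrite /left_dom /= mulVg; exact: mfd_dom_center. Qed.

Lemma smooth_left_coord p i : smooth C (left_dom p) (left_coord p i).
Proof.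
exact: ((smooth_map_left p^-1%g).2 _ _ (mfd_dom_open hM 1%g) (smooth_coord hM 1%g i)).
Qed.

Lemma left_formE a g j : left_form C a g j 0 =
  \sum_i dir C (left_coord g i) g (delta_mx 0 j) * a i 0.
Proof.
rewrite mxE pairingE; apply: eq_bigr => i _; congr (_ * _).
by rewrite mxE mulVg.
Qed.

Lemma pairing_left_form v a g :
  pairing v (left_form C a g) = \sum_i dir C (left_coord g i) g v * a i 0.
Proof.
rewrite pairingE; under eq_bigr do rewrite left_formE mulr_sumr.
rewrite exchange_big; apply: eq_bigr => i _.
rewrite (dir_linear hM (open_left_dom g) (left_dom_center g) (smooth_left_coord g i)).
by rewrite mulr_suml; apply: eq_bigr => j _; rewrite mulrA.
Qed.

Lemma pairing_left v a g : pairing (left_vfield C v g) (left_form C a g) = pairing v a.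
Proof.
rewrite pairing_left_form [RHS]pairingE; apply: eq_bigr => i _; congr (_ * _).
rewrite (dir_left_vfield _ (open_left_dom g) (left_dom_center g) (smooth_left_coord g i)).
rewrite -[RHS](dir_coord hM 1%g i v); congr (dir C _ _ _); apply/funext => h.
by rewrite /left_coord mulKg.
Qed.

Lemma smooth_left_form U a : smooth_form C U (left_form C a).
Proof.
move=> V X oV VU sX.
have sVi i : smooth C V (fun g => dir C (left_coord g i) g (X g)).
  (* On the graph of the inverse the product is the unit, the centre of the chart used. *)
  have OV g : V g -> [set x : G * G | cdom C 1%g (x.1 * x.2)%g] (g^-1%g, g).
    by move=> _ /=; rewrite mulVg; exact: mfd_dom_center.
  have om := open_mul (mfd_dom_open hM 1%g).
  have sm := smooth_mul (mfd_dom_open hM 1%g) (smooth_coord hM 1%g i).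
  exact: (smooth_dir_graph hM hM om sm oV (lie_inv hG) OV sX).
have sS : smooth C V (fun g => \sum_i dir C (left_coord g i) g (X g) * a i 0).
  apply: (smooth_sum hM _ oV) => i _; apply: (smoothM hM oV (sVi i)); exact: smooth_cst.
by apply: (smooth_ext hM oV) sS => g Vg; rewrite pairing_left_form.
Qed.

Lemma df_left_coord p i : df C (left_coord p i) p = left_form C (delta_mx i 0) p.
Proof.
apply/colP => j; rewrite mxE left_formE (bigD1 i)//= big1 => [|k ki].
  by rewrite mxE !eqxx mulr1 addr0.
by rewrite mxE (negbTE ki) mulr0.
Qed.

Definition lframe i : vfield R n G := left_vfield C (delta_mx 0 i).
Definition lcoframe i : form R n G := left_form C (delta_mx i 0).

Lemma pairing_lframe i j g : pairing (lframe i g) (lcoframe j g) = (i == j)%:R.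
Proof. by rewrite pairing_left pairing_delta mxE eqxx andbT. Qed.

Lemma lcoframe_expand (a : 'cV[R]_n) g : a = \sum_i pairing (lframe i g) a *: lcoframe i g.
Proof.
pose E := \matrix_i lframe i g; pose T := (\matrix_i (lcoframe i g)^T)^T.
have rE i : row i E = lframe i g by rewrite rowK.
have cT i : col i T = lcoframe i g by rewrite -tr_row rowK trmxK.
rewrite [LHS](@dual_frame_expand _ _ E T).
  by apply: eq_bigr => i _; rewrite rE cT.
by move=> i j; rewrite rE cT pairing_lframe.
Qed.

Lemma left_form_sum (a : 'cV[R]_n) g : left_form C a g = \sum_i a i 0 *: lcoframe i g.
Proof.
rewrite [LHS](lcoframe_expand _ g); apply: eq_bigr => i _.
by rewrite pairing_left pairing_delta.
Qed.

Lemma df_expand V f g : open V -> V g -> smooth C V f ->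
  df C f g = \sum_i dir C f g (lframe i g) *: lcoframe i g.
Proof.
move=> oV Vg sf; rewrite [LHS](lcoframe_expand _ g); apply: eq_bigr => i _.
by rewrite (pairing_df hM _ oV Vg sf).
Qed.

End LieGroupFrame.

(** * Left-invariant forms on a Poisson Lie group *)

Section PoissonLie.
Context (R : realType) (n : nat) (G : topologicalGroupDataType) (C : atlas R n G).
Hypothesis hG : is_lie_group C.
Variable pi : G -> 'M[R]_n.
Hypothesis hpi : is_poisson C pi.
Hypothesis hmult : is_multiplicative C pi.
Implicit Types (U V : set G) (f : G -> R) (g h p q : G).

Let hM := lie_manifold hG.

Local Notation E := (lframe C).
Local Notation Th := (lcoframe C).
Local Notation F := (left_coord C).
Local Notation V_ p := (left_dom C p).

Definition lham i : vfield R n G := sharp pi (Th i).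
Local Notation X := lham.

(** The structure constants of the bracket that [pi] induces on covectors at the unit. *)
Definition dual_const i j k : R :=
  delta C pi (delta_mx 0 k) (delta_mx i 0) (delta_mx j 0).
Local Notation c := dual_const.

Let sTh V i : smooth_form C V (Th i) := @smooth_left_form _ _ _ _ hG V _.

Lemma smooth_lham V i : open V -> smooth_vfield C V (X i).
Proof. by move=> oV; apply: (smooth_sharp hM hpi oV). Qed.

(** The Leibniz rule with a constant matrix; [key] uses it with the bivector frozen at [p]. *)
Lemma dir_pairing_form V (u w : G -> 'cV[R]_n) (P : 'M[R]_n) p v :
  open V -> V p -> (forall i, smooth C V (fun q => u q i 0)) ->
  (forall i, smooth C V (fun q => w q i 0)) ->
  smooth C V (fun q => pairing ((u q)^T *m P) (w q)) /\
  dir C (fun q => pairing ((u q)^T *m P) (w q)) p v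
  = pairing ((\col_i dir C (fun q => u q i 0) p v)^T *m P) (w p)
    + pairing ((u p)^T *m P) (\col_i dir C (fun q => w q i 0) p v).
Proof.
move=> oV Vp su sw.
have pE (a b : 'cV[R]_n) : pairing (a^T *m P) b = \sum_l \sum_i P i l * (a i 0 * b l 0).
  rewrite pairingE; apply: eq_bigr => l _; rewrite mxE mulr_suml.
  by apply: eq_bigr => i _; rewrite mxE mulrCA mulrA.
have -> : (fun q => pairing ((u q)^T *m P) (w q))
  = fun q => \sum_l \sum_i P i l * (u q i 0 * w q l 0) by apply/funext => q; exact: pE.
have suw i l := smoothM hM oV (su i) (sw l).
have sP i l := smoothM hM oV (smooth_cst C V (P i l)) (suw i l).
have sS l := smooth_sum hM (index_enum 'I_n) (P := xpredT) oV (fun i _ => sP i l).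
split; first by apply: (smooth_sum hM _ oV) => l _; exact: sS.
rewrite (dir_sum hM _ v oV Vp (fun l _ => sS l)) !pE -big_split /=.
apply: eq_bigr => l _; rewrite (dir_sum hM _ v oV Vp (fun i _ => sP i l)) -big_split /=.
apply: eq_bigr => i _; rewrite (dirZ hM _ _ Vp (suw i l)) (dirM hM _ Vp (su i) (sw l)) !mxE.
set a := dir _ _ _ _; set b := dir _ _ _ _; move: (u p i 0) (w p l 0) a b => x y a b; ring.
Qed.

Lemma smooth_lframe V i : smooth_vfield C V (E i).
Proof. exact: smooth_left_vfield. Qed.

Lemma mem_mulr V p : open V -> V p ->
  open [set h : G | V (p * h)%g] /\ [set h : G | V (p * h)%g] 1%g.
Proof.
by move=> oV Vp; split; [exact: (open_preimage (smooth_map_left hG p))|rewrite /= mulg1].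
Qed.

(** Multiplicativity splits the bracket at [p * h] into a part with [pi] taken at [p] and a part
    with [pi] taken at [h]. Differentiated at [h = 1], the second part is the linearization of [pi],
    and the first gives the two other terms by the Leibniz rule and [dir_dirC]. *)
Lemma key i j k p :
  dir C (pbracket C pi (F p i) (F p j)) p (E k p)
  = c i j k + dir C (fun z => dir C (F p j) z (E k z)) p (X i p)
    - dir C (fun z => dir C (F p i) z (E k z)) p (X j p).
Proof.
have oV := open_left_dom hG p; have Vp := left_dom_center hG p.
have sF l := smooth_left_coord hG p l.
have sK l := smooth_dir oV (sF l) (@smooth_lframe _ k).
rewrite (dir_left_vfield hG _ oV Vp (smooth_pbracket hM hpi oV (sF i) (sF j))).
pose O : set (G * G) := [set x | V_ p (x.1 * x.2)%g].
have oO : open O := open_mul hG oV.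
have sO l : smooth (prod_atlas C C) O (fun x => F p l (x.1 * x.2)%g) := smooth_mul hG oV (sF l).
pose W := [set h | V_ p (p * h)%g].
have [oW W1] : open W /\ W 1%g by exact: mem_mulr.
pose u l (h : G) : 'cV[R]_n := df C (fun z => F p l (z * h)%g) p.
pose A (h : G) := pairing ((u i h)^T *m pi p) (u j h).
pose B := pbracket C pi (fun z => F p i (p * z)%g) (fun z => F p j (p * z)%g).
have HAB (h : G) : W h -> pbracket C pi (F p i) (F p j) (p * h)%g = A h + B h.
  by move=> Wh; rewrite (hmult oV (sF i) (sF j) Wh).
rewrite (dir_ext hM _ oW W1 HAB).
(* Translating back by [p] gives the chart at the unit, the one in which [delta] is defined. *)
have FpE l : (fun z => F p l (p * z)%g) = (fun z => coord C 1%g z 0 l).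
  by apply/funext => z; rewrite /left_coord mulKg.
have sFp l : smooth C W (fun z => F p l (p * z)%g).
  rewrite FpE; apply: smooth_sub (smooth_coord hM 1%g l) => h.
  by rewrite /W /left_dom /= mulKg.
have sB : smooth C W B by exact: (smooth_pbracket hM hpi oW).
have su l a : smooth C W (fun h => u l h a 0).
  have := smooth_dir_slicel hM hM oO (sO l) p (delta_mx 0 a).
  by apply: (smooth_ext hM oW) => h Wh; rewrite mxE.
have [sA dA] := dir_pairing_form (pi p) (delta_mx 0 k) oW W1 (su i) (su j).
rewrite (dirD hM _ W1 sA sB) dA.
have -> : dir C B 1%g (delta_mx 0 k) = c i j k.
  rewrite /c /delta /B !FpE.
  have pE l : (fun g => pairing (coord C 1%g g) (delta_mx l 0)) = (fun z => coord C 1%g z 0 l).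
    apply/funext => z; rewrite /pairing -colE.
    by rewrite mxE.
  by rewrite !pE.
have u1 l : u l 1%g = df C (F p l) p.
  by rewrite /u; congr (df C _ p); apply/funext => z; rewrite mulg1.
(* The derivative in [h] is moved inside the differential at [p], where it becomes the derivative
   along [E k]. *)
have du l : \col_a dir C (fun h => u l h a 0) 1%g (delta_mx 0 k)
    = df C (fun z => dir C (F p l) z (E k z)) p.
  apply/colP => a; rewrite !mxE.
  have uE : (fun h => u l h a 0) = (fun h => dir C (fun z => F p l (z * h)%g) p (delta_mx 0 a)).
    by apply/funext => h; rewrite mxE.
  have Op1 : O (p, 1%g) by rewrite /O /= mulg1.
  rewrite uE -(dir_dirC hM hM oO (sO l) (delta_mx 0 a) (delta_mx 0 k) Op1).
  by apply: (dir_ext hM _ oV Vp) => z Vz; rewrite (dir_left_vfield hG _ oV Vz (sF l)).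
rewrite !u1 !du.
have T1 : pairing ((df C (F p i) p)^T *m pi p) (df C (fun z => dir C (F p j) z (E k z)) p)
   = dir C (fun z => dir C (F p j) z (E k z)) p (X i p).
  rewrite (pairing_df hM _ oV Vp (sK j)); congr (dir C _ p _).
  by rewrite /lham /sharp df_left_coord.
have T2 : pairing ((df C (fun z => dir C (F p i) z (E k z)) p)^T *m pi p) (df C (F p j) p)
   = - dir C (fun z => dir C (F p i) z (E k z)) p (X j p).
  have := sharp_antisym hpi (df C (fun z => dir C (F p i) z (E k z))) (df C (F p j)) p.
  rewrite {1}/sharp => ->; rewrite (pairing_df hM _ oV Vp (sK i)); congr (- dir C _ p _).
  by rewrite /lham /sharp df_left_coord.
have ringE (x y z : R) : - x + y + z = z + y - x by ring.
by rewrite T1 T2; exact: ringE.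
Qed.

Lemma frame_deriv_left_coord i k p : dir C (F p i) p (E k p) = (k == i)%:R.
Proof.
rewrite -(pairing_df hM _ (open_left_dom hG p) (left_dom_center hG p) (smooth_left_coord hG p i)).
by rewrite df_left_coord (pairing_lframe hG).
Qed.

Lemma smooth_form_sum V (r : seq 'I_n) (f : 'I_n -> G -> R) (a : 'I_n -> form R n G) :
  open V -> (forall i, smooth C V (f i)) -> (forall i, smooth_form C V (a i)) ->
  smooth_form C V (fun q => \sum_(i <- r) f i q *: a i q).
Proof.
move=> oV sf sa; elim: r => [|i r IH].
  rewrite (_ : (fun q => _) = fun=> 0); first exact: smooth_form0.
  by apply/funext => q; rewrite big_nil.
rewrite (_ : (fun q => _) = fun q => f i q *: a i q + \sum_(j <- r) f j q *: a j q).
  exact: (smooth_form_linear hM).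
by apply/funext => q; rewrite big_cons.
Qed.

Lemma fbracket0 V b p : open V -> V p -> smooth_form C V b ->
  fbracket C pi (fun=> 0) b p = 0.
Proof.
move=> oV Vp sb; have s0 := @smooth_form0 _ _ _ C V.
(* Additivity for two zero forms reads x = x + x. *)
have := fbracket_linearl hM hpi oV Vp (smooth_cst C V 1) s0 s0 sb.
rewrite (_ : (fun q => _) = fun=> 0); last by apply/funext => q; rewrite scaler0 addr0.
rewrite scale1r scaler0 subr0; set x := fbracket _ _ _ _ _ => /eqP.
by rewrite -subr_eq0 opprD addrA subrr add0r oppr_eq0 => /eqP.
Qed.

Lemma fbracket_suml V (r : seq 'I_n) (f : 'I_n -> G -> R) (a : 'I_n -> form R n G) b p :
  open V -> V p -> (forall i, smooth C V (f i)) -> (forall i, smooth_form C V (a i)) ->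
  smooth_form C V b ->
  fbracket C pi (fun q => \sum_(i <- r) f i q *: a i q) b p
  = \sum_(i <- r) (f i p *: fbracket C pi (a i) b p - dir C (f i) p (sharp pi b p) *: a i p).
Proof.
move=> oV Vp sf sa sb; elim: r => [|i r IH].
  rewrite (_ : (fun q => _) = fun=> 0); last by apply/funext => q; rewrite big_nil.
  by rewrite (fbracket0 oV Vp sb) big_nil.
rewrite (_ : (fun q => _) = fun q => f i q *: a i q + \sum_(j <- r) f j q *: a j q); last first.
  by apply/funext => q; rewrite big_cons.
rewrite (fbracket_linearl hM hpi oV Vp (sf i) (sa i) (smooth_form_sum r oV sf sa) sb).
by rewrite IH big_cons addrAC.
Qed.

Lemma fbracket_sumr V (r : seq 'I_n) (f : 'I_n -> G -> R) (a : 'I_n -> form R n G) b p :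
  open V -> V p -> (forall i, smooth C V (f i)) -> (forall i, smooth_form C V (a i)) ->
  smooth_form C V b ->
  fbracket C pi b (fun q => \sum_(i <- r) f i q *: a i q) p
  = \sum_(i <- r) (f i p *: fbracket C pi b (a i) p + dir C (f i) p (sharp pi b p) *: a i p).
Proof.
move=> oV Vp sf sa sb.
rewrite (fbracket_antisym hM hpi oV Vp sb (smooth_form_sum r oV sf sa)).
rewrite (fbracket_suml r oV Vp sf sa sb) -sumrN; apply: eq_bigr => i _.
rewrite (fbracket_antisym hM hpi oV Vp sb (sa i)).
by rewrite opprD opprK scalerN.
Qed.

(** The identity [fbracket_df] for the translated coordinates is expanded in the coframe. At [p] the
    coefficient matrix is the identity, and its derivatives are exactly the extra terms of [key]. *)
Lemma fbracket_lcoframe i j p :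
  fbracket C pi (Th i) (Th j) p = \sum_k c i j k *: Th k p.
Proof.
have oV := open_left_dom hG p; have Vp := left_dom_center hG p.
have sF l := smooth_left_coord hG p l.
pose K l k q := dir C (F p l) q (E k q).
have sK l k : smooth C (V_ p) (K l k) := smooth_dir oV (sF l) (@smooth_lframe _ k).
have dFE l q : V_ p q -> df C (F p l) q = \sum_k K l k q *: Th k q.
  by move=> Vq; exact: (df_expand hG oV Vq (sF l)).
have Kp l k : K l k p = (k == l)%:R by exact: frame_deriv_left_coord.
have Sp l : sharp pi (df C (F p l)) p = X l p by rewrite /lham /sharp df_left_coord.
have e1 := fbracket_df hM hpi oV Vp (sF i) (sF j).
rewrite (df_expand hG oV Vp (smooth_pbracket hM hpi oV (sF i) (sF j))) in e1.
have sSum l : smooth_form C (V_ p) (fun q => \sum_k K l k q *: Th k q).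
  by apply: smooth_form_sum.
have delta_sum (l : 'I_n) (A B : 'I_n -> 'cV[R]_n) :
    \sum_k (K l k p *: A k + B k) = A l + \sum_k B k.
  rewrite big_split /= (bigD1 l)//= Kp eqxx scale1r big1 ?addr0// => k kl.
  by rewrite Kp (negbTE kl) scale0r.
rewrite (fbracket_ext hM pi oV Vp (dFE i) (fun _ _ => erefl)) in e1.
rewrite (fbracket_suml _ oV Vp (sK i) (@sTh (V_ p)) (smooth_df hM oV (sF j))) in e1.
rewrite delta_sum Sp in e1.
rewrite (fbracket_ext hM pi oV Vp (fun _ _ => erefl) (dFE j)) in e1.
rewrite (fbracket_sumr _ oV Vp (sK j) (@sTh (V_ p)) (@sTh (V_ p) i)) delta_sum in e1.
(* Restoring the derivative terms of both expansions turns the left side into that of [e1]. *)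
apply: (addIr (\sum_k dir C (K j k) p (X i p) *: Th k p)).
apply: (addIr (\sum_k - (dir C (K i k) p (X j p) *: Th k p))).
rewrite e1 -!big_split; apply: eq_bigr => k _.
by rewrite key !scalerDl scaleNr.
Qed.

End PoissonLie.

(** * Jacobi identities for the frame *)

Section PoissonLieBracket.
Context (R : realType) (n : nat) (G : topologicalGroupDataType) (C : atlas R n G).
Hypothesis hG : is_lie_group C.
Variable pi : G -> 'M[R]_n.
Hypothesis hpi : is_poisson C pi.
Hypothesis hmult : is_multiplicative C pi.
Implicit Types (U V : set G) (f : G -> R) (g h p q : G).

Let hM := lie_manifold hG.

Local Notation E := (lframe C).
Local Notation Th := (lcoframe C).
Local Notation F := (left_coord C).
Local Notation V_ p := (left_dom C p).

Local Notation X := (lham C pi).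
Local Notation c := (dual_const C pi).
Let sTh V i : smooth_form C V (Th i) := @smooth_left_form _ _ _ _ hG V _.

Lemma dir_sum_vec V f (r : seq 'I_n) (a : 'I_n -> R) (v : 'I_n -> 'rV[R]_n) p :
  open V -> V p -> smooth C V f ->
  dir C f p (\sum_(i <- r) a i *: v i) = \sum_(i <- r) a i * dir C f p (v i).
Proof.
move=> oV Vp sf; elim: r => [|i r IH].
  rewrite !big_nil (dir_linear hM oV Vp sf) big1// => i _.
  by rewrite mxE mul0r.
by rewrite !big_cons (dir_linearP hM oV Vp sf) IH.
Qed.

Lemma dir_sharp_sum V f (a : 'I_n -> R) (w : 'cV[R]_n) p :
  open V -> V p -> smooth C V f -> w = \sum_i a i *: Th i p ->
  dir C f p (w^T *m pi p) = \sum_i a i * dir C f p (X i p).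
Proof.
move=> oV Vp sf ->; rewrite linear_sum mulmx_suml.
rewrite -(dir_sum_vec _ a (fun i => X i p) oV Vp sf); congr (dir C f p _).
by apply: eq_bigr => i _; rewrite linearZ /= -scalemxAl.
Qed.

(** The Jacobi identity for two translated coordinates and [f]. Replacing each [df (F p l)] by its
    coframe expansion leaves derivatives of coefficients, and these cancel against [key]. *)
Lemma lham_bracket U f i j p : open U -> U p -> smooth C U f ->
  dir C (fun q => dir C f q (X j q)) p (X i p) - dir C (fun q => dir C f q (X i q)) p (X j p)
  = \sum_k c i j k * dir C f p (X k p).
Proof.
move=> oU Up sfU; pose V := U `&` V_ p.
have oV : open V by exact: openI oU (open_left_dom hG p).
have Vp : V p by split=> //; exact: left_dom_center.
have sf := smooth_sub (@subIsetl _ U (V_ p)) sfU.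
have sF l := smooth_sub (@subIsetr _ U (V_ p)) (smooth_left_coord hG p l).
pose K l k q := dir C (F p l) q (E k q).
have sK l k : smooth C V (K l k) := smooth_dir oV (sF l) (smooth_left_vfield hG (U:=V) (delta_mx 0
  k)).
have Kp l k : K l k p = (k == l)%:R by exact: frame_deriv_left_coord.
have Sp l : sharp pi (df C (F p l)) p = X l p by rewrite /lham /sharp df_left_coord.
have sX l : smooth C V (fun q => dir C f q (X l q)) := smooth_dir oV sf (smooth_lham hG hpi l oV).
have pbF l (g : G -> R) : smooth C V g -> pbracket C pi (F p l) g p = dir C g p (X l p).
  by move=> sg; rewrite (pbracketE hM pi _ oV Vp sg) Sp.
have Ff l q : V q -> pbracket C pi (F p l) f q = \sum_k K l k q * dir C f q (X k q).
  move=> Vq; rewrite (pbracketE hM pi _ oV Vq sf).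
  by rewrite (dir_sharp_sum oV Vq sf (df_expand hG oV Vq (sF l))).
have sKX l k := smoothM hM oV (sK l k) (sX k).
have sFf l := smooth_pbracket hM hpi oV (sF l) sf.
have FFf l m : pbracket C pi (F p l) (pbracket C pi (F p m) f) p
    = dir C (fun q => dir C f q (X m q)) p (X l p)
      + \sum_k dir C f p (X k p) * dir C (K m k) p (X l p).
  rewrite (pbF l _ (sFf m)) (dir_ext hM _ oV Vp (Ff m)).
  rewrite (dir_sum hM _ _ oV Vp (fun k _ => sKX m k)).
  under eq_bigr => k _ do rewrite (dirM hM _ Vp (sK m k) (sX k)) Kp.
  rewrite big_split /=; congr (_ + _).
  rewrite (bigD1 m)//= eqxx mul1r big1 ?addr0// => k km.
  by rewrite (negbTE km) mul0r.
have sFF := smooth_pbracket hM hpi oV (sF i) (sF j).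
have jac := pi_jacobi hpi oV (sF i) (sF j) sf Vp.
have e2 : pbracket C pi (F p j) (pbracket C pi f (F p i)) p
    = - pbracket C pi (F p j) (pbracket C pi (F p i) f) p.
  rewrite (_ : pbracket C pi f (F p i) = fun q => - pbracket C pi (F p i) f q); last first.
    by apply/funext => q; exact: (pbracket_antisym hpi).
  by rewrite (pbF j _ (smoothN hM oV (sFf i))) (dirN hM _ Vp (sFf i)) (pbF j _ (sFf i)).
have e3 : pbracket C pi f (pbracket C pi (F p i) (F p j)) p
    = - \sum_k dir C (pbracket C pi (F p i) (F p j)) p (E k p) * dir C f p (X k p).
  rewrite (pbracket_antisym hpi) (pbracketE hM pi _ oV Vp sf).
  by rewrite (dir_sharp_sum oV Vp sf (df_expand hG oV Vp sFF)).
have ringE (x y s t u : R) : (x + s) - (y + t) - u = 0 -> u = s - t + (x - y).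
  by move=> /eqP; rewrite subr_eq0 => /eqP <-; ring.
rewrite e2 e3 (FFf i j) (FFf j i) in jac; have {}jac := ringE _ _ _ _ _ jac.
apply/esym/(addrI _ (etrans _ jac)).
rewrite -sumrB -big_split; apply: eq_bigr => k _; rewrite (key hG hpi hmult).
have ringE' (x y z t : R) : x * y - x * z + t * x = (t + y - z) * x by ring.
exact: ringE'.
Qed.

Lemma dual_const_antisym i j k : c i j k = - c j i k.
Proof.
rewrite /dual_const /delta.
have s1 l : smooth C (cdom C 1%g) (fun g => pairing (coord C 1%g g) (delta_mx l 0)).
  rewrite (_ : (fun g => _) = fun g => coord C 1%g g 0 l); first exact: smooth_coord.
  by apply/funext => g; rewrite pairingE (bigD1 l)//= big1 ?mxE ?eqxx ?mulr1 ?addr0// => m ml;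
     rewrite mxE (negbTE ml) mulr0.
have o1 := mfd_dom_open hM 1%g; have d1 := mfd_dom_center hM 1%g.
rewrite -(dirN hM _ d1 (smooth_pbracket hM hpi o1 (s1 j) (s1 i))).
set f := pbracket _ _ _ _; set g := pbracket _ _ _ _.
have -> : f = fun q => - g q by apply/funext => q; exact: (pbracket_antisym hpi).
by [].
Qed.

(** A multiplicative bivector vanishes at the unit: the product of the unit with itself gives x = x
    + x. *)
Lemma pbracket_unit V (f g : G -> R) : open V -> V 1%g -> smooth C V f -> smooth C V g ->
  pbracket C pi f g 1%g = 0.
Proof.
move=> oV V1 sf sg; have := @hmult V f g oV sf sg 1%g 1%g.
rewrite mulg1 => /(_ V1).
have r1 (h : G -> R) : (fun z : G => h (z * 1)%g) = h by apply/funext => z; rewrite mulg1.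
have r2 (h : G -> R) : (fun z : G => h (1 * z)%g) = h by apply/funext => z; rewrite mul1g.
rewrite (r1 f) (r1 g) (r2 f) (r2 g).
set x := pbracket _ _ _ _ _ => /eqP.
by rewrite -subr_eq0 opprD addrA subrr add0r oppr_eq0 => /eqP.
Qed.

(** The derivative at the unit, along [E m], of the Jacobi identity for coordinates. Since [pi]
    vanishes there, each double bracket contributes only its linear part, a product of two structure
    constants. *)
Lemma dual_const_jacobi i j k m :
  \sum_l (c j k l * c i l m + c k i l * c j l m + c i j l * c k l m) = 0.
Proof.
have oV := open_left_dom hG 1%g; have V1 := left_dom_center hG 1%g.
have sF l := smooth_left_coord hG 1%g l.
have X0 f l : smooth C (V_ 1%g) f -> dir C f 1%g (X l 1%g) = 0.
  move=> sf; rewrite -(pbracket_unit oV V1 (sF l) sf) (pbracketE hM pi _ oV V1 sf).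
  by rewrite /lham /sharp df_left_coord.
pose K l a q := dir C (F 1%g l) q (E a q).
have sK l a : smooth C (V_ 1%g) (K l a) := smooth_dir oV (sF l) (smooth_left_vfield hG (U:=V_ 1%g)
  (delta_mx 0 a)).
have Kp l a : K l a 1%g = (a == l)%:R by exact: frame_deriv_left_coord.
have sX a l : smooth C (V_ 1%g) (fun q => dir C (F 1%g a) q (X l q)).
  exact: smooth_dir oV (sF a) (smooth_lham hG hpi l oV).
have cE a b : dir C (pbracket C pi (F 1%g a) (F 1%g b)) 1%g (E m 1%g) = c a b m.
  by rewrite (key hG hpi hmult) (X0 _ a (sK b m)) (X0 _ b (sK a m)) addr0 subr0.
have cE' a b l : dir C (pbracket C pi (F 1%g a) (F 1%g b)) 1%g (E l 1%g) = c a b l.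
  by rewrite (key hG hpi hmult) (X0 _ a (sK b l)) (X0 _ b (sK a l)) addr0 subr0.
(* Near the unit the bracket of [F l] and [F a] differs from [X l (F a)] by coefficients [K] that
   are the identity at the unit. The derivatives of [K] multiply fields that vanish there. *)
have XE a l : dir C (fun q => dir C (F 1%g a) q (X l q)) 1%g (E m 1%g) = c l a m.
  rewrite -cE.
  have FF q : V_ 1%g q ->
      pbracket C pi (F 1%g l) (F 1%g a) q = \sum_b K l b q * dir C (F 1%g a) q (X b q).
    move=> Vq; rewrite (pbracketE hM pi _ oV Vq (sF a)).
    by rewrite (dir_sharp_sum oV Vq (sF a) (df_expand hG oV Vq (sF l))).
  rewrite (dir_ext hM _ oV V1 FF).
  have sKX b := smoothM hM oV (sK l b) (sX a b).
  rewrite (dir_sum hM _ _ oV V1 (fun b _ => sKX b)).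
  under eq_bigr => b _ do rewrite (dirM hM _ V1 (sK l b) (sX a b)) Kp (X0 _ b (sF a)) mul0r addr0.
  rewrite (bigD1 l)//= eqxx mul1r big1 ?addr0// => b bl.
  by rewrite (negbTE bl) mul0r.
have sFF a b := smooth_pbracket hM hpi oV (sF a) (sF b).
have step a b d : dir C (pbracket C pi (F 1%g a) (pbracket C pi (F 1%g b) (F 1%g d))) 1%g (E m 1%g)
    = \sum_l c b d l * c a l m.
  pose g := pbracket C pi (F 1%g b) (F 1%g d).
  have sg l : smooth C (V_ 1%g) (fun q => dir C g q (E l q)) := smooth_dir oV (sFF b d)
    (smooth_left_vfield hG (U:=V_ 1%g) (delta_mx 0 l)).
  have sgX l := smoothM hM oV (sg l) (sX a l).
  have FF q : V_ 1%g q -> pbracket C pi (F 1%g a) g q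
      = - \sum_l dir C g q (E l q) * dir C (F 1%g a) q (X l q).
    move=> Vq; rewrite (pbracket_antisym hpi) (pbracketE hM pi _ oV Vq (sF a)).
    by rewrite (dir_sharp_sum oV Vq (sF a) (df_expand hG oV Vq (sFF b d))).
  rewrite (dir_ext hM _ oV V1 FF).
  rewrite (dirN hM _ V1 (smooth_sum hM _ oV (fun l _ => sgX l))).
  rewrite (dir_sum hM _ _ oV V1 (fun l _ => sgX l)) -sumrN; apply: eq_bigr => l _.
  rewrite (dirM hM _ V1 (sg l) (sX a l)) (X0 _ l (sF a)) mul0r addr0 XE cE'.
  by rewrite (dual_const_antisym l a m) mulrN opprK.
rewrite !big_split /=.
apply: etrans (f_equal2 +%R (f_equal2 +%R (esym (step i j k)) (esym (step j k i))) (esym (step k i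
  j))) _.
have sFFF a b d := smooth_pbracket hM hpi oV (sF a) (sFF b d).
rewrite -(dirD hM _ V1 (sFFF i j k) (sFFF j k i)).
rewrite -(dirD hM _ V1 (smoothD hM oV (sFFF i j k) (sFFF j k i)) (sFFF k i j)).
rewrite (dir_ext hM _ oV V1 (g := fun=> 0)) ?dir_cst// => q Vq.
exact: (pi_jacobi hpi oV (sF i) (sF j) (sF k) Vq).
Qed.

End PoissonLieBracket.

(** * Acyclicity of the Weil complex *)

Section WeilComplex.
Context (R : realFieldType) (n : nat) (P : lmodType R).
Local Notation V := 'rV[R]_n.
Local Notation e k := (delta_mx 0 k : V).
Variable br : V -> V -> V.
Hypothesis br_linearr : forall x a y z, br x (a *: y + z) = a *: br x y + br x z.
Hypothesis br_antisym : forall x y, br x y = - br y x.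
Hypothesis br_jacobi : forall x y z, br x (br y z) = br (br x y) z + br y (br x z).
Variables (X D : V -> {linear P -> P}) (m : 'I_n -> {linear P -> P}).
Hypothesis X_linear : forall a x y f, X (a *: x + y) f = a *: X x f + X y f.
Hypothesis D_linear : forall a x y f, D (a *: x + y) f = a *: D x f + D y f.
Hypothesis X_bracket : forall x y f, X x (X y f) - X y (X x f) = X (br x y) f.
Hypothesis XD : forall x y f, X x (D y f) = D y (X x f).
Hypothesis Xm : forall x k f, X x (m k f) = m k (X x f).
Hypothesis DD : forall x y f, D x (D y f) = D y (D x f).
Hypothesis mm : forall j k f, m j (m k f) = m k (m j f).
Hypothesis Dm : forall x k f, D x (m k f) = m k (D x f) + x 0 k *: f.

Local Notation cochain := (seq V -> P).
Implicit Types (w : cochain) (s t : seq V) (x y z : V) (f g : P).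

(** The Lie derivative on cochains with values in [P], through its commutation with contraction:
    contracting L_x by y is L_x of the contraction minus the contraction by [x, y]. *)
Fixpoint ce_lie x w s : P :=
  if s is y :: s' then ce_lie x (fun t => w (y :: t)) s' - w (br x y :: s')
  else X x (w [::]).

(** The Chevalley-Eilenberg differential, through Cartan's formula: contracting d by x is L_x minus
    d of the contraction. The value 0 on the empty sequence says that d raises the degree. *)
Fixpoint ce_diff w s : P :=
  if s is x :: s' then ce_lie x w s' - ce_diff (fun t => w (x :: t)) s' else 0.

(** With [m k] the multiplication by the k-th variable, this is contraction with the polynomial
    variable itself, the Koszul differential. *)
Definition ce_iota w s : P := \sum_k m k (w (e k :: s)).

(** Unfolded, this is the alternating sum over the arguments of the derivative of [w] along one
    argument, evaluated on the remaining ones. *)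
Fixpoint ce_homotopy w s : P :=
  if s is x :: s' then D x (w s') - ce_homotopy (fun t => w (x :: t)) s' else 0.

(** The derivative at xi in the direction [z, xi]. *)
Definition coadjoint z f : P := \sum_k m k (D (br z (e k)) f).

Definition euler f : P := \sum_k m k (D (e k) f).

Definition multilinear w := forall s1 s2 a x y,
  w (s1 ++ (a *: x + y) :: s2) = a *: w (s1 ++ x :: s2) + w (s1 ++ y :: s2).

Definition alternating w := forall s1 s2 x, w (s1 ++ x :: x :: s2) = 0.

Definition invariant w := forall z s, ce_lie z w s = coadjoint z (w s).

Local Notation L := ce_lie.
Local Notation d := ce_diff.
Local Notation iota := ce_iota.
Local Notation h := ce_homotopy.
Local Notation Ez := coadjoint.

Lemma brxx x : br x x = 0.
Proof.
have /eqP := br_antisym x x; rewrite -addr_eq0 -mulr2n -scaler_nat scaler_eq0.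
by rewrite pnatr_eq0 => /eqP.
Qed.

Lemma br_linearl a x y z : br (a *: x + y) z = a *: br x z + br y z.
Proof. by rewrite br_antisym br_linearr opprD -scalerN -!br_antisym. Qed.

Lemma multilinear_contr w x : multilinear w -> multilinear (fun t => w (x :: t)).
Proof. by move=> lw s1 s2; exact: (lw (x :: s1)). Qed.

Lemma alternating_contr w x : alternating w -> alternating (fun t => w (x :: t)).
Proof. by move=> aw s1; exact: (aw (x :: s1)). Qed.

Lemma multilinear_sum w (I : Type) (r : seq I) (a : I -> R) (v : I -> V) s1 s2 :
  multilinear w ->
  w (s1 ++ (\sum_(i <- r) a i *: v i) :: s2) = \sum_(i <- r) a i *: w (s1 ++ v i :: s2).
Proof.
move=> lw; elim: r => [|i r IH]; last by rewrite !big_cons lw IH.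
rewrite !big_nil; have := lw s1 s2 (-1) 0 0.
by rewrite scaleN1r addNr => ->; rewrite scaleN1r addNr.
Qed.

Lemma multilinear0 w s1 s2 : multilinear w -> w (s1 ++ 0 :: s2) = 0.
Proof.
by move=> lw; have := multilinear_sum [::] (fun i : 'I_0 => 0) (fun=> 0) s1 s2 lw; rewrite !big_nil.
Qed.

Lemma alternating_swap w s1 s2 x y : multilinear w -> alternating w ->
  w (s1 ++ x :: y :: s2) = - w (s1 ++ y :: x :: s2).
Proof.
move=> lw aw; apply/eqP; rewrite -addr_eq0; apply/eqP.
have := aw s1 s2 (1 *: x + y); rewrite lw !scale1r.
have E z : w (s1 ++ z :: (x + y) :: s2) = w (s1 ++ z :: x :: s2) + w (s1 ++ z :: y :: s2).
  by have := lw (s1 ++ [:: z]) s2 1 x y; rewrite -!catA /= !scale1r.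
by rewrite !E !aw add0r addr0.
Qed.

Lemma alternating_gap w s1 s2 s3 x : multilinear w -> alternating w ->
  w (s1 ++ x :: s2 ++ x :: s3) = 0.
Proof.
move=> lw aw; elim: s2 s1 => [|y s2 IH] s1; first exact: aw.
rewrite /= alternating_swap// -cat_rcons IH oppr0 //.
Qed.

Lemma ce_lie_linear x a w1 w2 s :
  L x (fun t => a *: w1 t + w2 t) s = a *: L x w1 s + L x w2 s.
Proof.
elim: s w1 w2 => [|y s IH] w1 w2 /=; first by rewrite linearP.
by rewrite IH scalerBr opprD addrACA.
Qed.

Lemma ce_diff_linear a w1 w2 s :
  d (fun t => a *: w1 t + w2 t) s = a *: d w1 s + d w2 s.
Proof.
elim: s w1 w2 => [|y s IH] w1 w2 /=; first by rewrite scaler0 addr0.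
by rewrite IH ce_lie_linear scalerBr opprD addrACA.
Qed.

Lemma ce_homotopy_linear a w1 w2 s :
  h (fun t => a *: w1 t + w2 t) s = a *: h w1 s + h w2 s.
Proof.
elim: s w1 w2 => [|y s IH] w1 w2 /=; first by rewrite scaler0 addr0.
by rewrite IH linearP scalerBr opprD addrACA.
Qed.

Lemma ce_lieB x w1 w2 s : L x (fun t => w1 t - w2 t) s = L x w1 s - L x w2 s.
Proof.
rewrite addrC -scaleN1r -ce_lie_linear; congr (L x _ s); apply/funext => t.
by rewrite scaleN1r addrC.
Qed.

Lemma ce_diffB w1 w2 s : d (fun t => w1 t - w2 t) s = d w1 s - d w2 s.
Proof.
rewrite addrC -scaleN1r -ce_diff_linear; congr (d _ s); apply/funext => t.
by rewrite scaleN1r addrC.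
Qed.

Lemma ce_homotopyB w1 w2 s : h (fun t => w1 t - w2 t) s = h w1 s - h w2 s.
Proof.
rewrite addrC -scaleN1r -ce_homotopy_linear; congr (h _ s); apply/funext => t.
by rewrite scaleN1r addrC.
Qed.

Lemma ce_homotopyN w s : h (fun t => - w t) s = - h w s.
Proof.
have E : h (fun=> 0) s = 0.
  by rewrite -[RHS](subrr (h w s)) -ce_homotopyB; congr (h _ s); apply/funext => t; rewrite subrr.
have := ce_homotopyB (fun=> 0) w s; rewrite E sub0r => <-; congr (h _ s).
by apply/funext => t; rewrite sub0r.
Qed.

(* [L] and [d] only involve the operators [X], so they commute with every operator that commutes with these. *)
Lemma ce_lie_comm (T : {linear P -> P}) x w s : (forall f, X x (T f) = T (X x f)) ->
  L x (fun t => T (w t)) s = T (L x w s).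
Proof. by move=> XT; elim: s w => [|y s IH] w /=; rewrite ?XT // IH linearB. Qed.

Lemma ce_diff_comm (T : {linear P -> P}) w s : (forall x f, X x (T f) = T (X x f)) ->
  d (fun t => T (w t)) s = T (d w s).
Proof.
by move=> XT; elim: s w => [|y s IH] w /=; rewrite ?linear0// IH ce_lie_comm// linearB.
Qed.

Lemma ce_lie_sum (I : Type) (r : seq I) x (w : I -> cochain) s :
  L x (fun t => \sum_(i <- r) w i t) s = \sum_(i <- r) L x (w i) s.
Proof.
elim: r => [|i r IH].
  rewrite big_nil -[RHS](subrr (L x (fun=> 0) s)) -ce_lieB.
  by congr (L x _ s); apply/funext => t; rewrite big_nil subrr.
rewrite big_cons -IH -[L x (w i) s]scale1r -ce_lie_linear; congr (L x _ s).
by apply/funext => t; rewrite big_cons scale1r.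
Qed.

Lemma ce_diff_sum (I : Type) (r : seq I) (w : I -> cochain) s :
  d (fun t => \sum_(i <- r) w i t) s = \sum_(i <- r) d (w i) s.
Proof.
elim: r => [|i r IH].
  rewrite big_nil -[RHS](subrr (d (fun=> 0) s)) -ce_diffB.
  by congr (d _ s); apply/funext => t; rewrite big_nil subrr.
rewrite big_cons -IH -[d (w i) s]scale1r -ce_diff_linear; congr (d _ s).
by apply/funext => t; rewrite big_cons scale1r.
Qed.

Lemma ce_lie_linearl a x y w s : multilinear w ->
  L (a *: x + y) w s = a *: L x w s + L y w s.
Proof.
elim: s w => [|z s IH] w lw /=; first exact: X_linear.
rewrite IH; last exact: multilinear_contr.
by rewrite br_linearl (lw [::]) /= scalerBr opprD addrACA.
Qed.

(** Each argument slot contributes the Jacobi identity of [br], and the empty sequence contributes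
    the representation property of [X]. *)
Lemma ce_lie_bracket x y w s : multilinear w ->
  L x (L y w) s - L y (L x w) s = L (br x y) w s.
Proof.
elim: s w => [|z s IH] w lw /=; first exact: X_bracket.
rewrite !ce_lieB -IH; last exact: multilinear_contr.
rewrite (br_jacobi x y z).
have -> : w (br (br x y) z + br y (br x z) :: s)
    = w (br (br x y) z :: s) + w (br y (br x z) :: s).
  by have := lw [::] s 1 (br (br x y) z) (br y (br x z)); rewrite /= !scale1r.
set a := L x (L y _) s; set b := L y (L x _) s.
set u := L x (fun t => w (br y z :: t)) s; set v := L y (fun t => w (br x z :: t)) s.
move: (w (br (br x y) z :: s)) (w (br y _ :: _)) => p q.
rewrite !(opprB, opprD, opprK) !addrA.
by rewrite [LHS](ACl (1*9*6*(2*5)*(3*7)*(4*8))%AC)/= addNr subrr addNr !addr0.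
Qed.

Lemma ce_lie_diff x w s : multilinear w -> L x (d w) s = d (L x w) s.
Proof.
elim: s w => [|y s IH] w lw /=; first by rewrite linear0.
have lwy := multilinear_contr y lw.
rewrite !ce_lieB (IH _ lwy) ce_diffB -[L x (L y w) s](subrK (L y (L x w) s)).
rewrite ce_lie_bracket//.
set a := L (br x y) w s; set b := L y (L x w) s.
set p := d (L x _) s; set q := d (fun t => w (br x y :: t)) s.
rewrite !(opprB, opprD, opprK) !addrA.
by rewrite [LHS](ACl (2*4*3*(1*5))%AC)/= subrr addr0.
Qed.

(** By Cartan's recursion, contracting d d w by x gives L_x d w - d L_x w + d d of the contraction.
    The first two cancel by [ce_lie_diff]. *)
Lemma ce_diff_diff w s : multilinear w -> d (d w) s = 0.
Proof.
elim: s w => [|x s IH] w lw //=.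
rewrite ce_diffB ce_lie_diff// IH ?subr0 ?subrr//; exact: multilinear_contr.
Qed.

Lemma coadjoint_linear z a f g : Ez z (a *: f + g) = a *: Ez z f + Ez z g.
Proof.
rewrite /coadjoint scaler_sumr -big_split; apply: eq_bigr => k _.
by rewrite /= !linearP.
Qed.

Lemma coadjointB z f g : Ez z (f - g) = Ez z f - Ez z g.
Proof. by rewrite addrC -scaleN1r coadjoint_linear scaleN1r addrC. Qed.

Lemma coadjoint0 z : Ez z 0 = 0.
Proof. by rewrite /coadjoint big1// => k _; rewrite !linear0. Qed.

Lemma coadjoint_sum z (I : Type) (r : seq I) (F : I -> P) :
  Ez z (\sum_(i <- r) F i) = \sum_(i <- r) Ez z (F i).
Proof.
elim: r => [|i r IH]; first by rewrite !big_nil coadjoint0.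
by rewrite !big_cons -[F i]scale1r coadjoint_linear IH !scale1r.
Qed.

Lemma Dsum (I : Type) (r : seq I) (a : I -> R) (v : I -> V) f :
  D (\sum_(i <- r) a i *: v i) f = \sum_(i <- r) a i *: D (v i) f.
Proof.
elim: r => [|i r IH]; last by rewrite !big_cons D_linear IH.
by rewrite !big_nil -[in LHS](addNr 0) -scaleN1r D_linear scaleN1r addNr.
Qed.

Lemma DN x f : D (- x) f = - D x f.
Proof.
have D0 : D 0 f = 0 by have := Dsum [::] (fun i : 'I_0 => 0) (fun=> 0) f; rewrite !big_nil.
by have := D_linear (-1) x 0 f; rewrite D0 !addr0 !scaleN1r.
Qed.

Lemma D_coadjoint z x f : D x (Ez z f) = Ez z (D x f) + D (br z x) f.
Proof.
rewrite /coadjoint linear_sum.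
have -> : br z x = \sum_j x 0 j *: br z (e j).
  rewrite {1}(row_sum_delta x); elim: (index_enum _) => [|i r IH];
    last by rewrite !big_cons br_linearr IH.
  by rewrite !big_nil; have := br_linearr z (-1) 0 0; rewrite !scaleN1r !addNr.
rewrite Dsum -big_split; apply: eq_bigr => k _.
by rewrite /= Dm [D x (D _ _)]DD.
Qed.

Lemma coadjoint_m z k f : Ez z (m k f) = m k (Ez z f) + \sum_l (br z (e l)) 0 k *: m l f.
Proof.
rewrite /coadjoint linear_sum -big_split; apply: eq_bigr => l _.
by rewrite Dm linearD linearZ /= mm.
Qed.

Lemma ce_diff_coadjoint z w s : d (fun t => Ez z (w t)) s = Ez z (d w s).
Proof.
rewrite /coadjoint ce_diff_sum; apply: eq_bigr => k _.
rewrite (ce_diff_comm (T := m k)); last by move=> x f; rewrite Xm.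
by rewrite (ce_diff_comm (T := D _))// => x f; rewrite XD.
Qed.

Lemma iota_linear a w1 w2 s : iota (fun t => a *: w1 t + w2 t) s = a *: iota w1 s + iota w2 s.
Proof. by rewrite /iota scaler_sumr -big_split; apply: eq_bigr => k _; rewrite linearP. Qed.

Lemma iotaB w1 w2 s : iota (fun t => w1 t - w2 t) s = iota w1 s - iota w2 s.
Proof. by rewrite /iota -sumrB; apply: eq_bigr => k _; rewrite linearB. Qed.

Lemma double_eq0 f : f = - f -> f = 0.
Proof.
move=> /eqP; rewrite -addr_eq0 -mulr2n -scaler_nat scaler_eq0 pnatr_eq0.
by move=> /eqP.
Qed.

(** The multiplications commute while the contractions anticommute, so the double sum equals its
    opposite. *)
Lemma iota_iota w s : multilinear w -> alternating w -> iota (iota w) s = 0.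
Proof.
move=> lw aw; apply: double_eq0; rewrite {1}/iota.
under eq_bigr do rewrite linear_sum.
rewrite exchange_big -sumrN; apply: eq_bigr => k _.
rewrite linear_sum -sumrN; apply: eq_bigr => l _ /=.
by rewrite mm -!linearN /= -(alternating_swap [::]).
Qed.

Lemma iota_diff w s : iota (d w) s + d (iota w) s = \sum_k m k (L (e k) w s).
Proof.
rewrite /iota ce_diff_sum -big_split; apply: eq_bigr => k _ /=.
rewrite (ce_diff_comm (T := m k)); last by move=> x f; rewrite Xm.
by rewrite linearB subrK.
Qed.

(** This is the derivative at xi in the direction [xi, xi]. It is where [d_G] needs invariance to
    square to zero: there the Lie derivative along xi becomes this sum. *)
Lemma euler_coadjoint f : \sum_k m k (Ez (e k) f) = 0.
Proof.
apply: double_eq0; rewrite -sumrN.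
under eq_bigr do rewrite linear_sum.
rewrite exchange_big; apply: eq_bigr => k _ /=.
rewrite linear_sum -sumrN; apply: eq_bigr => l _ /=.
by rewrite mm br_antisym DN !linearN.
Qed.

Definition equiv_diff w s : P := d w s - iota w s.

Local Notation dG := equiv_diff.

Lemma ce_lie_ext x w1 w2 s : (forall t, w1 t = w2 t) -> L x w1 s = L x w2 s.
Proof. by move=> /funext ->. Qed.

Lemma ce_diff_ext w1 w2 s : (forall t, w1 t = w2 t) -> d w1 s = d w2 s.
Proof. by move=> /funext ->. Qed.

Lemma ce_homotopy_ext w1 w2 s : (forall t, w1 t = w2 t) -> h w1 s = h w2 s.
Proof. by move=> /funext ->. Qed.

Lemma equiv_diff_square w s : multilinear w -> alternating w -> invariant w ->
  dG (dG w) s = 0.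
Proof.
move=> lw aw vw; rewrite /equiv_diff ce_diffB iotaB ce_diff_diff// iota_iota//.
rewrite sub0r subr0 -opprD addrC iota_diff.
under eq_bigr do rewrite vw.
by rewrite euler_coadjoint oppr0.
Qed.

Lemma invariant_diff w : multilinear w -> invariant w -> invariant (d w).
Proof.
move=> lw vw z s; rewrite ce_lie_diff// -ce_diff_coadjoint.
by apply: ce_diff_ext => t; rewrite vw.
Qed.

(** The polynomial variable is an invariant element: the action on the contracted slot and the
    action on the variable give the same sum, the matrix of [br z] summed over rows or over
    columns. *)
Lemma invariant_iota w : multilinear w -> invariant w -> invariant (iota w).
Proof.
move=> lw vw z s; rewrite /iota ce_lie_sum coadjoint_sum.
under eq_bigr => k _.
  rewrite (ce_lie_comm (T := m k)); last by move=> f; rewrite Xm.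
  have -> : L z (fun t => w (e k :: t)) s = Ez z (w (e k :: s)) + w (br z (e k) :: s).
    by rewrite -vw /= subrK.
  rewrite linearD; over.
under [RHS]eq_bigr do rewrite coadjoint_m.
rewrite !big_split /=; congr (_ + _).
rewrite exchange_big; apply: eq_bigr => l _ /=.
rewrite {1}(row_sum_delta (br z (e l))) (multilinear_sum _ _ _ [::])// linear_sum.
by apply: eq_bigr => k _; rewrite linearZ.
Qed.

(** The homotopy commutes with the defect of invariance. This is stated for arbitrary [w] because
    the induction passes to contractions of [w], which are not invariant. *)
Lemma coadjoint_defect_homotopy z w s :
  L z (h w) s - Ez z (h w s) = h (fun t => L z w t - Ez z (w t)) s.
Proof.
elim: s w => [|x s IH] w /=.
  by rewrite linear0 coadjoint0 subrr.
rewrite ce_lieB (ce_lie_comm (T := D x)); last by move=> f; rewrite XD.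
rewrite coadjointB.
have hE : h (fun t => L z w (x :: t) - Ez z (w (x :: t))) s
    = L z (h (fun t => w (x :: t))) s - Ez z (h (fun t => w (x :: t)) s)
      - h (fun t => w (br z x :: t)) s.
  rewrite IH -ce_homotopyB; apply: ce_homotopy_ext => t /=.
  by rewrite addrAC.
have -> : D x (L z w s - Ez z (w s))
    = D x (L z w s) - (Ez z (D x (w s)) + D (br z x) (w s)).
  by rewrite linearB D_coadjoint.
have := hE; rewrite /= => ->.
set a := D x _; set b := L z _ s; set p := Ez z _; set q := D _ _.
set u := Ez z _; set v := h _ _.
rewrite !(opprB, opprD, opprK) !addrA.
by rewrite [LHS](ACl (1*6*4*3*5*2)%AC).
Qed.

Lemma invariant_homotopy w : invariant w -> invariant (h w).
Proof.
move=> vw z s; apply/eqP; rewrite -subr_eq0 coadjoint_defect_homotopy.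
rewrite (ce_homotopy_ext (w2 := fun t => w t - w t)) => [|t].
  by rewrite ce_homotopyB subrr.
by rewrite vw !subrr.
Qed.

Lemma invariant_linear a w1 w2 : invariant w1 -> invariant w2 ->
  invariant (fun t => a *: w1 t + w2 t).
Proof. by move=> v1 v2 z s; rewrite ce_lie_linear v1 v2 coadjoint_linear. Qed.

(** The commutation relation [Dm] yields one copy of [w s] for each argument, and the empty sequence
    contributes the Euler operator. The remaining terms cancel because [w] alternates. *)
Lemma homotopyP w s : multilinear w -> alternating w ->
  iota (h w) s + h (iota w) s = euler (w s) + w s *+ size s.
Proof.
elim: s w => [|x s IH] w lw aw /=.
  rewrite mulr0n !addr0 /iota /euler; apply: eq_bigr => k _ /=.
  by rewrite subr0.
have lwx := multilinear_contr x lw; have awx := alternating_contr x aw.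
have e1 : D x (iota w s) = \sum_k m k (D x (w (e k :: s))) + w (x :: s).
  rewrite /iota linear_sum; under eq_bigr => k _ do rewrite /= Dm.
  rewrite big_split /=; congr (_ + _).
  by rewrite [in RHS](row_sum_delta x) (multilinear_sum _ _ _ [::]).
have e2 : h (fun t => iota w (x :: t)) s = - h (iota (fun t => w (x :: t))) s.
  rewrite -ce_homotopyN; apply: ce_homotopy_ext => t.
  rewrite /iota -sumrN; apply: eq_bigr => k _.
  by rewrite (alternating_swap [::])// linearN.
have e3 : iota (h w) (x :: s) = - (\sum_k m k (D x (w (e k :: s))))
    + iota (h (fun t => w (x :: t))) s.
  rewrite /iota -sumrN -big_split; apply: eq_bigr => k _ /=.
  rewrite -linearN -linearD; congr (m k _).
  have -> : h (fun t => w (e k :: x :: t)) s = - h (fun t => w (x :: e k :: t)) s.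
    rewrite -ce_homotopyN; apply: ce_homotopy_ext => t.
    by rewrite (alternating_swap [::]).
  by rewrite opprK opprD [RHS]addrCA.
rewrite e1 e2 opprK e3 mulrS -addrA [X in _ + X]addrC addrA.
have := IH _ lwx awx => IHx.
rewrite [in RHS]addrCA -IHx.
set a := \sum_k _; set b := iota _ _; set p := w (x :: s); set q := h _ _.
by rewrite !addrA [LHS](ACl (3*5*4*(1*2))%AC)/= addNr addr0.
Qed.

Lemma multilinear_linear a w1 w2 : multilinear w1 -> multilinear w2 ->
  multilinear (fun t => a *: w1 t + w2 t).
Proof.
move=> l1 l2 s1 s2 b x y; rewrite l1 l2 !scalerDr !scalerA [b * a]mulrC.
by rewrite !addrA; congr (_ + _); rewrite addrAC.
Qed.

Lemma alternating_linear a w1 w2 : alternating w1 -> alternating w2 ->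
  alternating (fun t => a *: w1 t + w2 t).
Proof. by move=> a1 a2 s1 s2 x; rewrite a1 a2 scaler0 addr0. Qed.

Lemma multilinear_lie z w : multilinear w -> multilinear (L z w).
Proof.
move=> lw s1; elim: s1 w lw => [|b s1 IH] w lw s2 a x y /=.
  have -> : (fun t => w (a *: x + y :: t)) = fun t => a *: w (x :: t) + w (y :: t).
    by apply/funext => t; exact: (lw [::]).
  rewrite ce_lie_linear br_linearr (lw [::] s2)/= scalerBr opprD addrACA //.
rewrite (IH _ (multilinear_contr b lw)) (lw (br z b :: s1) s2)/=.
by rewrite scalerBr opprD addrACA.
Qed.

Lemma alternating_lie z w : multilinear w -> alternating w -> alternating (L z w).
Proof.
move=> lw aw s1; elim: s1 w lw aw => [|b s1 IH] w lw aw s2 x /=.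
  have -> : (fun t => w [:: x, x & t]) = fun t => w t - w t.
    by apply/funext => t; rewrite (aw [::]) subrr.
  rewrite ce_lieB subrr sub0r -opprD (alternating_swap [::])// addrC.
  by rewrite subrr oppr0.
by rewrite (IH _ (multilinear_contr b lw) (alternating_contr b aw)) (aw (br z b :: s1)) subrr.
Qed.

Lemma multilinear_diff w : multilinear w -> multilinear (d w).
Proof.
move=> lw s1; elim: s1 w lw => [|b s1 IH] w lw s2 a x y /=.
  have -> : (fun t => w (a *: x + y :: t)) = fun t => a *: w (x :: t) + w (y :: t).
    by apply/funext => t; exact: (lw [::]).
  by rewrite ce_diff_linear ce_lie_linearl// scalerBr opprD addrACA.
rewrite (IH _ (multilinear_contr b lw)) (multilinear_lie b lw).
by rewrite scalerBr opprD addrACA.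
Qed.

Lemma alternating_diff w : multilinear w -> alternating w -> alternating (d w).
Proof.
move=> lw aw s1; elim: s1 w lw aw => [|b s1 IH] w lw aw s2 x /=.
  rewrite brxx (multilinear0 [::])// subr0.
  have -> : (fun t => w [:: x, x & t]) = fun t => w t - w t.
    by apply/funext => t; rewrite (aw [::]) subrr.
  by rewrite ce_diffB subrr subr0 subrr.
by rewrite (IH _ (multilinear_contr b lw) (alternating_contr b aw)) (alternating_lie b lw aw) subrr.
Qed.

Lemma multilinear_iota w : multilinear w -> multilinear (iota w).
Proof.
move=> lw s1 s2 a x y; rewrite /iota scaler_sumr -big_split; apply: eq_bigr => k _.
by rewrite (lw (e k :: s1)) /= linearP.
Qed.

Lemma alternating_iota w : alternating w -> alternating (iota w).
Proof.
move=> aw s1 s2 x; rewrite /iota big1// => k _.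
by rewrite (aw (e k :: s1)) linear0.
Qed.

Lemma multilinear_homotopy w : multilinear w -> multilinear (h w).
Proof.
move=> lw s1; elim: s1 w lw => [|b s1 IH] w lw s2 a x y /=.
  have -> : (fun t => w (a *: x + y :: t)) = fun t => a *: w (x :: t) + w (y :: t).
    by apply/funext => t; exact: (lw [::]).
  by rewrite ce_homotopy_linear D_linear scalerBr opprD addrACA.
rewrite (IH _ (multilinear_contr b lw)) lw linearP.
by rewrite scalerBr opprD addrACA.
Qed.

Lemma alternating_homotopy w : alternating w -> alternating (h w).
Proof.
move=> aw s1; elim: s1 w aw => [|b s1 IH] w aw s2 x /=.
  have -> : (fun t => w [:: x, x & t]) = fun t => w t - w t.
    by apply/funext => t; rewrite (aw [::]) subrr.
  by rewrite ce_homotopyB subrr subr0 subrr.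
by rewrite (IH _ (alternating_contr b aw)) aw linear0 subrr.
Qed.

(** * Total degree and acyclicity *)

Section Grading.
Variable hom : nat -> P -> Prop.
Hypothesis hom0 : forall j, hom j 0.
Hypothesis hom_linear : forall j a f g, hom j f -> hom j g -> hom j (a *: f + g).
Hypothesis hom_X : forall j x f, hom j f -> hom j (X x f).
Hypothesis hom_m : forall j k f, hom j f -> hom j.+1 (m k f).
Hypothesis hom_D : forall j x f, hom j.+1 f -> hom j (D x f).
Hypothesis hom_D0 : forall x f, hom 0 f -> D x f = 0.
Hypothesis hom_euler : forall j f, hom j f -> euler f = f *+ j.

(* [f] is a value of the component of degree [q] of a cochain of total degree [N]. *)
Definition homog N q f := f = 0 \/ exists2 j, (q + 2 * j)%N = N & hom j f.

Definition graded N w := forall s, homog N (size s) (w s).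

Lemma homog0 N q : homog N q 0. Proof. by left. Qed.

Lemma homog_linear N q a f g : homog N q f -> homog N q g -> homog N q (a *: f + g).
Proof.
move=> [->|[j jN hf]]; first by rewrite scaler0 add0r.
move=> [->|[i iN hg]]; first by right; exists j => //; exact: hom_linear.
have ij : i = j by lia.
by rewrite ij in hg; right; exists j => //; exact: hom_linear.
Qed.

Lemma homogB N q f g : homog N q f -> homog N q g -> homog N q (f - g).
Proof. by move=> hf hg; rewrite addrC -scaleN1r; exact: homog_linear. Qed.

Lemma homog_sum N q (F : 'I_n -> P) : (forall k, homog N q (F k)) -> homog N q (\sum_k F k).
Proof.
move=> hF; apply: (big_ind (homog N q)) => [|f g hf hg|k _]; [exact: homog0| |exact: hF].
by rewrite -[f]scale1r; exact: homog_linear.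
Qed.

Lemma homogS N q f : homog N q f -> homog N.+1 q.+1 f.
Proof. by move=> [->|[j jN hf]]; [left|right; exists j => //; rewrite -jN]. Qed.

(** The offset [c] counts the arguments already filled in by contraction, which the recursion on [s]
    removes from its length. *)
Lemma graded_lie N c z w : (forall s, homog N (size s + c) (w s)) ->
  forall s, homog N (size s + c) (L z w s).
Proof.
move=> gw s; elim: s c w gw => [|b s IH] c w gw /=.
  case: (gw [::]) => [->|[j jN hf]]; first by rewrite linear0; left.
  by right; exists j => //; exact: hom_X.
apply: homogB; last exact: (gw (br z b :: s)).
by rewrite addSnnS; apply: IH => t; rewrite -addSnnS; exact: (gw (b :: t)).
Qed.

Lemma graded_diff N c w : (forall s, homog N (size s + c) (w s)) ->
  forall s, homog N.+1 (size s + c) (d w s).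
Proof.
move=> gw s; elim: s c w gw => [|b s IH] c w gw /=; first exact: homog0.
apply: homogB; first exact/homogS/graded_lie.
by rewrite addSnnS; apply: IH => t; rewrite -addSnnS; exact: (gw (b :: t)).
Qed.

(** One exterior slot is lost and one polynomial variable of weight 2 is gained. *)
Lemma graded_iota N w : graded N w -> graded N.+1 (iota w).
Proof.
move=> gw s; apply: homog_sum => k; case: (gw (e k :: s)) => [->|[j jN hf]].
  by rewrite linear0; left.
by right; exists j.+1; [rewrite /= in jN; lia|exact: hom_m].
Qed.

Lemma graded_homotopy N c w : (forall s, homog N.+1 (size s + c) (w s)) ->
  forall s, homog N (size s + c) (h w s).
Proof.
move=> gw s; elim: s c w gw => [|b s IH] c w gw /=; first exact: homog0.
apply: homogB.
  case: (gw s) => [->|[[|j] jN hf]]; first by rewrite linear0; left.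
    by rewrite hom_D0//; left.
  by right; exists j; [lia|exact: hom_D].
by rewrite addSnnS; apply: IH => t; rewrite -addSnnS; exact: (gw (b :: t)).
Qed.

Record weil_cochain N w : Prop := WeilCochain {
  weil_multilinear : multilinear w;
  weil_alternating : alternating w;
  weil_graded : graded N w;
  weil_invariant : invariant w }.

Lemma weil_cochain_linear N a w1 w2 : weil_cochain N w1 -> weil_cochain N w2 ->
  weil_cochain N (fun t => a *: w1 t + w2 t).
Proof.
move=> [l1 a1 g1 v1] [l2 a2 g2 v2]; split.
- exact: multilinear_linear.
- exact: alternating_linear.
- by move=> s; apply: homog_linear.
- exact: invariant_linear.
Qed.

Lemma weil_cochain0 N : weil_cochain N (fun=> 0).
Proof.
split=> [s1 s2 a x y|s1 s2 x|s|z s]; [by rewrite scaler0 addr0|by []|exact: homog0|].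
rewrite coadjoint0 -[RHS](subrr (L z (fun=> 0) s)) -ce_lieB.
by apply: ce_lie_ext => t; rewrite subr0.
Qed.

Lemma weil_cochain_diff N w : weil_cochain N w -> weil_cochain N.+1 (dG w).
Proof.
move=> [lw aw gw vw].
have -> : dG w = fun t => (-1) *: iota w t + d w t.
  by apply/funext => t; rewrite scaleN1r addrC.
split.
- by apply: multilinear_linear; [exact: multilinear_iota|exact: multilinear_diff].
- by apply: alternating_linear; [exact: alternating_iota|exact: alternating_diff].
- move=> s; apply: homog_linear; first exact: graded_iota.
  by rewrite -[size s]addn0; apply: graded_diff => t; rewrite addn0.
- by apply: invariant_linear; [exact: invariant_iota|exact: invariant_diff].
Qed.

Lemma weil_cochain_homotopy N w : weil_cochain N.+1 w -> weil_cochain N (h w).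
Proof.
move=> [lw aw gw vw]; split.
- exact: multilinear_homotopy.
- exact: alternating_homotopy.
- by move=> s; rewrite -[size s]addn0; apply: graded_homotopy => t; rewrite addn0.
- exact: invariant_homotopy.
Qed.

Definition component k w s : P := if size s == k then w s else 0.

Lemma ce_lie_component c k z w s :
  L z (fun t => if (size t + c)%N == k then w t else 0) s
  = if (size s + c)%N == k then L z w s else 0.
Proof.
elim: s c w => [|b s IH] c w /=; first by case: ifP; rewrite ?linear0.
under ce_lie_ext => t do rewrite addSnnS.
by rewrite IH addSnnS; case: ifP => //; rewrite subrr.
Qed.

Lemma weil_cochain_component N k w : weil_cochain N w -> weil_cochain N (component k w).
Proof.
move=> [lw aw gw vw]; split.
- move=> s1 s2 a x y; rewrite /component !size_cat /=; case: ifP => _; first exact: lw.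
  by rewrite scaler0 addr0.
- by move=> s1 s2 x; rewrite /component aw; case: ifP.
- by move=> s; rewrite /component; case: ifP => _; [exact: gw|left].
- move=> z s; have := ce_lie_component 0 k z w s; rewrite addn0.
  under ce_lie_ext => t do rewrite addn0.
  move=> ->; rewrite /component; case: ifP => _; first exact: vw.
  by rewrite coadjoint0.
Qed.

Lemma ce_lie_low k z w : (forall t, (size t < k)%N -> w t = 0) ->
  forall s, (size s < k)%N -> L z w s = 0.
Proof.
move=> w0 s; elim: s k w w0 => [|b s IH] k w w0 /= sk; first by rewrite w0// linear0.
rewrite w0// subr0; case: k w0 sk => // k w0 sk.
by apply: (IH k) => // t tk; exact: w0.
Qed.

Lemma ce_diff_low k w : (forall t, (size t < k)%N -> w t = 0) ->
  forall s, (size s <= k)%N -> d w s = 0.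
Proof.
move=> w0 s; elim: s k w w0 => [|b s IH] k w w0 //= sk.
rewrite (ce_lie_low _ w0)// sub0r; case: k w0 sk => // k w0 sk.
by rewrite (IH k) ?oppr0// => t tk; exact: w0.
Qed.

Lemma ce_homotopy_low k w : (forall t, (size t < k)%N -> w t = 0) ->
  forall s, (size s <= k)%N -> h w s = 0.
Proof.
move=> w0 s; elim: s k w w0 => [|b s IH] k w w0 //= sk.
rewrite w0// linear0 sub0r; case: k w0 sk => // k w0 sk.
by rewrite (IH k) ?oppr0// => t tk; exact: w0.
Qed.

Lemma equiv_diff_linear a w1 w2 s :
  dG (fun t => a *: w1 t + w2 t) s = a *: dG w1 s + dG w2 s.
Proof.
by rewrite /equiv_diff ce_diff_linear iota_linear scalerBr opprD addrACA.
Qed.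

Lemma equiv_diff0 s : dG (fun=> 0) s = 0.
Proof.
rewrite -[RHS](addNr (dG (fun=> 0) s)) -scaleN1r -equiv_diff_linear; congr (dG _ s).
by apply/funext => t; rewrite scaler0 addr0.
Qed.

(* The lowest component [w_k] of a cocycle satisfies [iota w_k = 0], hence [w_k] is a multiple of [iota (h w_k)]
   and adding a multiple of the coboundary of [h w_k] removes it. *)
Lemma weil_acyclic_from N i k w : (k + i)%N = N.+2 -> weil_cochain N.+1 w ->
  (forall s, dG w s = 0) -> (forall s, (size s < k)%N -> w s = 0) ->
  exists2 b, weil_cochain N b & forall s, w s = dG b s.
Proof.
elim: i k w => [|i IH] k w ki cw zw w0.
  exists (fun=> 0); first exact: weil_cochain0.
  move=> s; rewrite equiv_diff0.
  (* Here [k] is [N.+2], and no bidegree of total degree [N.+1] has that many exterior slots. *)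
  case: (ltnP (size s) k) => sk; first exact: w0.
  by case: (weil_graded cw s) => // -[j jN _]; lia.
(* If [k] has the wrong parity or is too large, the component of exterior degree [k] is already
   zero. *)
have [[j kj]|nj] := pselect (exists j, (k + 2 * j)%N = N.+1); last first.
  apply: (IH k.+1) => //; first by lia.
  move=> s; rewrite ltnS leq_eqVlt => /orP[/eqP sk|]; last exact: w0.
  by case: (weil_graded cw s) => // -[j jN _]; case: nj; exists j; rewrite -sk.
pose u := component k w.
have cu : weil_cochain N.+1 u by exact: weil_cochain_component.
have iu s : iota u s = 0.
  rewrite /iota /u /component /=; case: (eqVneq (size s).+1 k) => sk; last first.
    by rewrite big1// => l _; rewrite linear0.
  (* On [k.-1] arguments the differential only sees values of [w] on fewer than [k] arguments, which
     vanish; the cocycle condition reduces to the contraction. *)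
  have := zw s; rewrite /equiv_diff (ce_diff_low (k := k.-1)) ?sub0r.
  - by move=> /eqP; rewrite oppr_eq0 => /eqP.
  - by move=> t tk; apply: w0; lia.
  - by lia.
(* The inverse of the exterior degree plus the polynomial degree. It exists because [k + 2 * j] is
   positive. *)
pose c : R := (k + j)%:R^-1.
have kj0 : (k + j)%:R != 0 :> R by rewrite pnatr_eq0; lia.
have ihu s : iota (h u) s = (k + j)%:R *: u s.
  have := homotopyP s (weil_multilinear cu) (weil_alternating cu).
  have -> : h (iota u) s = 0.
    apply: (ce_homotopy_low (k := size s)) => // t _; exact: iu.
  rewrite addr0 => ->; rewrite /u /component; case: eqP => [sk|_]; last first.
    by rewrite mul0rn addr0 scaler0 /euler big1// => l _; rewrite !linear0.
  case: (weil_graded cw s) => [->|[l lN hl]].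
    by rewrite mul0rn addr0 scaler0 /euler big1// => l _; rewrite !linear0.
  have lj : l = j by lia.
  by rewrite (hom_euler hl) -mulrnDr scaler_nat sk lj addnC.
pose b s := c *: h u s + 0.
have cb : weil_cochain N b.
  exact: weil_cochain_linear (weil_cochain_homotopy cu) (weil_cochain0 N).
have b0 s : (size s < k.+1)%N -> b s = 0.
  move=> sk; rewrite /b addr0 (ce_homotopy_low (k := k))// ?scaler0// => t tk.
  by rewrite /u /component ltn_eqF.
have ib s : iota b s = u s.
  rewrite /b iota_linear ihu scalerA mulVf// scale1r.
  by rewrite [X in _ + X]big1 ?addr0// => l _; rewrite linear0.
(* The contraction of [b] is [u] and enters [dG] with a minus sign, while [ce_diff] of [b] starts
   above degree [k]. So the sum cancels the component of degree [k]. *)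
pose w1 s := 1 *: dG b s + w s.
have cw1 : weil_cochain N.+1 w1.
  exact: weil_cochain_linear (weil_cochain_diff cb) cw.
have [||||b1 cb1 wb1] := IH k.+1 w1.
- by lia.
- exact: cw1.
- move=> s; rewrite /w1 equiv_diff_linear zw addr0 scale1r.
  exact: equiv_diff_square (weil_multilinear cb) (weil_alternating cb) (weil_invariant cb).
- move=> s; rewrite ltnS => sk; rewrite /w1 scale1r /equiv_diff ib.
  rewrite (ce_diff_low b0) ?sub0r; last by rewrite ltnW.
  rewrite /u /component; case: eqP => [_|/eqP nk]; first by rewrite addNr.
  by rewrite oppr0 add0r w0// ltn_neqAle nk.
exists (fun t => (-1) *: b t + b1 t); first exact: weil_cochain_linear.
by move=> s; rewrite equiv_diff_linear -wb1 /w1 scale1r scaleN1r addKr.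
Qed.

Lemma weil_acyclic N w : weil_cochain N.+1 w -> (forall s, dG w s = 0) ->
  exists2 b, weil_cochain N b & forall s, w s = dG b s.
Proof. by move=> cw zw; apply: (@weil_acyclic_from N N.+2 0 w). Qed.

End Grading.
End WeilComplex.

(** * The dual Lie algebra *)

Section StructureConstants.
Context (R : comRingType) (n : nat).
Variable c : 'I_n -> 'I_n -> 'I_n -> R.
Hypothesis c_antisym : forall i j k, c i j k = - c j i k.
Hypothesis c_jacobi : forall i j k m,
  \sum_l (c j k l * c i l m + c k i l * c j l m + c i j l * c k l m) = 0.
Implicit Types (u v w : 'rV[R]_n).

Definition const_br u v : 'rV[R]_n := \row_k \sum_i \sum_j u 0 i * v 0 j * c i j k.

Lemma const_br_linearr u a v w : const_br u (a *: v + w) = a *: const_br u v + const_br u w.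
Proof.
apply/rowP => k; rewrite !mxE mulr_sumr -big_split; apply: eq_bigr => i _.
rewrite mulr_sumr -big_split; apply: eq_bigr => j _; rewrite !mxE /=; ring.
Qed.

Lemma const_br_antisym u v : const_br u v = - const_br v u.
Proof.
apply/rowP => k; rewrite !mxE -sumrN exchange_big; apply: eq_bigr => i _.
rewrite -sumrN; apply: eq_bigr => j _ /=; rewrite c_antisym; ring.
Qed.

Lemma const_br_cyclic u v w :
  const_br u (const_br v w) + const_br v (const_br w u) + const_br w (const_br u v) = 0.
Proof.
apply/rowP => m; rewrite [LHS]mxE [X in X + _]mxE [RHS]mxE.
pose J i j k := \sum_l c j k l * c i l m.
have T u' v' w' : const_br u' (const_br v' w') 0 m
   = \sum_i \sum_j \sum_k u' 0 i * v' 0 j * w' 0 k * J i j k.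
  rewrite mxE; apply: eq_bigr => i _.
  under eq_bigr => l _ do rewrite mxE mulr_sumr mulr_suml.
  rewrite exchange_big; apply: eq_bigr => j _.
  under eq_bigr => l _ do rewrite mulr_sumr mulr_suml.
  rewrite exchange_big; apply: eq_bigr => k _.
  rewrite /J mulr_sumr; apply: eq_bigr => l _; ring.
rewrite !T.
have -> : \sum_i \sum_j \sum_k v 0 i * w 0 j * u 0 k * J i j k
   = \sum_i \sum_j \sum_k u 0 i * v 0 j * w 0 k * J j k i.
  rewrite [RHS]exchange_big; apply: eq_bigr => j _.
  rewrite [RHS]exchange_big; apply: eq_bigr => k _; apply: eq_bigr => i _ /=; ring.
have -> : \sum_i \sum_j \sum_k w 0 i * u 0 j * v 0 k * J i j k
   = \sum_i \sum_j \sum_k u 0 i * v 0 j * w 0 k * J k i j.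
  rewrite exchange_big; apply: eq_bigr => i _.
  rewrite /= exchange_big; apply: eq_bigr => j _; apply: eq_bigr => k _ /=; ring.
rewrite -!big_split big1// => i _; rewrite -!big_split big1// => j _.
rewrite -!big_split big1// => k _ /=.
by rewrite -!mulrDr /J -!big_split /= c_jacobi mulr0.
Qed.

(** Extends a commutation relation between frame elements bilinearly to arbitrary combinations. *)
Lemma const_br_sum u v (A : 'I_n -> 'I_n -> R) (B : 'I_n -> R) :
  (forall i j, A i j - A j i = \sum_k c i j k * B k) ->
  \sum_i \sum_j u 0 i * v 0 j * A i j - \sum_i \sum_j v 0 i * u 0 j * A i j
  = \sum_k const_br u v 0 k * B k.
Proof.
move=> AB; under [RHS]eq_bigr => k _ do rewrite mxE mulr_suml.
rewrite [RHS]exchange_big [X in _ - X]exchange_big -sumrB; apply: eq_bigr => i _ /=.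
under [RHS]eq_bigr => k _ do rewrite mulr_suml.
rewrite [RHS]exchange_big -sumrB; apply: eq_bigr => j _ /=.
under [RHS]eq_bigr => k _ do rewrite -mulrA.
by rewrite -mulr_sumr -AB; ring.
Qed.

End StructureConstants.

(** * The bracket of g through the duality pairing *)

Section DualBracket.
Context (R : realType) (n : nat) (G : topologicalGroupDataType) (C : atlas R n G).
Hypothesis hG : is_lie_group C.
Variable pi : G -> 'M[R]_n.
Hypothesis hpi : is_poisson C pi.
Hypothesis hmult : is_multiplicative C pi.
Variable K : 'M[R]_n.
Hypothesis hK : K \in unitmx.
Variable br : 'rV[R]_n -> 'rV[R]_n -> 'rV[R]_n.
Hypothesis br_dual : forall x y u,
  pairing u ((br x y *m K)^T) = delta C pi u ((x *m K)^T) ((y *m K)^T).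
Implicit Types (U V : set G) (f : G -> R) (p q : G) (x y z : 'rV[R]_n).

Let hM := lie_manifold hG.
Local Notation E := (lframe C).
Local Notation Th := (lcoframe C).
Local Notation X := (lham C pi).
Local Notation c := (dual_const C pi).

Definition dual_form x : form R n G := left_form C ((x *m K)^T).
Local Notation th := dual_form.

(** The element of g whose form [th] takes the value [a p] at [p], see [dual_coordK]. *)
Definition dual_coord (a : form R n G) p : 'rV[R]_n :=
  (\row_i pairing (E i p) (a p)) *m invmx K.

Lemma dual_formE x p : th x p = \sum_i (x *m K) 0 i *: Th i p.
Proof. by rewrite /dual_form (left_form_sum hG); apply: eq_bigr => i _; rewrite mxE. Qed.

Lemma smooth_dual_form U x : smooth_form C U (th x).
Proof. exact: smooth_left_form. Qed.

Lemma dual_form_linear a x y p : th (a *: x + y) p = a *: th x p + th y p.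
Proof.
rewrite !dual_formE scaler_sumr -big_split; apply: eq_bigr => i _.
by rewrite mulmxDl -scalemxAl !mxE scalerDl scalerA.
Qed.

Lemma dual_coordK a p : th (dual_coord a p) p = a p.
Proof.
rewrite dual_formE /dual_coord mulmxKV// [RHS](lcoframe_expand hG _ p).
by apply: eq_bigr => i _; rewrite mxE.
Qed.

Lemma dual_formK x p : dual_coord (th x) p = x.
Proof.
rewrite /dual_coord -[RHS](mulmxK hK); congr (_ *m _); apply/rowP => i.
by rewrite mxE (pairing_left hG) pairing_delta mxE.
Qed.

Lemma smooth_dual_coord U a k : open U -> smooth_form C U a ->
  smooth C U (fun p => dual_coord a p 0 k).
Proof.
move=> oU sa.
have sE i : smooth C U (fun p => pairing (E i p) (a p)).
  exact: (smooth_pairing oU (smooth_left_vfield hG (U:=U) (delta_mx 0 i)) sa).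
have sS : smooth C U (fun p => \sum_i pairing (E i p) (a p) * invmx K i k).
  by apply: (smooth_sum hM _ oU) => i _; exact: (smoothM hM oU (sE i) (smooth_cst C U _)).
apply: (smooth_ext hM oU) sS => p _; rewrite /dual_coord [RHS]mxE.
by apply: eq_bigr => i _; rewrite mxE.
Qed.

Lemma delta_expand u (a b : 'cV[R]_n) :
  delta C pi u a b = \sum_i \sum_j a i 0 * b j 0
    * delta C pi u (delta_mx i 0) (delta_mx j 0).
Proof.
have o1 := mfd_dom_open hM 1%g; have d1 := mfd_dom_center hM 1%g.
pose y i (g : G) := coord C 1%g g 0 i.
have sy i : smooth C (cdom C 1%g) (y i) by exact: smooth_coord.
have yE i : (fun g => pairing (coord C 1%g g) (delta_mx i 0)) = y i.
  apply/funext => g; rewrite pairingE (bigD1 i)//= big1 => [|l li].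
    by rewrite mxE !eqxx mulr1 addr0.
  by rewrite mxE (negbTE li) mulr0.
pose l (a : 'cV[R]_n) (g : G) := \sum_i a i 0 * y i g.
have lE a0 : (fun g => pairing (coord C 1%g g) a0) = l a0.
  by apply/funext => g; rewrite pairingE; apply: eq_bigr => i _; rewrite mulrC.
have say (a0 : 'cV[R]_n) i := smoothM hM o1 (smooth_cst C _ (a0 i 0)) (sy i).
have sl a0 : smooth C (cdom C 1%g) (l a0).
  by apply: (smooth_sum hM _ o1) => i _; exact: say.
have dl a0 g v : cdom C 1%g g -> dir C (l a0) g v = \sum_i a0 i 0 * dir C (y i) g v.
  move=> dg; rewrite (dir_sum hM _ _ o1 dg (fun i _ => say a0 i)).
  by apply: eq_bigr => i _; rewrite (dirZ hM _ _ dg (sy i)).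
have dfl a0 g : cdom C 1%g g -> df C (l a0) g = \sum_i a0 i 0 *: df C (y i) g.
  move=> dg; apply/colP => k; rewrite mxE (dl _ _ _ dg) summxE.
  by apply: eq_bigr => i _; rewrite !mxE.
have pb g : cdom C 1%g g -> pbracket C pi (l a) (l b) g
    = \sum_i \sum_j a i 0 * b j 0 * pbracket C pi (y i) (y j) g.
  move=> dg; rewrite /pbracket /sharp (dfl a g dg) (dfl b g dg).
  rewrite linear_sum mulmx_suml /pairing mulmx_suml summxE; apply: eq_bigr => i _.
  rewrite linearZ /= -!scalemxAl mxE mulmx_sumr summxE mulr_sumr; apply: eq_bigr => j _.
  by rewrite -scalemxAr mxE mulrA.
have syy i j := smooth_pbracket hM hpi o1 (sy i) (sy j).
have scyy i j := smoothM hM o1 (smooth_cst C _ (a i 0 * b j 0)) (syy i j).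
have sS i := smooth_sum hM (index_enum 'I_n) (P := xpredT) o1 (fun j _ => scyy i j).
rewrite /delta !lE (dir_ext hM _ o1 d1 pb) (dir_sum hM _ _ o1 d1 (fun i _ => sS i)).
apply: eq_bigr => i _; rewrite (dir_sum hM _ _ o1 d1 (fun j _ => scyy i j)).
by apply: eq_bigr => j _; rewrite (dirZ hM _ _ d1 (syy i j)) !yE.
Qed.

Lemma brK x y k : (br x y *m K) 0 k = \sum_i \sum_j (x *m K) 0 i * (y *m K) 0 j * c i j k.
Proof.
have := br_dual x y (delta_mx 0 k); rewrite pairing_delta mxE delta_expand => ->.
by apply: eq_bigr => i _; apply: eq_bigr => j _; rewrite !mxE.
Qed.

Lemma rowK_inj x y : (forall k, (x *m K) 0 k = (y *m K) 0 k) -> x = y.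
Proof.
by move=> xy; rewrite -[x](mulmxK hK) -[y](mulmxK hK); congr (_ *m _); apply/rowP.
Qed.

(** An abstract operation [br] dual to [delta] is determined by the structure constants. Its
    bilinearity, antisymmetry and Jacobi identity are thus consequences of the Poisson structure. *)
Lemma br_const x y : br x y = const_br c (x *m K) (y *m K) *m invmx K.
Proof.
apply: rowK_inj => k; rewrite mulmxKV// [RHS]mxE; exact: brK.
Qed.

Lemma br_linearr x a y z : br x (a *: y + z) = a *: br x y + br x z.
Proof.
by rewrite !br_const mulmxDl -[a *: y *m K]scalemxAl const_br_linearr mulmxDl -scalemxAl.
Qed.

Lemma br_antisym x y : br x y = - br y x.
Proof.
by rewrite !br_const (const_br_antisym (dual_const_antisym hG hpi)) mulNmx.
Qed.

Lemma br_cyclic x y z : br x (br y z) + br y (br z x) + br z (br x y) = 0.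
Proof.
rewrite !br_const !mulmxKV// -!mulmxDl.
by rewrite (const_br_cyclic (dual_const_jacobi hG hpi hmult)) mul0mx.
Qed.

Lemma br_jacobi x y z : br x (br y z) = br (br x y) z + br y (br x z).
Proof.
have brN a b : br a (- b) = - br a b.
  have br0 : br a 0 = 0 by have := br_linearr a (-1) 0 0; rewrite !scaleN1r !addNr.
  by have := br_linearr a (-1) b 0; rewrite !scaleN1r br0 !addr0.
have /eqP := br_cyclic x y z; rewrite -addrA addr_eq0 => /eqP ->.
by rewrite (br_antisym z x) brN (br_antisym z (br x y)) opprD !opprK addrC.
Qed.

Lemma dir_dual_form U f x p : open U -> U p -> smooth C U f ->
  dir C f p (sharp pi (th x) p) = \sum_i (x *m K) 0 i * dir C f p (X i p).
Proof.
by move=> oU Up sf; exact: (dir_sharp_sum hG pi oU Up sf (dual_formE x p)).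
Qed.

Lemma smooth_sharp_dual_form U x : open U -> smooth_vfield C U (sharp pi (th x)).
Proof. by move=> oU; apply: (smooth_sharp hM hpi oU); exact: smooth_dual_form. Qed.

Lemma dir_dual_form_bracket U f x y p : open U -> U p -> smooth C U f ->
  dir C (fun q => dir C f q (sharp pi (th y) q)) p (sharp pi (th x) p)
  - dir C (fun q => dir C f q (sharp pi (th x) q)) p (sharp pi (th y) p)
  = dir C f p (sharp pi (th (br x y)) p).
Proof.
move=> oU Up sf.
have sX i : smooth C U (fun q => dir C f q (X i q)).
  exact: (smooth_dir oU sf (smooth_lham hG hpi i oU)).
have sxX (z : 'rV[R]_n) i := smoothM hM oU (smooth_cst C U ((z *m K) 0 i)) (sX i).
have T x' y' : dir C (fun q => dir C f q (sharp pi (th y') q)) p (sharp pi (th x') p)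
   = \sum_i \sum_j (x' *m K) 0 i * (y' *m K) 0 j * dir C (fun q => dir C f q (X j q)) p (X i p).
  rewrite (dir_ext hM _ oU Up (fun q Uq => dir_dual_form y' oU Uq sf)).
  rewrite (dir_sum hM _ _ oU Up (fun i _ => sxX y' i)) exchange_big; apply: eq_bigr => j _ /=.
  rewrite (dirZ hM _ _ Up (sX j)) (dir_dual_form x' oU Up (sX j)) mulr_sumr.
  by apply: eq_bigr => i _; rewrite mulrA [_ * (x' *m K) 0 i]mulrC.
apply: etrans (f_equal2 (fun r r' : R => r - r') (T x y) (T y x)) _.
apply: etrans _ (esym (dir_dual_form (br x y) oU Up sf)).
apply: etrans (const_br_sum _ _ (fun i j => lham_bracket hG hpi hmult i j oU Up sf)) _.
by apply: eq_bigr => k _; rewrite brK mxE.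
Qed.

Lemma fbracket_dual_form x y p : fbracket C pi (th x) (th y) p = th (br x y) p.
Proof.
have oV := open_left_dom hG p; have Vp := left_dom_center hG p.
have sT i : smooth_form C (left_dom C p) (Th i) by exact: smooth_left_form.
have thE z : th z = fun q => \sum_i (fun=> (z *m K) 0 i : R) q *: Th i q.
  by apply/funext => q; exact: dual_formE.
have sc (z : 'rV[R]_n) i : smooth C (left_dom C p) (fun=> (z *m K) 0 i) by exact: smooth_cst.
rewrite (thE x) (fbracket_suml hG hpi _ oV Vp (sc x) sT (@smooth_dual_form (left_dom C p) y)).
rewrite (thE y) dual_formE.
under eq_bigr => i _.
  rewrite (fbracket_sumr hG hpi _ oV Vp (sc y) sT (sT i)) dir_cst scale0r subr0 scaler_sumr.
  under eq_bigr => j _ do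
    rewrite dir_cst scale0r addr0 (fbracket_lcoframe hG hpi hmult) !scaler_sumr.
  rewrite exchange_big; over.
rewrite exchange_big; apply: eq_bigr => k _.
rewrite brK scaler_suml; apply: eq_bigr => i _.
by rewrite scaler_suml; apply: eq_bigr => j _; rewrite !scalerA.
Qed.

End DualBracket.

(** * Tensoriality of the Poisson differential *)

Lemma big_ord_gt0 (R : nmodType) m (F : 'I_m.+1 -> R) :
  \sum_(j < m.+1 | (0 < j)%N) F j = \sum_(j < m) F (lift ord0 j).
Proof. by rewrite big_mkcond big_ord_recl /= add0r. Qed.

Lemma big_ord_gtS (R : nmodType) m i (F : 'I_m.+1 -> R) :
  \sum_(j < m.+1 | (i.+1 < j)%N) F j = \sum_(j < m | (i < j)%N) F (lift ord0 j).
Proof. by rewrite big_mkcond big_ord_recl /= add0r [RHS]big_mkcond. Qed.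

Section Tensoriality.
Context (R : realType) (n : nat) (M : topologicalType) (C : atlas R n M).
Hypothesis hC : is_manifold C.
Variable pi : M -> 'M[R]_n.
Hypothesis hpi : is_poisson C pi.
Variable U : set M.
Hypothesis oU : open U.
(** Discharged by [smooth_fbracket], whose proof uses the invariant frame. *)
Hypothesis smooth_fb : forall a b, smooth_form C U a -> smooth_form C U b ->
  smooth_form C U (fbracket C pi a b).
Implicit Types (f : M -> R) (p : M) (a b c : form R n M) (s : seq (form R n M))
  (w u v : mvfield R n M) (B : mvfield R n M).

Local Notation sform := (smooth_form C U).
Local Notation sforms := (smooth_forms C U).
Local Notation fb := (fbracket C pi).

Lemma smooth_forms_cons a s : sforms (a :: s) <-> sform a /\ sforms s.
Proof.
split=> [h|[ha hs] [|i] si]; [split=> [|i si]| |]; [exact: (h 0%N)|exact: (h i.+1)|exact: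
  ha|exact: hs].
Qed.

Lemma smooth_forms_nil : sforms [::]. Proof. by []. Qed.

Lemma smooth_forms_cat s1 s2 : sforms (s1 ++ s2) <-> sforms s1 /\ sforms s2.
Proof.
elim: s1 => [|a s1 IH] /=; first by split=> // -[].
rewrite !smooth_forms_cons IH; tauto.
Qed.

Lemma smooth_forms_nth s i : sforms s -> (i < size s)%N -> sform (nthf s i).
Proof. by move=> hs; exact: hs. Qed.

Lemma smooth_forms_omit i s : sforms s -> sforms (omit i s).
Proof.
elim: s i => [|a s IH] [|i] //; first by rewrite /omit /= drop0 => /smooth_forms_cons[].
move=> /smooth_forms_cons[ha hs]; apply/smooth_forms_cons; split=> //; exact: IH.
Qed.

Definition mvec w := forall q, is_multivector C U q w.

Definition slot_linear B := forall s1 s2 f a b, sforms (s1 ++ s2) -> smooth C U f ->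
  sform a -> sform b -> forall p, U p ->
  B (s1 ++ (fun q => f q *: a q + b q) :: s2) p
  = f p * B (s1 ++ a :: s2) p + B (s1 ++ b :: s2) p.

Lemma mvec_smooth w s : mvec w -> sforms s -> smooth C U (w s).
Proof. by move=> hw; exact: (mv_smooth (hw (size s)) erefl). Qed.

Lemma mvec_slot_linear w : mvec w -> slot_linear w.
Proof.
by move=> hw s1 s2 f a b hs hf ha hb p Up; apply: (mv_linear (hw _) erefl).
Qed.

Lemma mvec_alternating w s a p : mvec w -> sforms s -> sform a -> U p ->
  w (a :: a :: s) p = 0.
Proof. by move=> hw hs ha Up; exact: (mv_alternating (hw _) (s1 := [::]) (s2 := [::]) erefl). Qed.

Lemma mvec_contr w a : mvec w -> sform a -> mvec (contr a w).
Proof.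
move=> hw ha q; split.
- move=> s sq hs; apply: (mvec_smooth hw); exact/smooth_forms_cons.
- move=> s1 s2 f b c sq hs hf hb hc p Up.
  by apply: (mvec_slot_linear hw (s1 := a :: s1)) => //; apply/smooth_forms_cons.
- move=> s1 s2 s3 b sq hs hb p Up.
  by apply: (mv_alternating (hw _) (s1 := a :: s1) erefl) => //; apply/smooth_forms_cons.
Qed.

Lemma slot_linear_zero B s1 s2 p : slot_linear B -> sforms (s1 ++ s2) -> U p ->
  B (s1 ++ (fun=> 0) :: s2) p = 0.
Proof.
move=> hB hs Up.
have s0 : sform (fun=> 0) by exact: smooth_form0.
have := hB s1 s2 (fun=> 1) _ _ hs (smooth_cst C U 1) s0 s0 p Up.
rewrite (_ : (fun q => _) = fun=> 0); last by apply/funext => q; rewrite scaler0 addr0.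
by rewrite mul1r => /eqP; rewrite -subr_eq0 opprD addrA subrr add0r oppr_eq0 => /eqP.
Qed.

Lemma slot_linear_ext B s1 s2 a b p : slot_linear B -> sforms (s1 ++ s2) ->
  sform a -> sform b -> (forall q, U q -> a q = b q) -> U p ->
  B (s1 ++ a :: s2) p = B (s1 ++ b :: s2) p.
Proof.
(* The difference [e] vanishes on [U], so it is equal to [1_(~ U) e + 0], and [1_(~ U)] vanishes on [U]. *)
move=> hB hs sa sb ab Up.
have s0 : sform (fun=> 0) by exact: smooth_form0.
have sN : sform (fun q => (-1) *: b q + a q).
  by apply: (smooth_form_linear hC oU (smooth_cst C U (-1))).
pose e q := a q - b q.
have se : sform e.
  by have -> : e = fun q => (-1) *: b q + a q by apply/funext => q; rewrite scaleN1r addrC.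
pose chi q : R := if `[< U q >] then 0 else 1.
have schi : smooth C U chi.
  apply: (smooth_ext hC oU) (smooth_cst C U 0) => q Uq.
  by rewrite /chi asboolT.
have e0 : B (s1 ++ e :: s2) p = 0.
  have -> : e = fun q => chi q *: e q + (fun=> 0) q.
    apply/funext => q; rewrite addr0 /chi; case: asboolP => [Uq|]; last by rewrite scale1r.
    by rewrite scale0r /e ab// subrr.
  rewrite (hB s1 s2 chi e (fun=> 0) hs schi se s0 p Up) {1}/chi asboolT// mul0r add0r.
  exact: slot_linear_zero.
have -> : a = fun q => (fun=> 1 : R) q *: e q + b q.
  by apply/funext => q; rewrite scale1r subrK.
by rewrite (hB s1 s2 (fun=> 1) e b hs (smooth_cst C U 1) se sb p Up) e0 mulr0 add0r.
Qed.

Lemma mvec_swap w a b s p : mvec w -> sforms s -> sform a -> sform b -> U p ->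
  w (a :: b :: s) p = - w (b :: a :: s) p.
Proof.
move=> hw hs ha hb Up; have lw := mvec_slot_linear hw; have s1 := smooth_cst C U 1.
have hab := smooth_form_linear hC oU s1 ha hb.
have := mvec_alternating hw hs hab Up.
have ha' : sforms ([:: a] ++ s) by apply/smooth_forms_cons.
have hb' : sforms ([:: b] ++ s) by apply/smooth_forms_cons.
have hab' : sforms ([::] ++ (fun q => 1 *: a q + b q) :: s) by apply/smooth_forms_cons.
rewrite (lw [::] _ _ _ _ hab' s1 ha hb p Up) /= mul1r.
rewrite (lw [:: a] s _ _ _ ha' s1 ha hb p Up) (lw [:: b] s _ _ _ hb' s1 ha hb p Up) /= !mul1r.
rewrite !(mvec_alternating hw hs)// add0r addr0 => /eqP.
by rewrite addr_eq0 => /eqP.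
Qed.

(** The Lie derivative along [a] in the recursive shape of [ce_lie], so that the two can be compared
    by induction on the arguments. *)
Fixpoint form_lie a w s p : R :=
  if s is b :: s' then form_lie a (contr b w) s' p - w (fb a b :: s') p
  else dir C (w [::]) p (sharp pi a p).

Lemma form_lieE a w s p : mvec w -> sform a -> sforms s -> U p ->
  form_lie a w s p = dir C (w s) p (sharp pi a p)
    - \sum_(j < size s) (-1) ^+ j * w (fb a (nthf s j) :: omit j s) p.
Proof.
move=> hw ha; elim: s w hw => [|b s IH] w hw /=; first by rewrite big_ord0 subr0.
move=> /smooth_forms_cons[hb hs] Up.
rewrite (IH _ (mvec_contr hw hb) hs Up) big_ord_recl expr0 mul1r.
have -> : w (fb a (nthf (b :: s) ord0) :: omit (ord0 : 'I_(size s).+1) (b :: s)) p = w (fb a b ::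
  s) p.
  by rewrite /omit /= drop0.
have -> : \sum_(i < size s) (-1) ^+ lift ord0 i
      * w (fb a (nthf (b :: s) (lift ord0 i)) :: omit (lift ord0 i) (b :: s)) p
    = \sum_(j < size s) (-1) ^+ j * contr b w (fb a (nthf s j) :: omit j s) p.
  apply: eq_bigr => j _; rewrite lift0 exprS mulN1r mulNr -mulrN; apply: (f_equal2 *%R) => //.
  apply/esym/(mvec_swap hw) => //; first exact: smooth_forms_omit.
  by apply: smooth_fb => //; exact: smooth_forms_nth.
by rewrite opprD addrAC addrA.
Qed.

(** Cartan's formula, which brings [d_pi] to the recursive shape of [ce_diff]. The terms with index
    0 form the Lie derivative; in the others [a] is moved past the bracket at the cost of a sign. *)
Lemma d_pi_cons w a s p : mvec w -> sform a -> sforms s -> U p ->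
  d_pi C pi w (a :: s) p = form_lie a w s p - d_pi C pi (contr a w) s p.
Proof.
move=> hw ha hs Up; rewrite form_lieE// /d_pi.
have om0 t : omit 0 (a :: t) = t by rewrite /omit /= drop0.
have -> : \sum_(i < size (a :: s)) (-1) ^+ i
      * dir C (w (omit i (a :: s))) p (sharp pi (nthf (a :: s) i) p)
    = dir C (w s) p (sharp pi a p) - \sum_(i < size s) (-1) ^+ i
      * dir C (contr a w (omit i s)) p (sharp pi (nthf s i) p).
  rewrite big_ord_recl om0 expr0 mul1r; apply: (f_equal2 +%R) => //.
  rewrite -sumrN; apply: eq_bigr => i _.
  by rewrite lift0 exprS mulN1r mulNr.
have -> : \sum_(i < size (a :: s)) \sum_(j < size (a :: s) | (i < j)%N) (-1) ^+ (i + j)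
      * w (fb (nthf (a :: s) i) (nthf (a :: s) j) :: omit i (omit j (a :: s))) p
    = - \sum_(j < size s) (-1) ^+ j * w (fb a (nthf s j) :: omit j s) p
      + \sum_(i < size s) \sum_(j < size s | (i < j)%N) (-1) ^+ (i + j)
      * - contr a w (fb (nthf s i) (nthf s j) :: omit i (omit j s)) p.
  rewrite big_ord_recl; apply: (f_equal2 +%R).
    rewrite big_ord_gt0 -sumrN; apply: eq_bigr => j _.
    by rewrite lift0 add0n exprS mulN1r mulNr om0.
  apply: eq_bigr => i _; rewrite lift0 big_ord_gtS; apply: eq_bigr => j ij.
  rewrite lift0 [nthf _ _]/=.
  rewrite addSn addnS !exprS !mulN1r opprK; apply: (f_equal2 *%R) => //.
  apply: (mvec_swap (a := fb (nthf s i) (nthf s j)) (s := omit i (omit j s)) hw _ _ ha Up).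
    by do 2!apply: smooth_forms_omit.
  by apply: smooth_fb; apply: smooth_forms_nth.
rewrite opprD !addrA -!addrA; apply: (f_equal2 +%R) => //.
rewrite addrCA; apply: (f_equal2 +%R) => //; apply: (f_equal2 +%R) => //.
rewrite -sumrN; apply: eq_bigr => i _; rewrite -sumrN; apply: eq_bigr => j _.
by rewrite mulrN.
Qed.

Lemma d_pi_nil w p : d_pi C pi w [::] p = 0.
Proof. by rewrite /d_pi !big_ord0 addr0. Qed.

Definition mv_eq w w' := forall s, sforms s -> forall p, U p -> w s p = w' s p.

Lemma dir_mv_eq w w' s p x : mv_eq w w' -> sforms s -> U p ->
  dir C (w s) p x = dir C (w' s) p x.
Proof. by move=> ww hs Up; apply: (dir_ext hC _ oU Up) => q Uq; exact: ww. Qed.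

Lemma d_pi_mv_eq w w' s p : mv_eq w w' -> sforms s -> U p ->
  d_pi C pi w s p = d_pi C pi w' s p.
Proof.
move=> ww hs Up; rewrite /d_pi; apply: (f_equal2 +%R).
  apply: eq_bigr => i _; apply: (f_equal2 *%R) => //.
  by apply: dir_mv_eq => //; exact: smooth_forms_omit.
apply: eq_bigr => i _; apply: eq_bigr => j _; apply: (f_equal2 *%R) => //; apply: ww => //.
apply/smooth_forms_cons; split; last by do 2!apply: smooth_forms_omit.
by apply: smooth_fb; exact: smooth_forms_nth.
Qed.

Lemma form_lie_mv_eq a w w' s p : mv_eq w w' -> sform a -> sforms s -> U p ->
  form_lie a w s p = form_lie a w' s p.
Proof.
move=> + ha; elim: s w w' => [|b s IH] w w' ww /=; first by move=> _ Up; exact: dir_mv_eq.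
move=> /smooth_forms_cons[hb hs] Up; apply: (f_equal2 (fun x y : R => x - y)).
  by apply: IH => // t ht q Uq; apply: ww => //; apply/smooth_forms_cons.
by apply: ww => //; apply/smooth_forms_cons; split=> //; exact: smooth_fb.
Qed.

Lemma form_lie_linear c f u v s p : mvec u -> mvec v -> smooth C U f -> sform c ->
  sforms s -> U p ->
  form_lie c (fun t q => f q * u t q + v t q) s p
  = f p * form_lie c u s p + form_lie c v s p + dir C f p (sharp pi c p) * u s p.
Proof.
move=> + + sf hc; elim: s u v => [|b s IH] u v hu hv /=.
  move=> _ Up; have su := mvec_smooth hu smooth_forms_nil.
  have sv := mvec_smooth hv smooth_forms_nil.
  rewrite (dirD hC _ Up (smoothM hC oU sf su) sv) (dirM hC _ Up sf su).
  by rewrite [u [::] p * _]mulrC addrAC.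
move=> /smooth_forms_cons[hb hs] Up.
rewrite (IH _ _ (mvec_contr hu hb) (mvec_contr hv hb) hs Up).
set x := form_lie _ _ _ _; set y := form_lie _ _ _ _; set z := dir _ _ _ _.
rewrite /contr; move: (u _ _) (u _ _) (v _ _) x y z => u1 u2 v1 x y z; ring.
Qed.

Lemma d_pi_linear f u v s p : mvec u -> mvec v -> smooth C U f -> sforms s -> U p ->
  d_pi C pi (fun t q => f q * u t q + v t q) s p
  = f p * d_pi C pi u s p + d_pi C pi v s p
    + \sum_(j < size s) (-1) ^+ j * (dir C f p (sharp pi (nthf s j) p) * u (omit j s) p).
Proof.
move=> hu hv sf hs Up; rewrite /d_pi.
have -> : \sum_(i < size s) (-1) ^+ i * dir C (fun q => f q * u (omit i s) q + v (omit i s) q) p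
      (sharp pi (nthf s i) p)
    = f p * \sum_(i < size s) (-1) ^+ i * dir C (u (omit i s)) p (sharp pi (nthf s i) p)
    + \sum_(i < size s) (-1) ^+ i * dir C (v (omit i s)) p (sharp pi (nthf s i) p)
    + \sum_(j < size s) (-1) ^+ j * (dir C f p (sharp pi (nthf s j) p) * u (omit j s) p).
  rewrite mulr_sumr -!big_split; apply: eq_bigr => i _ /=.
  have su := mvec_smooth hu (@smooth_forms_omit i s hs).
  have sv := mvec_smooth hv (@smooth_forms_omit i s hs).
  rewrite (dirD hC _ Up (smoothM hC oU sf su) sv) (dirM hC _ Up sf su).
  set x := dir _ _ _ _; set y := dir _ _ _ _; set z := dir _ _ _ _.
  move: (u _ _) x y z => u1 x y z; ring.
have -> : \sum_(i < size s) \sum_(j < size s | (i < j)%N) (-1) ^+ (i + j)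
     * (f p * u (fb (nthf s i) (nthf s j) :: omit i (omit j s)) p
        + v (fb (nthf s i) (nthf s j) :: omit i (omit j s)) p)
    = f p * (\sum_(i < size s) \sum_(j < size s | (i < j)%N) (-1) ^+ (i + j)
       * u (fb (nthf s i) (nthf s j) :: omit i (omit j s)) p)
    + \sum_(i < size s) \sum_(j < size s | (i < j)%N) (-1) ^+ (i + j)
       * v (fb (nthf s i) (nthf s j) :: omit i (omit j s)) p.
  rewrite mulr_sumr -big_split; apply: eq_bigr => i _; rewrite mulr_sumr -big_split.
  by apply: eq_bigr => j _ /=; move: (u _ _) (v _ _) => u1 v1; ring.
set a := \sum_(i < _) _; set b := \sum_(i < _) _; set d := \sum_(i < _) _.
set e := \sum_(i < _) _; set g := \sum_(i < _) _.
ring.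
Qed.

(** The derivative of the coefficient [f] appears once from differentiating the contraction of [w]
    and once from the Leibniz rule for the bracket, with opposite signs. *)
Lemma form_lie_slot_linear c w : mvec w -> sform c -> slot_linear (form_lie c w).
Proof.
move=> + hc s1; elim: s1 w => [|d s1 IH] w hw s2 f a b /= hs sf ha hb p Up.
  have lw := mvec_slot_linear hw.
  have E : mv_eq (contr (fun q => f q *: a q + b q) w)
      (fun t q => f q * contr a w t q + contr b w t q).
    by move=> t ht q Uq; exact: (lw [::] t).
  rewrite (form_lie_mv_eq E hc hs Up).
  rewrite (form_lie_linear (mvec_contr hw ha) (mvec_contr hw hb) sf hc hs Up).
  have sca := smooth_fb hc ha; have scb := smooth_fb hc hb.
  have sXf : smooth C U (fun q => dir C f q (sharp pi c q)).
    exact: (smooth_dir oU sf (smooth_sharp hC hpi oU hc)).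
  have sab := smooth_form_linear hC oU sXf ha scb.
  have fbE q : U q -> fb c (fun q => f q *: a q + b q) q
      = f q *: fb c a q + (dir C f q (sharp pi c q) *: a q + fb c b q).
    move=> Uq; rewrite (fbracket_linearr hC hpi oU Uq sf hc ha hb).
    by apply: etrans (esym (addrA _ _ _)) _; apply: (f_equal2 +%R) => //; exact: addrC.
  have e1 := slot_linear_ext (s1 := [::]) lw hs (smooth_fb hc (smooth_form_linear hC oU sf ha hb))
    (smooth_form_linear hC oU sf sca sab) fbE Up.
  have e2 := lw [::] s2 f _ _ hs sf sca sab p Up.
  have e3 := lw [::] s2 _ _ _ hs sXf ha scb p Up.
  have ringE (F A B D Wa W W1 W2 W3 : R) : W = F * W1 + W2 -> W2 = D * Wa + W3 ->
    F * A + B + D * Wa - W = F * (A - W1) + (B - W3) by move=> -> ->; ring.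
  exact: ringE (etrans e1 e2) e3.
move/smooth_forms_cons: hs => [hd hs].
rewrite (IH _ (mvec_contr hw hd) s2 f a b hs sf ha hb p Up).
have hs' : sforms ((fb c d :: s1) ++ s2) by apply/smooth_forms_cons; split=> //; exact: smooth_fb.
rewrite (mvec_slot_linear hw hs' sf ha hb Up) /=.
set x := form_lie _ _ _ _; set y := form_lie _ _ _ _.
move: (w _ _) (w _ _) x y => u1 u2 x y; ring.
Qed.

(** For the first slot, the derivatives of [f] produced by the Lie derivative along [f a + b] cancel
    those produced by the differential of the contraction. The other slots follow by induction
    through [d_pi_cons]. *)
Lemma d_pi_slot_linear w : mvec w -> slot_linear (d_pi C pi w).
Proof.
move=> hw s1; elim: s1 w hw => [|d s1 IH] w hw s2 f a b /= hs sf ha hb p Up; last first.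
  move/smooth_forms_cons: hs => [hd hs].
  have hsx x : sform x -> sforms (s1 ++ x :: s2).
    move/smooth_forms_cat: hs => [h1 h2] hx; apply/smooth_forms_cat; split=> //.
    exact/smooth_forms_cons.
  have hab := smooth_form_linear hC oU sf ha hb.
  rewrite (d_pi_cons hw hd (hsx _ hab) Up) (d_pi_cons hw hd (hsx _ ha) Up).
  rewrite (d_pi_cons hw hd (hsx _ hb) Up).
  rewrite (form_lie_slot_linear hw hd hs sf ha hb Up).
  rewrite (IH _ (mvec_contr hw hd) s2 f a b hs sf ha hb p Up).
  set x := form_lie _ _ _ _; set y := form_lie _ _ _ _.
  set x' := d_pi _ _ _ _ _; set y' := d_pi _ _ _ _ _; ring.
have hab := smooth_form_linear hC oU sf ha hb; have lw := mvec_slot_linear hw.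
rewrite (d_pi_cons hw hab hs Up) (d_pi_cons hw ha hs Up) (d_pi_cons hw hb hs Up).
have E : mv_eq (contr (fun q => f q *: a q + b q) w)
    (fun t q => f q * contr a w t q + contr b w t q).
  by move=> t ht q Uq; exact: (lw [::] t).
rewrite (d_pi_mv_eq E hs Up).
rewrite (d_pi_linear (mvec_contr hw ha) (mvec_contr hw hb) sf hs Up).
have -> : form_lie (fun q => f q *: a q + b q) w s2 p
    = f p * form_lie a w s2 p + form_lie b w s2 p
    + \sum_(j < size s2) (-1) ^+ j * (dir C f p (sharp pi (nthf s2 j) p) * contr a w (omit j s2) p).
  rewrite (form_lieE hw hab hs Up) (form_lieE hw ha hs Up) (form_lieE hw hb hs Up).
  have -> : sharp pi (fun q => f q *: a q + b q) p = f p *: sharp pi a p + sharp pi b p.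
    by rewrite /sharp linearD linearZ /= mulmxDl -scalemxAl.
  rewrite (dir_linearP hC oU Up (mvec_smooth hw hs)).
  have -> : \sum_(j < size s2) (-1) ^+ j
       * w (fb (fun q => f q *: a q + b q) (nthf s2 j) :: omit j s2) p
    = f p * \sum_(j < size s2) (-1) ^+ j * w (fb a (nthf s2 j) :: omit j s2) p
      + \sum_(j < size s2) (-1) ^+ j * w (fb b (nthf s2 j) :: omit j s2) p
      - \sum_(j < size s2) (-1) ^+ j * (dir C f p (sharp pi (nthf s2 j) p) * contr a w (omit j s2)
        p).
    rewrite mulr_sumr -big_split -sumrB; apply: eq_bigr => j _ /=.
    have hj := smooth_forms_nth hs (ltn_ord j); have ho := @smooth_forms_omit j s2 hs.
    have sXf : smooth C U (fun q => - dir C f q (sharp pi (nthf s2 j) q)).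
      exact: (smoothN hC oU (smooth_dir oU sf (smooth_sharp hC hpi oU hj))).
    have saj := smooth_fb ha hj; have sbj := smooth_fb hb hj.
    have sab := smooth_form_linear hC oU sXf ha sbj.
    (* This Leibniz rule holds on [U] only; [slot_linear_ext] is what lets it be used inside an
       argument of [w]. *)
    have fbE q : U q -> fb (fun q => f q *: a q + b q) (nthf s2 j) q
        = f q *: fb a (nthf s2 j) q
          + (- dir C f q (sharp pi (nthf s2 j) q) *: a q + fb b (nthf s2 j) q).
      move=> Uq; rewrite (fbracket_linearl hC hpi oU Uq sf ha hb hj).
      rewrite scaleNr; apply: etrans (esym (addrA _ _ _)) _; apply: (f_equal2 +%R) => //.
      exact: addrC.
    have e1 := slot_linear_ext (s1 := [::]) lw ho (smooth_fb hab hj)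
      (smooth_form_linear hC oU sf saj sab) fbE Up.
    have e2 := lw [::] _ f _ _ ho sf saj sab p Up.
    have e3 := lw [::] _ _ _ _ ho sXf ha sbj p Up.
    have ringE (s0 F D Wa W W1 W2 W3 : R) : W = F * W1 + W2 -> W2 = - D * Wa + W3 ->
      s0 * W = F * (s0 * W1) + s0 * W3 - s0 * (D * Wa) by move=> -> ->; ring.
    exact: ringE (etrans e1 e2) e3.
  set x := dir _ _ _ _; set y := dir _ _ _ _.
  set x' := \sum_(j < _) _; set y' := \sum_(j < _) _; set z' := \sum_(j < _) _; ring.
set x := form_lie _ _ _ _; set y := form_lie _ _ _ _.
set x' := d_pi _ _ _ _ _; set y' := d_pi _ _ _ _ _; set z' := \sum_(j < _) _; ring.
Qed.

End Tensoriality.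

(** * Polynomial maps with values in functions *)

Section SubLmodule.
Context (R : pzRingType) (T : lmodType R).

(** The Weil complex needs a coefficient module carrying everywhere linear operators.
    Differentiation is linear only on differentiable functions, so that module is a subspace turned
    into a type. *)
Record submodule := Submodule {
  submodule_pred :> T -> Prop;
  submodule0 : submodule_pred 0;
  submodule_linear : forall a x y, submodule_pred x -> submodule_pred y ->
    submodule_pred (a *: x + y) }.

Definition submodule_mem (S : submodule) : {pred T} := fun x => `[< S x >].

Lemma submodule_memP (S : submodule) x : reflect (S x) (x \in submodule_mem S).
Proof. exact: asboolP. Qed.

Fact submodule_closed (S : submodule) : submod_closed (submodule_mem S).
Proof.
split=> [|a x y /submodule_memP Sx /submodule_memP Sy]; apply/submodule_memP.
  exact: submodule0.
exact: submodule_linear.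
Qed.

HB.instance Definition _ (S : submodule) :=
  GRing.isSubmodClosed.Build R T (submodule_mem S) (submodule_closed S).

Record sub_of (S : submodule) := SubOf {
  sub_val :> T;
  sub_valP : sub_val \in submodule_mem S }.

HB.instance Definition _ (S : submodule) := [isSub for @sub_val S].
HB.instance Definition _ (S : submodule) := [Choice of sub_of S by <:].
HB.instance Definition _ (S : submodule) := [SubChoice_isSubLmodule of sub_of S by <:].

Lemma sub_valS (S : submodule) (x : sub_of S) : S (sub_val x).
Proof. exact/submodule_memP/sub_valP. Qed.

Definition mk_sub (S : submodule) x (Sx : S x) : sub_of S :=
  SubOf (introT (submodule_memP S x) Sx).

Lemma sub_val_inj (S : submodule) : injective (@sub_val S). Proof. exact: val_inj. Qed.

Lemma sub_valD (S : submodule) (x y : sub_of S) : sub_val (x + y) = sub_val x + sub_val y.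
Proof. by []. Qed.

Lemma sub_valZ (S : submodule) a (x : sub_of S) : sub_val (a *: x) = a *: sub_val x.
Proof. by []. Qed.

Section SubLinear.
Variables (S : submodule) (f : T -> T).
Hypothesis fS : forall x, S x -> S (f x).
Hypothesis fL : forall a x y, S x -> S y -> f (a *: x + y) = a *: f x + f y.

Definition sub_fun (x : sub_of S) : sub_of S := mk_sub (fS (sub_valS x)).

Fact sub_fun_linear : linear sub_fun.
Proof. by move=> a x y; apply: val_inj; rewrite /= fL//; exact: sub_valS. Qed.

Definition sub_linear : {linear sub_of S -> sub_of S} :=
  HB.pack sub_fun (GRing.isLinear.Build R (sub_of S) (sub_of S) _ sub_fun sub_fun_linear).

Lemma sub_linearE x : sub_val (sub_linear x) = f (sub_val x).
Proof. by []. Qed.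

End SubLinear.
End SubLmodule.

Section PolynomialFunctions.
Context (R : realType) (n : nat) (M : topologicalType) (C : atlas R n M).
Hypothesis hC : is_manifold C.
Variable U : set M.
Hypothesis oU : open U.
Local Notation V := 'rV[R]_n.
Local Notation T := (V -> M -> R^o).
Implicit Types (F H : T) (x y xi : V) (p : M).

(* The values are extended by [0] outside [U], so that elements agreeing on [U] are equal. *)
Fixpoint hom_fun m F : Prop :=
  if m is m'.+1 then exists2 g : 'I_n -> T, forall k, hom_fun m' (g k) &
    forall xi p, F xi p = \sum_k xi 0 k * g k xi p
  else exists2 f : M -> R, smooth C U f /\ (forall p, ~ U p -> f p = 0) &
    forall xi p, F xi p = f p.

(** The span of the homogeneous functions of all degrees: a single degree is not stable under the
    operators that shift the degree. *)
Inductive poly_fun : T -> Prop :=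
| poly_hom m F : hom_fun m F -> poly_fun F
| poly_add F H : poly_fun F -> poly_fun H -> poly_fun (fun xi p => F xi p + H xi p).

Lemma hom_fun_linear m a F H : hom_fun m F -> hom_fun m H ->
  hom_fun m (fun xi p => a * F xi p + H xi p).
Proof.
elim: m F H => [|m IH] F H /=.
  move=> [f [sf f0] fE] [h [sh h0] hE]; exists (fun p => a * f p + h p) => [|xi p].
    split=> [|p Up]; last by rewrite f0// h0// mulr0 addr0.
    exact: (smoothD hC oU (smoothM hC oU (smooth_cst C U a) sf) sh).
  by rewrite fE hE.
move=> [f hf fE] [h hh hE]; exists (fun k xi p => a * f k xi p + h k xi p) => [k|xi p].
  exact: IH.
rewrite fE hE mulr_sumr -big_split; apply: eq_bigr => k _ /=.
by rewrite mulrDr; congr (_ + _); rewrite mulrCA.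
Qed.

Lemma hom_fun0 m : hom_fun m (fun _ _ => 0).
Proof.
elim: m => [|m IH] /=; first by exists (fun=> 0) => //; split=> //; exact: smooth_cst.
by exists (fun _ _ _ => 0) => // xi p; rewrite big1// => k _; rewrite mulr0.
Qed.

Lemma hom_fun_scale m a F : hom_fun m F -> hom_fun m (fun xi p => a * F xi p).
Proof.
move=> hF; have := hom_fun_linear a hF (hom_fun0 m).
by congr hom_fun; apply/funext => xi; apply/funext => p; rewrite addr0.
Qed.

Lemma hom_fun_add m F H : hom_fun m F -> hom_fun m H -> hom_fun m (fun xi p => F xi p + H xi p).
Proof.
move=> hF hH; have := hom_fun_linear 1 hF hH.
by congr hom_fun; apply/funext => xi; apply/funext => p; rewrite mul1r.
Qed.

Lemma hom_fun_sum m (I : Type) (r : seq I) (F : I -> T) : (forall i, hom_fun m (F i)) ->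
  hom_fun m (fun xi p => \sum_(i <- r) F i xi p).
Proof.
move=> hF; elim: r => [|i r IH].
  have := hom_fun0 m; congr hom_fun; apply/funext => xi; apply/funext => p; rewrite big_nil //.
have := hom_fun_add (hF i) IH; congr hom_fun; apply/funext => xi; apply/funext => p.
by rewrite big_cons.
Qed.

Lemma hom_fun_mul m k F : hom_fun m F -> hom_fun m.+1 (fun xi p => xi 0 k * F xi p).
Proof.
move=> hF; exists (fun j xi p => (j == k)%:R * F xi p) => [j|xi p]; first exact: hom_fun_scale.
rewrite (bigD1 k)//= eqxx mul1r big1 ?addr0// => j jk.
by rewrite (negbTE jk) mul0r mulr0.
Qed.

Lemma hom_fun_off m F xi p : hom_fun m F -> ~ U p -> F xi p = 0.
Proof.
elim: m F => [|m IH] F /=; first by move=> [f [_ f0] fE] Up; rewrite fE f0.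
by move=> [g hg gE] Up; rewrite gE big1// => k _; rewrite IH ?mulr0.
Qed.

Lemma hom_fun_smooth m F xi : hom_fun m F -> smooth C U (F xi).
Proof.
elim: m F => [|m IH] F /=.
  by move=> [f [sf _] fE]; apply: (smooth_ext hC oU) sf => p _; rewrite fE.
move=> [g hg gE].
have sS : smooth C U (fun p => \sum_k xi 0 k * g k xi p).
  by apply: (smooth_sum hC _ oU) => k _; exact: (smoothM hC oU (smooth_cst C U _) (IH _ (hg k))).
by apply: (smooth_ext hC oU) sS => p _; rewrite gE.
Qed.

Lemma hom_fun_Ck m F p k : hom_fun m F -> Ck k setT (fun xi => F xi p).
Proof.
elim: m F => [|m IH] F /=.
  move=> [f _ fE]; rewrite (_ : (fun xi => _) = fun=> f p); first exact: Ck_cst.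
  by apply/funext => xi; rewrite fE.
move=> [g hg gE]; rewrite (_ : (fun xi => _) = fun xi : V => \sum_j xi 0 j * g j xi p).
  apply: Ck_sum => [|j]; first exact: openT.
  by apply: CkM; [exact: openT|exact: Ck_coord|exact: IH].
by apply/funext => xi; rewrite gE.
Qed.

Lemma hom_fun_differentiable m F p xi : hom_fun m F ->
  differentiable (fun eta => F eta p) xi.
Proof. by move=> hF; have [+ _] := hom_fun_Ck p 1 hF; exact. Qed.

Lemma derive_sumf (I : Type) (r : seq I) (f : I -> V -> R^o) xi x :
  (forall i, differentiable (f i) xi) ->
  differentiable (fun eta => \sum_(i <- r) f i eta) xi /\
  'D_x (fun eta => \sum_(i <- r) f i eta) xi = \sum_(i <- r) 'D_x (f i) xi.
Proof.
move=> df; elim: r => [|i r [IH1 IH2]].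
  rewrite (_ : (fun eta => _) = fun=> 0); last by apply/funext => eta; rewrite big_nil.
  by split; [exact: differentiable_cst|rewrite derive_cst big_nil].
rewrite (_ : (fun eta => _) = fun eta => f i eta + \sum_(j <- r) f j eta); last first.
  by apply/funext => eta; rewrite big_cons.
split; first exact: differentiableD.
by rewrite derive_addf// big_cons IH2.
Qed.

Definition poly_deriv x F : T := fun xi p => 'D_x (fun eta => F eta p) xi.

Lemma poly_deriv_mul m (g : 'I_n -> T) x : (forall k, hom_fun m (g k)) ->
  poly_deriv x (fun xi p => \sum_k xi 0 k * g k xi p)
  = fun xi p => \sum_k (x 0 k * g k xi p + xi 0 k * poly_deriv x (g k) xi p).
Proof.
move=> hg; apply/funext => xi; apply/funext => p; rewrite /poly_deriv.
have dg k := hom_fun_differentiable p xi (hg k).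
have [_ ->] := @derive_sumf _ (index_enum 'I_n) (fun k eta => eta 0 k * g k eta p) xi x
  (fun k => differentiableM (differentiable_coord xi 0 k) (dg k)).
apply: eq_bigr => k _; rewrite (derive_mulf x (differentiable_coord xi 0 k) (dg k)) derive_coord.
by rewrite addrC mulrC.
Qed.

Lemma hom_fun_deriv m x F : hom_fun m.+1 F -> hom_fun m (poly_deriv x F).
Proof.
elim: m F => [|m IH] F [g hg gE].
  have -> : F = fun xi p => \sum_k xi 0 k * g k xi p.
    by apply/funext => xi; apply/funext => p; exact: gE.
  rewrite (@poly_deriv_mul 0 g x hg).
  have := @hom_fun_sum 0 _ (index_enum 'I_n) _ (fun k => @hom_fun_scale 0 (x 0 k) _ (hg k)).
  congr hom_fun; apply/funext => xi; apply/funext => p; apply: eq_bigr => k _.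
  have [f _ fE] := hg k; rewrite /poly_deriv.
  rewrite (_ : (fun eta => g k eta p) = fun=> f p); last by apply/funext => eta; rewrite fE.
  by rewrite derive_cst mulr0 addr0.
have -> : F = fun xi p => \sum_k xi 0 k * g k xi p.
  by apply/funext => xi; apply/funext => p; exact: gE.
rewrite (@poly_deriv_mul m.+1 g x hg); apply: hom_fun_sum => k.
apply: hom_fun_add; first exact: hom_fun_scale.
by apply: hom_fun_mul; exact: IH.
Qed.

Lemma poly_deriv0 x F : hom_fun 0 F -> poly_deriv x F = fun _ _ => 0.
Proof.
move=> [f _ fE]; apply/funext => xi; apply/funext => p; rewrite /poly_deriv.
rewrite (_ : (fun eta => F eta p) = fun=> f p); last by apply/funext => eta; rewrite fE.
exact: derive_cst.
Qed.

Lemma euler_fun m F xi p : hom_fun m F ->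
  \sum_k xi 0 k * poly_deriv (delta_mx 0 k) F xi p = F xi p *+ m.
Proof.
elim: m F xi p => [|m IH] F xi p.
  by move=> hF; rewrite mulr0n big1// => k _; rewrite poly_deriv0// mulr0.
move=> [g hg gE].
have -> : F = fun xi p => \sum_k xi 0 k * g k xi p.
  by apply/funext => eta; apply/funext => q; exact: gE.
under eq_bigr => k _ do rewrite (poly_deriv_mul _ hg) mulr_sumr.
rewrite exchange_big mulrSr -[in RHS]sumrMnl -big_split; apply: eq_bigr => j _ /=.
under eq_bigr => k _ do rewrite mulrDr [xi 0 k * (xi 0 j * _)]mulrCA.
rewrite big_split /= -mulr_sumr (IH _ _ _ (hg j)); apply: etrans (addrC _ _) _.
apply: (f_equal2 +%R); first exact: mulrnAr.
rewrite (bigD1 j)//= mxE !eqxx mul1r big1 ?addr0// => k kj.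
by rewrite mxE eqxx eq_sym (negbTE kj) mul0r mulr0.
Qed.

Section Fields.
Variable X : V -> vfield R n M.
Hypothesis smooth_X : forall x, smooth_vfield C U (X x).
Hypothesis X_linear : forall a x y p, X (a *: x + y) p = a *: X x p + X y p.

(** The cut-off keeps the result among the functions vanishing outside [U]. *)
Definition poly_dir x F : T := fun xi p =>
  if `[< U p >] then dir C (F xi) p (X x p) else 0.

Lemma poly_dir_in x F xi p : U p -> poly_dir x F xi p = dir C (F xi) p (X x p).
Proof. by move=> Up; rewrite /poly_dir asboolT. Qed.

Lemma poly_dir_mul m (g : 'I_n -> T) x : (forall k, hom_fun m (g k)) ->
  poly_dir x (fun xi p => \sum_k xi 0 k * g k xi p)
  = fun xi p => \sum_k xi 0 k * poly_dir x (g k) xi p.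
Proof.
move=> hg; apply/funext => xi; apply/funext => p; rewrite /poly_dir.
case: asboolP => Up; last by rewrite big1// => k _; rewrite mulr0.
have sg k := hom_fun_smooth xi (hg k).
have sxg k := smoothM hC oU (smooth_cst C U (xi 0 k)) (sg k).
rewrite (dir_sum hC _ _ oU Up (fun k _ => sxg k)); apply: eq_bigr => k _.
exact: (dirZ hC _ _ Up (sg k)).
Qed.

Lemma hom_fun_dir m x F : hom_fun m F -> hom_fun m (poly_dir x F).
Proof.
elim: m F => [|m IH] F.
  move=> [f [sf f0] fE]; exists (poly_dir x F 0); last first.
    by move=> xi p; rewrite /poly_dir (_ : F xi = F 0)//; apply/funext => q; rewrite !fE.
  split; last by move=> p Up; rewrite /poly_dir asboolF.
  have -> : F = fun=> f by apply/funext => xi; apply/funext => p; rewrite fE.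
  apply: (smooth_ext hC oU) (smooth_dir oU sf (smooth_X x)) => p Up.
  by rewrite poly_dir_in.
move=> [g hg gE].
have -> : F = fun xi p => \sum_k xi 0 k * g k xi p.
  by apply/funext => xi; apply/funext => p; exact: gE.
rewrite (poly_dir_mul x hg); apply: hom_fun_sum => k.
exact: hom_fun_mul (IH _ (hg k)).
Qed.

(** The variables xi are constant along the manifold, so both operators act on the coefficients of
    an expansion in xi and the degree drops by one. *)
Lemma poly_dir_deriv m x y F : hom_fun m F ->
  poly_dir x (poly_deriv y F) = poly_deriv y (poly_dir x F).
Proof.
elim: m F => [|m IH] F.
  move=> hF; rewrite (poly_deriv0 y (hom_fun_dir x hF)) (poly_deriv0 y hF).
  apply/funext => xi; apply/funext => p; rewrite /poly_dir; case: asboolP => // Up.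
  exact: dir_cst.
move=> [g hg gE].
have -> : F = fun xi p => \sum_k xi 0 k * g k xi p.
  by apply/funext => xi; apply/funext => p; exact: gE.
rewrite (poly_dir_mul x hg) (poly_deriv_mul y hg) (poly_deriv_mul y (fun k => hom_fun_dir x (hg
  k))).
have IHg k := IH _ (hg k); apply/funext => xi; apply/funext => p.
under [RHS]eq_bigr => k _ do rewrite -IHg.
rewrite /poly_dir; case: asboolP => Up; last by rewrite big1// => k _; rewrite !mulr0 addr0.
have sg k := hom_fun_smooth xi (hg k).
have sd k : smooth C U (poly_deriv y (g k) xi).
  case: m {IH} hg => [|m] hg; last exact: hom_fun_smooth (hom_fun_deriv y (hg k)).
  by rewrite (poly_deriv0 y (hg k)); exact: smooth_cst.
have s1 k := smoothM hC oU (smooth_cst C U (y 0 k)) (sg k).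
have s2 k := smoothM hC oU (smooth_cst C U (xi 0 k)) (sd k).
rewrite (dir_sum hC _ _ oU Up (fun k _ => smoothD hC oU (s1 k) (s2 k))).
apply: eq_bigr => k _; rewrite (dirD hC _ Up (s1 k) (s2 k)).
by rewrite (dirZ hC _ _ Up (sg k)) (dirZ hC _ _ Up (sd k)).
Qed.

End Fields.
End PolynomialFunctions.

(** * The coefficient module of the Weil complex *)

Section WeilModel.
Context (R : realType) (n : nat) (M : topologicalType) (C : atlas R n M).
Hypothesis hC : is_manifold C.
Variable U : set M.
Hypothesis oU : open U.
Local Notation V := 'rV[R]_n.
Local Notation T := (V -> M -> R^o).
Local Notation hom := (hom_fun C U).
Local Notation poly := (poly_fun C U).
Implicit Types (F H : T) (x y z xi : V) (p : M).

Lemma poly_fun_smooth F xi : poly F -> smooth C U (F xi).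
Proof.
move=> hF; elim: hF => {F} [m F hF|F H _ IH1 _ IH2]; first exact: hom_fun_smooth hF.
exact: (smoothD hC oU IH1 IH2).
Qed.

Lemma poly_fun_Ck F p k : poly F -> Ck k setT (fun xi => F xi p).
Proof.
move=> hF; elim: hF => {F} [m F hF|F H _ IH1 _ IH2]; first exact: hom_fun_Ck hF.
by apply: CkD => //; exact: openT.
Qed.

Lemma poly_fun_differentiable F p xi : poly F -> differentiable (fun eta => F eta p) xi.
Proof. by move=> /(poly_fun_Ck p 1)[+ _]; exact. Qed.

Lemma poly_fun_off F xi p : poly F -> ~ U p -> F xi p = 0.
Proof.
move=> hF Up; elim: hF => {F} [m F hF|F H _ IH1 _ IH2]; first exact: hom_fun_off hF Up.
by rewrite IH1 IH2 addr0.
Qed.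

(** Stability under an additive operator only has to be checked on homogeneous functions. *)
Lemma poly_fun_closed (f : T -> T) : (forall m F, hom m F -> poly (f F)) ->
  (forall F H, poly F -> poly H ->
    f (fun xi p => F xi p + H xi p) = fun xi p => f F xi p + f H xi p) ->
  forall F, poly F -> poly (f F).
Proof.
move=> fh fD F; elim=> {F} [m F hF|F H hF IH1 hH IH2]; first exact: fh hF.
by rewrite fD//; exact: poly_add.
Qed.

Lemma poly_fun_linear a F H : poly F -> poly H -> poly (a *: F + H).
Proof.
move=> hF hH; apply: poly_add (hH).
apply: (@poly_fun_closed (fun F xi p => a * F xi p)) hF => [m E hE|E E' _ _].
  exact: poly_hom (hom_fun_scale hC oU a hE).
by apply/funext => xi; apply/funext => p; rewrite mulrDr.
Qed.

Definition poly_funs : submodule (GRing.Lmodule.clone R T _) :=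
  @Submodule R (GRing.Lmodule.clone R T _) poly (poly_hom (@hom_fun0 R n M C U 0)) poly_fun_linear.

Definition poly_mul k F : T := fun xi p => xi 0 k * F xi p.

Lemma poly_fun_mul k F : poly F -> poly (poly_mul k F).
Proof.
apply: poly_fun_closed => [m E hE|E E' _ _]; first exact: poly_hom (hom_fun_mul hC oU k hE).
by apply/funext => xi; apply/funext => p; exact: mulrDr.
Qed.

Lemma poly_mul_linear k a F H : poly_mul k (a *: F + H) = a *: poly_mul k F + poly_mul k H.
Proof.
apply/funext => xi; apply/funext => p.
have ringE (r s t u : R) : r * (s * t + u) = s * (r * t) + r * u by ring.
exact: ringE.
Qed.

Lemma poly_deriv_linear x a F H : poly F -> poly H ->
  poly_deriv x (a *: F + H) = a *: poly_deriv x F + poly_deriv x H.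
Proof.
move=> hF hH; apply/funext => xi; apply/funext => p.
have dF := poly_fun_differentiable p xi hF; have dH := poly_fun_differentiable p xi hH.
have dC : differentiable (fun _ : V => a : R^o) xi by exact: differentiable_cst.
have e1 := derive_addf x (differentiableM dC dF) dH.
have e2 := derive_mulf x dC dF; rewrite derive_cst mulr0 addr0 in e2.
exact: etrans e1 (f_equal2 +%R e2 erefl).
Qed.

Lemma poly_fun_deriv x F : poly F -> poly (poly_deriv x F).
Proof.
apply: poly_fun_closed => [[|m] E hE|E E' hE hE'].
- by rewrite (poly_deriv0 x hE); exact: poly_hom (@hom_fun0 R n M C U 0).
- exact: poly_hom (hom_fun_deriv hC oU x hE).
apply/funext => xi; apply/funext => p.
exact: derive_addf (poly_fun_differentiable p xi hE) (poly_fun_differentiable p xi hE').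
Qed.

Lemma poly_deriv_linearl a x y F : poly F ->
  poly_deriv (a *: x + y) F = a *: poly_deriv x F + poly_deriv y F.
Proof.
move=> hF; apply/funext => xi; apply/funext => p.
have dF := poly_fun_differentiable p xi hF.
rewrite /poly_deriv (derive_linear dF); apply/esym; apply: etrans (f_equal2 +%R _ _) _.
- exact: (f_equal (fun t : R => a * t) (derive_linear dF x)).
- exact: (derive_linear dF y).
rewrite mulr_sumr -big_split; apply: eq_bigr => k _ /=.
by rewrite !mxE mulrA -mulrDl.
Qed.

Lemma poly_deriv_comm x y F : poly F ->
  poly_deriv x (poly_deriv y F) = poly_deriv y (poly_deriv x F).
Proof.
move=> hF; apply/funext => xi; apply/funext => p.
exact: (schwarz (W := setT) _ _ openT I (poly_fun_Ck p 2 hF)).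
Qed.

Lemma poly_deriv_var x k F : poly F ->
  poly_deriv x (poly_mul k F) = poly_mul k (poly_deriv x F) + x 0 k *: F.
Proof.
move=> hF; apply/funext => xi; apply/funext => p.
have dF := poly_fun_differentiable p xi hF.
have := derive_mulf x (differentiable_coord xi 0 k) dF; rewrite derive_coord => e.
by apply: etrans e _; apply: (f_equal2 +%R) => //; exact: mulrC.
Qed.

Variable X : V -> vfield R n M.
Hypothesis smooth_X : forall x, smooth_vfield C U (X x).
Hypothesis X_linear : forall a x y p, X (a *: x + y) p = a *: X x p + X y p.

Local Notation dirX := (poly_dir C U X).

Lemma poly_dir_linear x a F H : poly F -> poly H ->
  dirX x (a *: F + H) = a *: dirX x F + dirX x H.
Proof.
move=> hF hH; apply/funext => xi; apply/funext => p.
have [Up|nUp] := pselect (U p); last first.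
  apply/esym; apply: etrans (f_equal2 +%R (f_equal (fun t : R => a * t) _) _) _;
    rewrite /poly_dir asboolF//.
  by rewrite mulr0 addr0.
have sF := poly_fun_smooth xi hF; have sH := poly_fun_smooth xi hH.
have e1 := dirD hC (X x p) Up (smoothM hC oU (smooth_cst C U a) sF) sH.
rewrite (dirZ hC a _ Up sF) in e1.
apply: etrans (poly_dir_in C X x _ xi Up) (etrans e1 _).
apply/esym; apply: (f_equal2 +%R); last exact: poly_dir_in.
by apply: (f_equal (fun t : R => a * t)); exact: poly_dir_in.
Qed.

Lemma poly_fun_dir x F : poly F -> poly (dirX x F).
Proof.
apply: poly_fun_closed => [m E hE|E E' hE hE']; first exact: poly_hom (hom_fun_dir hC oU smooth_X
  x hE).
apply/funext => xi; apply/funext => p; rewrite /poly_dir; case: asboolP => Up;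
  last by rewrite addr0.
exact: (dirD hC (X x p) Up (poly_fun_smooth xi hE) (poly_fun_smooth xi hE')).
Qed.

Lemma poly_dir_linearl a x y F : poly F -> dirX (a *: x + y) F = a *: dirX x F + dirX y F.
Proof.
move=> hF; apply/funext => xi; apply/funext => p.
have [Up|nUp] := pselect (U p); last first.
  apply/esym; apply: etrans (f_equal2 +%R (f_equal (fun t : R => a * t) _) _) _;
    rewrite /poly_dir asboolF//.
  by rewrite mulr0 addr0.
have e1 := dir_linearP hC oU Up (poly_fun_smooth xi hF) a (X x p) (X y p).
apply: etrans (poly_dir_in C X _ _ xi Up) _; rewrite X_linear; apply: etrans e1 _.
apply/esym; apply: (f_equal2 +%R); last exact: poly_dir_in.
by apply: (f_equal (fun t : R => a * t)); exact: poly_dir_in.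
Qed.

Lemma poly_dir_deriv_comm x y F : poly F -> dirX x (poly_deriv y F) = poly_deriv y (dirX x F).
Proof.
elim=> {F} [m F hF|F H hF IH1 hH IH2]; first exact: (poly_dir_deriv hC oU smooth_X x y hF).
have addE (E E' : T) : (fun xi p => E xi p + E' xi p) = 1 *: E + E' by rewrite scale1r.
have e1 := f_equal (dirX x) (poly_deriv_linear y 1 hF hH).
have e2 := poly_dir_linear x 1 (poly_fun_deriv y hF) (poly_fun_deriv y hH).
have e3 := f_equal (poly_deriv y) (poly_dir_linear x 1 hF hH).
have e4 := poly_deriv_linear y 1 (poly_fun_dir x hF) (poly_fun_dir x hH).
rewrite addE; apply: etrans e1 (etrans e2 _); apply: etrans (esym (etrans e3 e4)).
by rewrite IH1 IH2.
Qed.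

Lemma poly_dir_mulr x k F : poly F -> dirX x (poly_mul k F) = poly_mul k (dirX x F).
Proof.
move=> hF; apply/funext => xi; apply/funext => p; rewrite /poly_dir /poly_mul.
case: asboolP => Up; last by rewrite mulr0.
exact: (dirZ hC (xi 0 k) _ Up (poly_fun_smooth xi hF)).
Qed.

Variable br : V -> V -> V.
Hypothesis X_bracket : forall f x y p, U p -> smooth C U f ->
  dir C (fun q => dir C f q (X y q)) p (X x p) - dir C (fun q => dir C f q (X x q)) p (X y p)
  = dir C f p (X (br x y) p).

Lemma poly_dir_bracket x y F : poly F ->
  dirX x (dirX y F) - dirX y (dirX x F) = dirX (br x y) F.
Proof.
move=> hF; apply/funext => xi; apply/funext => p.
have [Up|nUp] := pselect (U p); last first.
  have off z H : dirX z H xi p = 0 by rewrite /poly_dir asboolF.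
  apply: etrans (f_equal2 (fun s t : R => s - t) (off _ _) (off _ _)) _.
  by rewrite subr0 off.
have sF := poly_fun_smooth xi hF.
have E z z' : dirX z (dirX z' F) xi p = dir C (fun q => dir C (F xi) q (X z' q)) p (X z p).
  rewrite poly_dir_in//; apply: (dir_ext hC _ oU Up) => q Uq; exact: poly_dir_in.
apply: etrans (f_equal2 (fun s t : R => s - t) (E _ _) (E _ _)) _.
by apply: etrans (X_bracket x y Up sF) _; rewrite poly_dir_in.
Qed.

(* The space [sub_of poly_funs] behind an interface: conversion problems that unfold its canonical
   structures are intractable. *)
Record weil_module := WeilModule {
  weil_space :> lmodType R;
  weil_val : weil_space -> T;
  weil_dir : V -> {linear weil_space -> weil_space};
  weil_deriv : V -> {linear weil_space -> weil_space};
  weil_mul : 'I_n -> {linear weil_space -> weil_space};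
  weil_val_inj : injective weil_val;
  weil_val_linear : forall a f g xi p,
    weil_val (a *: f + g) xi p = a * (weil_val f xi p : R) + (weil_val g xi p : R);
  weil_valP : forall f, poly (weil_val f);
  weil_lift : forall F, poly F -> exists f, weil_val f = F;
  weil_dirE : forall x f, weil_val (weil_dir x f) = dirX x (weil_val f);
  weil_derivE : forall x f, weil_val (weil_deriv x f) = poly_deriv x (weil_val f);
  weil_mulE : forall k f, weil_val (weil_mul k f) = poly_mul k (weil_val f) }.

Lemma weil_module_exists : inhabited weil_module.
Proof.
pose P := sub_of poly_funs.
pose dirP x : {linear P -> P} :=
  @sub_linear _ _ poly_funs (dirX x) (@poly_fun_dir x) (@poly_dir_linear x).
pose derP x : {linear P -> P} :=
  @sub_linear _ _ poly_funs (poly_deriv x) (@poly_fun_deriv x) (@poly_deriv_linear x).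
pose mulP k : {linear P -> P} :=
  @sub_linear _ _ poly_funs (poly_mul k) (@poly_fun_mul k) (fun a F H _ _ => poly_mul_linear k a F
    H).
split; apply: (@WeilModule P (@sub_val _ _ poly_funs) dirP derP mulP).
- exact: (@sub_val_inj _ _ poly_funs).
- by move=> a f g xi p; rewrite sub_valD sub_valZ.
- by move=> f; exact: (sub_valS f).
- by move=> F hF; exists (@mk_sub _ _ poly_funs F hF).
- by move=> x f; exact: sub_linearE.
- by move=> x f; exact: sub_linearE.
- by move=> x f; exact: sub_linearE.
Qed.

Variable P : weil_module.
Implicit Types (f g : P).

Lemma weil_val0 xi p : weil_val (0 : P) xi p = 0.
Proof.
by have := weil_val_linear (-1) (0 : P) 0 xi p; rewrite scaleN1r addNr mulN1r addNr.
Qed.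

Lemma weil_valD f g xi p : weil_val (f + g) xi p = (weil_val f xi p : R) + (weil_val g xi p : R).
Proof. by rewrite -[f in LHS]scale1r weil_val_linear mul1r. Qed.

Lemma weil_valZ a f xi p : weil_val (a *: f) xi p = a * (weil_val f xi p : R).
Proof. by rewrite -[a *: f]addr0 weil_val_linear weil_val0 addr0. Qed.

Lemma weil_valB f g xi p : weil_val (f - g) xi p = (weil_val f xi p : R) - (weil_val g xi p : R).
Proof. by rewrite weil_valD -scaleN1r weil_valZ mulN1r. Qed.

Lemma weil_val_sum (I : Type) (r : seq I) (F : I -> P) xi p :
  weil_val (\sum_(i <- r) F i) xi p = \sum_(i <- r) (weil_val (F i) xi p : R).
Proof. by elim: r => [|i r IH]; rewrite !(big_nil, big_cons) ?weil_val0// weil_valD IH. Qed.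

(** Elements vanish outside [U], so identities valid on [U] become equations in the module. *)
Lemma weil_ext f g : (forall xi p, U p -> weil_val f xi p = weil_val g xi p) -> f = g.
Proof.
move=> fg; apply: weil_val_inj; apply/funext => xi; apply/funext => p.
have [Up|nUp] := pselect (U p); first exact: fg.
by rewrite (poly_fun_off xi (weil_valP f) nUp) (poly_fun_off xi (weil_valP g) nUp).
Qed.

Definition weil_hom j f : Prop := hom j (weil_val f).

Lemma weil_hom0 j : weil_hom j 0.
Proof.
rewrite /weil_hom (_ : weil_val 0 = fun _ _ => 0); first exact: hom_fun0.
by apply/funext => xi; apply/funext => p; exact: weil_val0.
Qed.

Lemma weil_hom_linear j a f g : weil_hom j f -> weil_hom j g -> weil_hom j (a *: f + g).
Proof.
move=> hf hg; rewrite /weil_hom.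
have -> : weil_val (a *: f + g) = fun xi p => a * weil_val f xi p + weil_val g xi p.
  by apply/funext => xi; apply/funext => p; exact: weil_val_linear.
exact: (hom_fun_linear hC oU a hf hg).
Qed.

Lemma weil_hom_deriv j x f : weil_hom j.+1 f -> weil_hom j (weil_deriv P x f).
Proof. by rewrite /weil_hom weil_derivE; exact: hom_fun_deriv. Qed.

Lemma weil_hom_deriv0 x f : weil_hom 0 f -> weil_deriv P x f = 0.
Proof.
move=> hf; apply: weil_ext => xi p _.
by rewrite weil_derivE (poly_deriv0 x hf) weil_val0.
Qed.

Lemma weil_euler j f : weil_hom j f -> euler (weil_deriv P) (weil_mul P) f = f *+ j.
Proof.
move=> hf; apply: weil_ext => xi p _; rewrite weil_val_sum -scaler_nat weil_valZ.
apply: etrans (etrans _ (euler_fun xi p hf)) (esym (mulr_natl _ _)); apply: eq_bigr => k _.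
by rewrite weil_mulE weil_derivE.
Qed.

Hypothesis br_linearr : forall x a y z, br x (a *: y + z) = a *: br x y + br x z.
Hypothesis br_antisym : forall x y, br x y = - br y x.
Hypothesis br_jacobi : forall x y z, br x (br y z) = br (br x y) z + br y (br x z).

Lemma weil_module_acyclic N (w : seq V -> P) :
  weil_cochain br (weil_dir P) (weil_deriv P) (weil_mul P) weil_hom N.+1 w ->
  (forall s, equiv_diff br (weil_dir P) (weil_mul P) w s = 0) ->
  exists2 b, weil_cochain br (weil_dir P) (weil_deriv P) (weil_mul P) weil_hom N b &
    forall s, w s = equiv_diff br (weil_dir P) (weil_mul P) b s.
Proof.
have valE f g : weil_val f = weil_val g -> f = g by exact: weil_val_inj.
apply: weil_acyclic => //.
- move=> a x y f; apply: weil_ext => xi p _; rewrite weil_valD weil_valZ !weil_dirE.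
  by rewrite (poly_dir_linearl a x y (weil_valP f)).
- move=> a x y f; apply: weil_ext => xi p _; rewrite weil_valD weil_valZ !weil_derivE.
  by rewrite (poly_deriv_linearl a x y (weil_valP f)).
- move=> x y f; apply: weil_ext => xi p _; rewrite weil_valB !weil_dirE.
  by rewrite -(poly_dir_bracket x y (weil_valP f)).
- move=> x y f; apply: valE; rewrite weil_dirE !weil_derivE weil_dirE.
  exact: poly_dir_deriv_comm (weil_valP f).
- move=> x k f; apply: valE; rewrite weil_dirE !weil_mulE weil_dirE.
  exact: poly_dir_mulr (weil_valP f).
- move=> x y f; apply: valE; rewrite !weil_derivE.
  exact: poly_deriv_comm (weil_valP f).
- move=> j k f; apply: valE; rewrite !weil_mulE.
  by apply/funext => xi; apply/funext => p; exact: mulrCA.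
- move=> x k f; apply: weil_ext => xi p _; rewrite weil_valD weil_valZ weil_derivE !weil_mulE.
  by rewrite (poly_deriv_var x k (weil_valP f)) weil_derivE.
- exact: weil_hom0.
- exact: weil_hom_linear.
- by move=> j x f; rewrite /weil_hom weil_dirE; exact: hom_fun_dir.
- by move=> j k f; rewrite /weil_hom weil_mulE; exact: hom_fun_mul.
- exact: weil_hom_deriv.
- exact: weil_hom_deriv0.
- exact: weil_euler.
Qed.

End WeilModel.

(** * Cochains in the invariant frame *)

Section FormCoordinates.
Context (R : realType) (n : nat) (G : topologicalGroupDataType) (C : atlas R n G).
Hypothesis hG : is_lie_group C.
Variable pi : G -> 'M[R]_n.
Hypothesis hpi : is_poisson C pi.
Hypothesis hmult : is_multiplicative C pi.
Variable K : 'M[R]_n.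
Hypothesis hK : K \in unitmx.
Variable br : 'rV[R]_n -> 'rV[R]_n -> 'rV[R]_n.
Hypothesis br_dual : forall x y u,
  pairing u ((br x y *m K)^T) = delta C pi u ((x *m K)^T) ((y *m K)^T).
Variable U : set G.
Hypothesis oU : open U.
Local Notation V := 'rV[R]_n.
Local Notation e k := (delta_mx 0 k : V).
Local Notation hM := (lie_manifold hG).
Local Notation th := (dual_form C K).
Local Notation sg := (dual_coord C K).
Implicit Types (x y xi : V) (p q : G) (a b : form R n G) (s : seq (form R n G))
  (w B : mvfield R n G).

Lemma dual_form_sum p (c : 'I_n -> R) (v : 'I_n -> V) :
  th (\sum_k c k *: v k) p = \sum_k c k *: th (v k) p.
Proof.
elim: (index_enum _) => [|k r IH]; last by rewrite !big_cons (dual_form_linear hG) IH.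
rewrite !big_nil; have := dual_form_linear hG K (-1) 0 0 p.
by rewrite !scaleN1r !addNr.
Qed.

Lemma dual_form_expand a : a = fun q => \sum_k sg a q 0 k *: th (e k) q.
Proof.
apply/funext => q; rewrite -{1}(dual_coordK hG hK a q) {1}(row_sum_delta (sg a q)).
exact: dual_form_sum.
Qed.

(** Both forms are expanded in the frame [th], whose brackets are again of the form [th]. The
    Leibniz rules leave smooth coefficients and their derivatives along smooth fields. *)
Lemma smooth_fbracket a b : smooth_form C U a -> smooth_form C U b ->
  smooth_form C U (fbracket C pi a b).
Proof.
move=> sa sb.
have sc k := smooth_dual_coord hG K (a := a) k oU sa.
have sd k := smooth_dual_coord hG K (a := b) k oU sb.
have st x := @smooth_dual_form _ _ _ _ hG K U x.
have sX f c : smooth C U f -> smooth_form C U c ->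
    smooth C U (fun q => - dir C f q (sharp pi c q)).
  by move=> sf sc'; exact: (smoothN hM oU (smooth_dir oU sf (smooth_sharp hM hpi oU sc'))).
have sXp f c : smooth C U f -> smooth_form C U c ->
    smooth C U (fun q => dir C f q (sharp pi c q)).
  by move=> sf sc'; exact: (smooth_dir oU sf (smooth_sharp hM hpi oU sc')).
(* The second argument is expanded first, with a frame form on the left. *)
have sfb k : smooth_form C U (fbracket C pi (th (e k)) b).
  have E q : U q -> \sum_j (sg b q 0 j *: th (br (e k) (e j)) q
      + dir C (fun q => sg b q 0 j) q (sharp pi (th (e k)) q) *: th (e j) q)
      = fbracket C pi (th (e k)) b q.
    move=> Uq; rewrite [in RHS](dual_form_expand b).
    apply/esym; apply: etrans (fbracket_sumr hG hpi _ oU Uq sd (fun j => st (e j)) (st (e k))) _.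
    by apply: eq_bigr => j _; rewrite (fbracket_dual_form hG hpi hmult br_dual).
  apply: (smooth_form_ext hM E).
  have -> : (fun q => \sum_j (sg b q 0 j *: th (br (e k) (e j)) q
      + dir C (fun q => sg b q 0 j) q (sharp pi (th (e k)) q) *: th (e j) q))
    = fun q => (fun=> 1 : R) q *: (\sum_j sg b q 0 j *: th (br (e k) (e j)) q)
      + \sum_j dir C (fun q => sg b q 0 j) q (sharp pi (th (e k)) q) *: th (e j) q.
    by apply/funext => q; rewrite scale1r big_split.
  apply: (smooth_form_linear hM oU (smooth_cst C U 1)).
    exact: (smooth_form_sum hG _ oU sd (fun j => st _)).
  exact: (smooth_form_sum hG _ oU (fun j => sXp _ _ (sd j) (st (e k))) (fun j => st _)).
have E q : U q -> \sum_k (sg a q 0 k *: fbracket C pi (th (e k)) b q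
    - dir C (fun q => sg a q 0 k) q (sharp pi b q) *: th (e k) q) = fbracket C pi a b q.
  move=> Uq; rewrite [in RHS](dual_form_expand a); apply/esym.
  exact: (fbracket_suml hG hpi _ oU Uq sc (fun j => st (e j)) sb).
apply: (smooth_form_ext hM E).
have -> : (fun q => \sum_k (sg a q 0 k *: fbracket C pi (th (e k)) b q
    - dir C (fun q => sg a q 0 k) q (sharp pi b q) *: th (e k) q))
  = fun q => (fun=> 1 : R) q *: (\sum_k sg a q 0 k *: fbracket C pi (th (e k)) b q)
    + \sum_k - dir C (fun q => sg a q 0 k) q (sharp pi b q) *: th (e k) q.
  apply/funext => q; rewrite scale1r -big_split; apply: eq_bigr => k _.
  by rewrite scaleNr.
apply: (smooth_form_linear hM oU (smooth_cst C U 1)).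
  exact: (smooth_form_sum hG _ oU sc sfb).
exact: (smooth_form_sum hG _ oU (fun j => sX _ _ (sc j) sb) (fun j => st _)).
Qed.

Lemma slot_linear_sum B s1 s2 (f : 'I_n -> G -> R) (v : 'I_n -> form R n G) p :
  slot_linear C U B -> smooth_forms C U (s1 ++ s2) -> (forall k, smooth C U (f k)) ->
  (forall k, smooth_form C U (v k)) -> U p ->
  B (s1 ++ (fun q => \sum_k f k q *: v k q) :: s2) p = \sum_k f k p * B (s1 ++ v k :: s2) p.
Proof.
move=> lB hs sf sv Up; elim: (index_enum _) => [|k r IH].
  rewrite big_nil (_ : (fun q => _) = fun=> 0); last by apply/funext => q; rewrite big_nil.
  exact: (slot_linear_zero lB hs Up).
rewrite big_cons -IH (_ : (fun q => _) = fun q => f k q *: v k q + \sum_(j <- r) f j q *: v j q).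
  exact: (lB s1 s2 (f k) (v k) _ hs (sf k) (sv k) (smooth_form_sum hG r oU sf sv) p Up).
by apply/funext => q; rewrite big_cons.
Qed.

Lemma smooth_dual_forms (v : seq V) : smooth_forms C U (map th v).
Proof.
elim: v => [|x v IH]; first exact: smooth_forms_nil.
apply/smooth_forms_cons; split=> //; exact: (smooth_dual_form hG).
Qed.

(** The value at [p] is unchanged when the coefficient functions of each argument in the frame are
    replaced by their values at [p]. *)
Lemma slot_linear_frozen B s p : slot_linear C U B -> smooth_forms C U s -> U p ->
  B s p = B [seq th (sg a p) | a <- s] p.
Proof.
move=> lB hs Up.
(* The prefix [t] collects the arguments already frozen. *)
suff E t s' : smooth_forms C U s' -> B (map th t ++ s') p = B (map th (t ++ [seq sg a p | a <-
  s'])) p.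
  by rewrite (E [::] s hs) /= -map_comp.
elim: s' t => [|a s' IH] t; first by rewrite !cats0.
move=> /smooth_forms_cons[sa hs'].
have hts : smooth_forms C U (map th t ++ s').
  by apply/smooth_forms_cat; split=> //; exact: smooth_dual_forms.
have st x := @smooth_dual_form _ _ _ _ hG K U x.
have -> : B (map th t ++ a :: s') p = B (map th t ++ th (sg a p) :: s') p.
  rewrite {1}(dual_form_expand a).
  have -> : th (sg a p) = fun q => \sum_k (fun k => fun=> sg a p 0 k) k q *: th (e k) q.
    by apply/funext => q; rewrite {1}(row_sum_delta (sg a p)) dual_form_sum.
  rewrite (slot_linear_sum lB hts (fun k => smooth_dual_coord hG K k oU sa) (fun k => st _) Up).
  by rewrite (slot_linear_sum lB hts (fun k => smooth_cst C U _) (fun k => st _) Up).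
by rewrite -cat_rcons -map_rcons (IH _ hs') cat_rcons.
Qed.

End FormCoordinates.

(** * Cochains and their values on the frame *)

Section WeilModels.
Context (R : realType) (n : nat) (G : topologicalGroupDataType) (C : atlas R n G).
Hypothesis hG : is_lie_group C.
Variable pi : G -> 'M[R]_n.
Hypothesis hpi : is_poisson C pi.
Hypothesis hmult : is_multiplicative C pi.
Variable K : 'M[R]_n.
Hypothesis hK : K \in unitmx.
Variable br : 'rV[R]_n -> 'rV[R]_n -> 'rV[R]_n.
Hypothesis br_dual : forall x y u,
  pairing u ((br x y *m K)^T) = delta C pi u ((x *m K)^T) ((y *m K)^T).
Variable U : set G.
Hypothesis oU : open U.
Local Notation V := 'rV[R]_n.
Local Notation e k := (delta_mx 0 k : V).
Local Notation hM := (lie_manifold hG).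
Local Notation th := (dual_form C K).
Local Notation sg := (dual_coord C K).
Local Notation X := (fun x => sharp pi (th x)).
Variable P : weil_module C U X.
Implicit Types (x y xi : V) (v : seq V) (p q : G) (a : form R n G) (s : seq (form R n G))
  (w : mvfield R n G) (A : cochain R n G n) (b : seq V -> P).

Local Notation Xo := (weil_dir P).
Local Notation Do := (weil_deriv P).
Local Notation mo := (weil_mul P).
Local Notation val := (@weil_val _ _ _ _ _ _ P).
Local Notation smooth_fb := (smooth_fbracket hG hpi hmult hK br_dual oU).

(* By tensoriality [A] is determined by its values on the forms [th x], which are [b]. *)
Definition models A b := forall xi s, smooth_forms C U s -> forall p, U p ->
  A xi s p = val (b [seq sg a p | a <- s]) xi p.

Definition model_cochain b : cochain R n G n := fun xi s p =>
  val (b [seq sg a p | a <- s]) xi p.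

Lemma models_cochain b : models (model_cochain b) b. Proof. by []. Qed.

Lemma models_dual A b xi v p : models A b -> U p -> A xi (map th v) p = val (b v) xi p.
Proof.
move=> mA Up; rewrite mA//; last exact: (smooth_dual_forms hG).
rewrite -map_comp; congr (val (b _) xi p); rewrite -[RHS]map_id; apply: eq_map => x /=.
exact: (dual_formK hG hK).
Qed.

Lemma models_inj A A' b b' : models A b -> models A' b' -> cochain_eq C U A A' ->
  forall v, b v = b' v.
Proof.
move=> mA mA' AA' v; apply: weil_ext => xi p Up.
rewrite -(models_dual xi v mA Up) -(models_dual xi v mA' Up).
by apply: AA' => //; exact: (smooth_dual_forms hG).
Qed.

(** The arguments of [b] vary with the point. Expanding them one at a time in the standard basis
    moves this dependence to smooth coefficients, and [t] holds the constant arguments obtained. *)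
Lemma smooth_model b xi t s : multilinear b -> smooth_forms C U s ->
  smooth C U (fun p => val (b (t ++ [seq sg a p | a <- s])) xi p).
Proof.
move=> lb; elim: s t => [|a s IH] t; first by move=> _; rewrite /= cats0;
  exact: (poly_fun_smooth hM oU xi (weil_valP (b t))).
move=> /smooth_forms_cons[sa hs].
have sS : smooth C U (fun p => \sum_k sg a p 0 k * val (b (rcons t (e k) ++ [seq sg a p | a <-
  s])) xi p).
  apply: (smooth_sum hM _ oU) => k _.
  exact: (smoothM hM oU (smooth_dual_coord hG K k oU sa) (IH _ hs)).
apply: (smooth_ext hM oU) sS => p Up.
rewrite /= (row_sum_delta (sg a p)) (multilinear_sum _ _ _ _ _ lb) weil_val_sum.
by apply: eq_bigr => k _; rewrite cat_rcons weil_valZ -row_sum_delta.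
Qed.

Lemma dual_coord_linear (c : G -> R) a a' p :
  sg (fun q => c q *: a q + a' q) p = c p *: sg a p + sg a' p.
Proof.
rewrite /dual_coord scalemxAl -mulmxDl; congr (_ *m _); apply/rowP => i.
by rewrite !mxE pairingDr pairingZr.
Qed.

Lemma models_mvec A b xi : multilinear b -> alternating b -> models A b -> mvec C U (A xi).
Proof.
move=> lb ab mA q; split.
- move=> s _ hs; apply: (smooth_ext hM oU) (smooth_model xi [::] lb hs) => p Up.
  by rewrite mA.
- move=> s1 s2 f a a' _ /smooth_forms_cat[h1 h2] sf sa sa' p Up.
  have hx c : smooth_form C U c -> smooth_forms C U (s1 ++ c :: s2).
    by move=> hc; apply/smooth_forms_cat; split=> //; apply/smooth_forms_cons.
  rewrite !mA//; try exact: hx; last by apply: hx; exact: (smooth_form_linear hM oU).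
  by rewrite !map_cat /= dual_coord_linear lb weil_valD weil_valZ.
- move=> s1 s2 s3 a _ /smooth_forms_cat[h1 /smooth_forms_cat[h2 h3]] sa p Up.
  rewrite mA//; last first.
    apply/smooth_forms_cat; split=> //; apply/smooth_forms_cons; split=> //.
    by apply/smooth_forms_cat; split=> //; apply/smooth_forms_cons.
  by rewrite !map_cat /= map_cat /= alternating_gap// weil_val0.
Qed.

(** The agreement is assumed at all points of [U], since the Lie derivative differentiates in the
    point. *)
Lemma form_lie_model w b x xi v p :
  (forall t q, U q -> w (map th t) q = val (b t) xi q) -> U p ->
  form_lie C pi (th x) w (map th v) p = val (ce_lie br Xo x b v) xi p.
Proof.
move=> + Up; elim: v w b => [|y v IH] w b wb /=.
  rewrite weil_dirE poly_dir_in//; apply: (dir_ext hM _ oU Up) => q Uq.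
  exact: (wb [::]).
rewrite weil_valB; apply: (f_equal2 (fun s t : R => s - t)).
  by apply: IH => t q Uq; exact: (wb (y :: t)).
rewrite -wb//=; congr (w (_ :: _) p); apply/funext => q.
exact: (fbracket_dual_form hG hpi hmult br_dual).
Qed.

Lemma d_pi_model w b xi v p : mvec C U w ->
  (forall t q, U q -> w (map th t) q = val (b t) xi q) -> U p ->
  d_pi C pi w (map th v) p = val (ce_diff br Xo b v) xi p.
Proof.
move=> + + Up; elim: v w b => [|x v IH] w b hw wb /=; first by rewrite weil_val0 d_pi_nil.
have hx := @smooth_dual_form _ _ _ _ hG K U x.
have hv : smooth_forms C U (map th v) by exact: (smooth_dual_forms hG).
rewrite (d_pi_cons hM oU smooth_fb hw hx hv Up).
rewrite weil_valB; apply: (f_equal2 (fun s t : R => s - t)); first exact: form_lie_model.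
by apply: IH => [|t q Uq]; [exact: mvec_contr|exact: (wb (x :: t))].
Qed.

Lemma lie_form_lie w x s p : mvec C U w -> smooth_forms C U s -> U p ->
  lie C pi (th x) w s p = form_lie C pi (th x) w s p.
Proof.
move=> hw hs Up; rewrite /lie {1}/contr.
rewrite (d_pi_cons hM oU smooth_fb hw (@smooth_dual_form _ _ _ _ hG K U x) hs Up).
exact: subrK.
Qed.

Lemma weil_iotaE b xi v p : multilinear b ->
  val (ce_iota mo b v) xi p = val (b (xi :: v)) xi p.
Proof.
move=> lb; rewrite /ce_iota weil_val_sum {2}(row_sum_delta xi).
rewrite (multilinear_sum (index_enum 'I_n) (fun k => xi 0 k) (fun k => e k) [::] v lb) weil_val_sum.
by apply: eq_bigr => k _; rewrite weil_valZ weil_mulE.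
Qed.

(** By tensoriality of [d_pi] and of the contraction, it suffices to compare values on the frame.
    There the contraction of [A xi] with the form of the same xi is [ce_iota]. *)
Lemma models_d_G A b : multilinear b -> alternating b -> models A b ->
  models (d_G C pi th A) (equiv_diff br Xo mo b).
Proof.
move=> lb ab mA xi s hs p Up; have hA := models_mvec xi lb ab mA.
have hx := @smooth_dual_form _ _ _ _ hG K U xi.
have l1 := d_pi_slot_linear hM hpi oU smooth_fb hA.
have l2 := mvec_slot_linear (mvec_contr hA hx).
rewrite /d_G (slot_linear_frozen hG hK oU l1 hs Up) (slot_linear_frozen hG hK oU l2 hs Up).
rewrite (map_comp th (fun a => sg a p)) /equiv_diff.
rewrite weil_valB; apply: (f_equal2 (fun s t : R => s - t)).
  by apply: d_pi_model => // t q Uq; exact: models_dual.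
by rewrite weil_iotaE//; exact: (models_dual xi (xi :: _) mA Up).
Qed.

End WeilModels.

(** * Tensor products with polynomials *)

Section Tensors.
Context (R : realType) (n : nat) (M : topologicalType) (C : atlas R n M).
Hypothesis hC : is_manifold C.
Variable U : set M.
Hypothesis oU : open U.
Local Notation V := 'rV[R]_n.
Implicit Types (w : mvfield R n M) (s : seq (form R n M)) (A : cochain R n M n) (p : M) (xi : V).

Lemma hom_fun_prod m (l : 'I_m -> 'cV[R]_n) (f : M -> R) : smooth C U f ->
  (forall p, ~ U p -> f p = 0) ->
  hom_fun C U m (fun xi p => \prod_(i < m) (xi *m l i) 0 0 * f p).
Proof.
move=> sf f0; elim: m l => [|m IH] l; first by exists f => // xi p; rewrite big_ord0 mul1r.
exists (fun k xi p => l ord0 k 0 * (\prod_(i < m) (xi *m l (lift ord0 i)) 0 0 * f p)) => [k|xi p].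
  exact: (hom_fun_scale hC oU (l ord0 k 0) (IH (fun i => l (lift ord0 i)))).
rewrite big_ord_recl mxE !mulr_suml; apply: eq_bigr => k _.
by rewrite -!mulrA.
Qed.

Lemma multivector_eq q w w' : is_multivector C U q w ->
  (forall s, size s = q -> smooth_forms C U s -> forall p, U p -> w s p = w' s p) ->
  is_multivector C U q w'.
Proof.
move=> hw ww'; split.
- move=> s sq hs; apply: (smooth_ext hC oU) (mv_smooth hw sq hs) => p Up; exact: ww'.
- move=> s1 s2 f a b sq hs sf sa sb p Up.
  have hx c : smooth_form C U c -> smooth_forms C U (s1 ++ c :: s2).
    move=> hc; have /smooth_forms_cat[h1 h2] := hs.
    by apply/smooth_forms_cat; split=> //; apply/smooth_forms_cons.
  have sx c : size (s1 ++ c :: s2) = q by rewrite size_cat /= addnS.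
  rewrite -!ww' ?sx//; try exact: hx; last by apply: hx; exact: (smooth_form_linear hC oU).
  exact: (mv_linear hw).
- move=> s1 s2 s3 a sq hs sa p Up; rewrite -ww'//; first exact: (mv_alternating hw).
    by rewrite -sq !size_cat /= size_cat /=; lia.
  have /smooth_forms_cat[h1 /smooth_forms_cat[h2 h3]] := hs.
  apply/smooth_forms_cat; split=> //; apply/smooth_forms_cons; split=> //.
  by apply/smooth_forms_cat; split=> //; apply/smooth_forms_cons.
Qed.

Lemma multivector_sum q r (c : 'I_r -> R) (w : 'I_r -> mvfield R n M) :
  (forall j, is_multivector C U q (w j)) ->
  is_multivector C U q (fun s p => \sum_(j < r) c j * w j s p).
Proof.
move=> hw; split.
- move=> s sq hs; apply: (smooth_sum hC _ oU) => j _.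
  exact: (smoothM hC oU (smooth_cst C U _) (mv_smooth (hw j) sq hs)).
- move=> s1 s2 f a b sq hs sf sa sb p Up; rewrite mulr_sumr -big_split; apply: eq_bigr => j _ /=.
  by rewrite (mv_linear (hw j) sq hs sf sa sb Up) mulrDr mulrCA.
- move=> s1 s2 s3 a sq hs sa p Up; apply: big1 => j _.
  by rewrite (mv_alternating (hw j) sq hs sa Up) mulr0.
Qed.

Lemma in_tensor_ext q m A A' : in_tensor C U q m A ->
  (forall xi s, size s = q -> smooth_forms C U s -> forall p, U p -> A xi s p = A' xi s p) ->
  in_tensor C U q m A'.
Proof.
move=> [r [l [w [hw AE]]]] AA'; exists r, l, w; split=> // xi s sq hs p Up.
by rewrite -AA'// AE.
Qed.

Lemma in_tensor_linear_form q m k A : in_tensor C U q m A ->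
  in_tensor C U q m.+1 (fun xi s p => xi 0 k * A xi s p).
Proof.
move=> [r [l [w [hw AE]]]].
(* The new factor, the k-th coordinate, occupies index 0 and the old ones are shifted. *)
exists r, (fun j i => if unlift ord0 i is Some i' then l j i' else delta_mx k 0), w; split=> //.
move=> xi s sq hs p Up; rewrite AE// mulr_sumr; apply: eq_bigr => j _.
rewrite big_ord_recl unlift_none -colE mxE -mulrA; congr (_ * (_ * _)).
by apply: eq_bigr => i _; rewrite liftK.
Qed.

Lemma in_tensor0 q m : in_tensor C U q m ((fun _ _ _ => 0) : cochain R n M n).
Proof.
exists 0%N, (fun _ _ => 0), (fun _ => fun _ _ => 0); split=> [[]//|xi s _ _ p _].
by rewrite big_ord0.
Qed.

Lemma in_tensor_add q m A A' : in_tensor C U q m A -> in_tensor C U q m A' ->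
  in_tensor C U q m (fun xi s p => A xi s p + A' xi s p).
Proof.
move=> [r [l [w [hw AE]]]] [r' [l' [w' [hw' AE']]]].
exists (r + r')%N, (fun j => match fintype.split j with inl i => l i | inr i => l' i end),
  (fun j => match fintype.split j with inl i => w i | inr i => w' i end); split.
  by move=> j; case: (fintype.split j).
move=> xi s sq hs p Up; rewrite AE// AE'// big_split_ord; congr (_ + _); apply: eq_bigr => j _ /=.
  by rewrite (unsplitK (inl j)).
by rewrite (unsplitK (inr j)).
Qed.

Lemma in_tensor_sum q m (I : Type) (r : seq I) (A : I -> cochain R n M n) :
  (forall i, in_tensor C U q m (A i)) ->
  in_tensor C U q m (fun xi s p => \sum_(i <- r) A i xi s p).
Proof.
move=> hA; elim: r => [|i r IH].
  by apply: (in_tensor_ext (in_tensor0 q m)) => xi s _ _ p _; rewrite big_nil.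
by apply: (in_tensor_ext (in_tensor_add (hA i) IH)) => xi s _ _ p _; rewrite big_cons.
Qed.

End Tensors.

(** * Equivariant cochains as Weil cochains *)

Section WeilCorrespondence.
Context (R : realType) (n : nat) (G : topologicalGroupDataType) (C : atlas R n G).
Hypothesis hG : is_lie_group C.
Variable pi : G -> 'M[R]_n.
Hypothesis hpi : is_poisson C pi.
Hypothesis hmult : is_multiplicative C pi.
Variable K : 'M[R]_n.
Hypothesis hK : K \in unitmx.
Variable br : 'rV[R]_n -> 'rV[R]_n -> 'rV[R]_n.
Hypothesis br_dual : forall x y u,
  pairing u ((br x y *m K)^T) = delta C pi u ((x *m K)^T) ((y *m K)^T).
Variable U : set G.
Hypothesis oU : open U.
Local Notation V := 'rV[R]_n.
Local Notation e k := (delta_mx 0 k : V).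
Local Notation hM := (lie_manifold hG).
Local Notation th := (dual_form C K).
Local Notation sg := (dual_coord C K).
Local Notation X := (fun x => sharp pi (th x)).
Variable P : weil_module C U X.
Local Notation Xo := (weil_dir P).
Local Notation Do := (weil_deriv P).
Local Notation mo := (weil_mul P).
Local Notation val := (@weil_val _ _ _ _ _ _ P).
Local Notation hom := (@weil_hom _ _ _ _ _ _ P).
Local Notation smooth_fb := (smooth_fbracket hG hpi hmult hK br_dual oU).
Local Notation wcochain := (weil_cochain br Xo Do mo hom).
Implicit Types (x y xi : V) (v : seq V) (p q : G) (a : form R n G) (s : seq (form R n G))
  (A : cochain R n G n) (b : seq V -> P).

(** Linearity of the derivative in its direction collects the sum into the single direction
    [br z xi], as in [diag_act]. *)
Lemma coadjoint_val z (f : P) xi p :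
  val (coadjoint br Do mo z f) xi p = poly_deriv (br z xi) (val f) xi p.
Proof.
have lbr := br_linearr hG hpi hK br_dual.
have br0 : br z 0 = 0 by have := lbr z (-1) 0 0; rewrite !scaleN1r !addNr.
have lD (c : R) x y : poly_deriv (c *: x + y) (val f) xi p
    = c * (poly_deriv x (val f) xi p : R) + (poly_deriv y (val f) xi p : R).
  by rewrite (poly_deriv_linearl c x y (weil_valP f)).
have D0 : poly_deriv 0 (val f) xi p = 0.
  by have := lD (-1) 0 0; rewrite scaleN1r addNr mulN1r addNr.
transitivity (poly_deriv (br z (\sum_k xi 0 k *: e k)) (val f) xi p); last first.
  by rewrite -row_sum_delta.
rewrite weil_val_sum.
elim: (index_enum _) => [|k r IH]; first by rewrite !big_nil br0 D0.
rewrite !big_cons IH lbr lD; apply: (f_equal2 +%R) => //.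
by rewrite weil_mulE weil_derivE.
Qed.

Lemma cochain_mvec N A xi : is_cochain C pi br th U N A -> mvec C U (A xi).
Proof.
move=> hA q; have [[m qm]|nm] := pselect (exists m, (q + 2 * m)%N = N).
  have [r [l [w [hw AE]]]] := cochain_tensor hA qm.
  apply: (multivector_eq hM oU (multivector_sum hM oU _ hw)) => s sq hs p Up.
  by rewrite (AE xi).
(* In a degree excluded by [N] the component is zero, obtained here as an empty sum. *)
apply: (multivector_eq hM oU (@multivector_sum _ _ _ _ hM U oU q 0 (fun=> 0) (fun _ _ _ => 0) _)).
  by case.
move=> s sq hs p Up; rewrite big_ord0 (cochain_zero hA _ xi sq hs Up)// => m qm.
by apply: nm; exists m.
Qed.

Definition frame_values A v : V -> G -> R^o :=
  fun xi p => if `[< U p >] then A xi (map th v) p else 0.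

Lemma frame_values_in A v xi p : U p -> frame_values A v xi p = A xi (map th v) p.
Proof. by move=> Up; rewrite /frame_values asboolT. Qed.

Lemma hom_frame_values (q m : nat) A v : in_tensor C U q m A -> size v = q ->
  hom_fun C U m (frame_values A v).
Proof.
move=> [r [l [w [hw AE]]]] vq.
have hv : smooth_forms C U (map th v) by exact: (smooth_dual_forms hG).
have sv : size (map th v) = q by rewrite size_map.
pose f j p : R := if `[< U p >] then w j (map th v) p else 0.
have sf j : smooth C U (f j).
  by apply: (smooth_ext hM oU) (mv_smooth (hw j) sv hv) => p Up; rewrite /f asboolT.
have f0 j p : ~ U p -> f j p = 0 by move=> Up; rewrite /f asboolF.
have hS := @hom_fun_sum _ _ _ _ hM U oU m _ (index_enum 'I_r) _
  (fun j => hom_fun_prod hM oU (l j) (sf j) (f0 j)).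
rewrite (_ : frame_values A v = fun xi p =>
  \sum_(j < r) \prod_(i < m) (xi *m l j i) 0 0 * f j p)//.
apply/funext => xi; apply/funext => p.
have [Up|nUp] := pselect (U p).
  by rewrite frame_values_in// AE//; apply: eq_bigr => j _; rewrite /f asboolT.
by rewrite /frame_values asboolF// big1// => j _; rewrite f0// mulr0.
Qed.

Lemma cochain_model N A : is_cochain C pi br th U N A ->
  exists2 b, wcochain N b & models A b.
Proof.
move=> hA; have mvA xi := cochain_mvec xi hA.
have hv v : smooth_forms C U (map th v) by exact: (smooth_dual_forms hG).
have sth x : smooth_form C U (th x) by exact: (smooth_dual_form hG).
have off v : (forall m, (size v + 2 * m)%N <> N) -> frame_values A v = fun _ _ => 0.
  move=> nm; apply/funext => xi; apply/funext => p; rewrite /frame_values; case: asboolP => // Up.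
  by apply: (cochain_zero hA nm) => //; rewrite size_map.
have polyA v : poly_fun C U (frame_values A v).
  have [[m vm]|nm] := pselect (exists m, (size v + 2 * m)%N = N).
    by apply: poly_hom; exact: (hom_frame_values (cochain_tensor hA vm)).
  rewrite off; first exact: poly_hom (hom_fun0 C U 0).
  by move=> m vm; apply: nm; exists m.
pose b v := sval (cid (weil_lift P (polyA v))).
have bE v : val (b v) = frame_values A v by exact: (svalP (cid (weil_lift P (polyA v)))).
have bA v xi p : U p -> val (b v) xi p = A xi (map th v) p.
  by move=> Up; rewrite bE frame_values_in.
exists b; last first.
  move=> xi s hs p Up; rewrite bA// (slot_linear_frozen hG hK oU (mvec_slot_linear (mvA xi)) hs Up).
  by rewrite -map_comp.
split.
- move=> s1 s2 c x y; apply: weil_ext => xi p Up.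
  rewrite weil_valD weil_valZ !bA// !map_cat /=.
  have -> : th (c *: x + y) = fun q => (fun=> c : R) q *: th x q + th y q.
    by apply/funext => q; exact: (dual_form_linear hG).
  apply: (mvec_slot_linear (mvA xi)) => //; first by rewrite -map_cat.
  exact: smooth_cst.
- move=> s1 s2 x; apply: weil_ext => xi p Up; rewrite weil_val0 bA// map_cat /=.
  apply: (mv_alternating (mvA xi _) (s2 := [::]) erefl) => //.
  by rewrite /= -map_cat.
- move=> v; have [[m vm]|nm] := pselect (exists m, (size v + 2 * m)%N = N).
    by right; exists m => //; rewrite /weil_hom bE; exact: (hom_frame_values (cochain_tensor hA
      vm)).
  left; apply: weil_ext => xi p Up; rewrite weil_val0 bE off// => m vm.
  by apply: nm; exists m.
- move=> z v; apply: weil_ext => xi p Up; rewrite coadjoint_val.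
  (* On frame arguments the Lie derivative becomes [ce_lie], so invariance of [A] is invariance of
     [b]. *)
  have := cochain_invariant hA z xi (hv v) Up; rewrite /diag_act.
  rewrite (lie_form_lie hG hpi hmult hK br_dual oU z (mvA xi) (hv v) Up).
  have bA' t q : U q -> A xi (map th t) q = val (b t) xi q by move=> Uq; rewrite bA.
  rewrite (form_lie_model hG hpi hmult br_dual oU z v bA' Up) => /eqP.
  rewrite subr_eq0 => /eqP ->; congr ('D_ _ _ xi).
  by apply/funext => eta; rewrite bA.
Qed.

(** Euler's identity splits off one linear form at a time: a homogeneous element of degree [m.+1] is
    the sum of xi_k times its k-th partial derivative, divided by [m.+1]. *)
Lemma model_in_tensor (q m : nat) A b : multilinear b -> alternating b ->
  (forall v, size v = q -> hom m (b v)) -> models A b -> in_tensor C U q m A.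
Proof.
elim: m A b => [|m IH] A b lb ab hb mA.
  (* In polynomial degree 0 the values do not depend on xi, so [A 0] with an empty product
     represents [A]. *)
  exists 1%N, (fun _ _ => 0), (fun=> A 0); split=> [_|xi s sq hs p Up].
    exact: (models_mvec hG oU 0 lb ab mA).
  rewrite big_ord1 big_ord0 mul1r !mA//.
  have [|f _ fE] := hb [seq sg a p | a <- s]; first by rewrite size_map.
  by rewrite !fE.
pose B k v := (m.+1%:R)^-1 *: Do (e k) (b v).
have lB k : multilinear (B k).
  by move=> s1 s2 c x y; rewrite /B lb linearP scalerDr !scalerA mulrC.
have aB k : alternating (B k).
  by move=> s1 s2 x; rewrite /B ab linear0 scaler0.
have hB k v : size v = q -> hom m (B k v).
  move=> vq; rewrite /B -[_ *: _]addr0.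
  apply: (weil_hom_linear hM oU); last exact: weil_hom0.
  by apply: (weil_hom_deriv hM oU); exact: hb.
have tB := in_tensor_sum (index_enum 'I_n) (fun k => in_tensor_linear_form k
  (IH _ _ (lB k) (aB k) (hB k) (models_cochain (B k)))).
apply: (in_tensor_ext tB) => xi s sq hs p Up; rewrite mA//.
set v := [seq sg a p | a <- s].
have vq : size v = q by rewrite size_map.
have := euler_fun xi p (hb v vq) => eul.
have scaleE (c S T : R) : c != 0 -> S = c * T -> c^-1 * S = T by move=> c0 ->; rewrite mulKf.
have m0 : (m.+1%:R : R) != 0 by rewrite pnatr_eq0.
rewrite -(scaleE _ _ _ m0 (etrans eul (esym (mulr_natl _ _)))) mulr_sumr; apply: eq_bigr => k _.
by rewrite /model_cochain -/v /B weil_valZ weil_derivE; exact: mulrCA.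
Qed.

Lemma model_is_cochain N A b : wcochain N b -> models A b -> is_cochain C pi br th U N A.
Proof.
move=> [lb ab gb ib] mA; split.
- move=> q m qm; apply: model_in_tensor mA => // v vq.
  case: (gb v) => [->|[j vj]]; first exact: weil_hom0.
  by rewrite (_ : j = m)//; move: vj qm; rewrite vq; lia.
- move=> q nm xi s sq hs p Up; rewrite mA//.
  case: (gb [seq sg a p | a <- s]) => [->|[j]]; first exact: weil_val0.
  by rewrite size_map sq => /nm.
move=> z xi s hs p Up; have mvA := models_mvec hG oU xi lb ab mA.
have lL := form_lie_slot_linear hM hpi oU smooth_fb mvA (@smooth_dual_form _ _ _ _ hG K U z).
rewrite /diag_act (lie_form_lie hG hpi hmult hK br_dual oU z mvA hs Up).
rewrite (slot_linear_frozen hG hK oU lL hs Up) (map_comp th (fun a => sg a p)).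
have bA t q : U q -> A xi (map th t) q = val (b t) xi q by move=> Uq;
  exact: (models_dual hG hK xi t mA Uq).
rewrite (form_lie_model hG hpi hmult br_dual oU z _ bA Up) ib coadjoint_val.
rewrite (_ : (fun eta => A eta s p) = fun eta => val (b [seq sg a p | a <- s]) eta p).
  exact: subrr.
by apply/funext => eta; exact: mA.
Qed.

End WeilCorrespondence.

(** * Cohomology *)

Section Cohomology.
Context (R : realType) (n : nat) (G : topologicalGroupDataType) (C : atlas R n G).
Hypothesis hG : is_lie_group C.
Variable pi : G -> 'M[R]_n.
Hypothesis hpi : is_poisson C pi.
Hypothesis hmult : is_multiplicative C pi.
Variable K : 'M[R]_n.
Hypothesis hK : K \in unitmx.
Variable br : 'rV[R]_n -> 'rV[R]_n -> 'rV[R]_n.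
Hypothesis br_dual : forall x y u,
  pairing u ((br x y *m K)^T) = delta C pi u ((x *m K)^T) ((y *m K)^T).
Variable U : set G.
Hypothesis oU : open U.
Local Notation V := 'rV[R]_n.
Local Notation e k := (delta_mx 0 k : V).
Local Notation hM := (lie_manifold hG).
Local Notation th := (dual_form C K).
Local Notation sg := (dual_coord C K).
Local Notation X := (fun x => sharp pi (th x)).
Variable P : weil_module C U X.
Local Notation Xo := (weil_dir P).
Local Notation Do := (weil_deriv P).
Local Notation mo := (weil_mul P).
Local Notation val := (@weil_val _ _ _ _ _ _ P).
Local Notation hom := (@weil_hom _ _ _ _ _ _ P).
Local Notation wcochain := (weil_cochain br Xo Do mo hom).
Local Notation dW := (equiv_diff br Xo mo).
Local Notation cocycle := (cocycle C pi br th U).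
Local Notation coboundary := (coboundary C pi br th U).
Local Notation cohom_class := (cohom_class C pi br th U).
Implicit Types (x y xi : V) (v : seq V) (p : G) (f h : G -> R) (s : seq (form R n G))
  (A : cochain R n G n) (b : seq V -> P).

Lemma cocycle_model N A : cocycle N A ->
  exists b, [/\ wcochain N b, models A b & forall v, dW b v = 0].
Proof.
move=> [hA A0]; have [b wb mA] := cochain_model hG hpi hmult hK br_dual oU P hA.
exists b; split=> // v.
have md := models_d_G hG hpi hmult hK br_dual oU (weil_multilinear wb) (weil_alternating wb) mA.
have m0 : models (fun _ _ _ => 0) (fun=> 0 : P) by move=> xi s hs p Up; rewrite weil_val0.
exact: (models_inj hG hK md m0 A0).
Qed.

Lemma model_cocycle N A b : wcochain N b -> models A b -> (forall v, dW b v = 0) -> cocycle N A.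
Proof.
move=> wb mA b0; split; first exact: (model_is_cochain hG hpi hmult hK br_dual oU wb mA).
move=> xi s hs p Up.
have md := models_d_G hG hpi hmult hK br_dual oU (weil_multilinear wb) (weil_alternating wb) mA.
by rewrite md// b0 weil_val0.
Qed.

Lemma model_coboundary N A b : wcochain N b -> models A (dW b) -> coboundary N.+1 A.
Proof.
move=> wb mA; exists (model_cochain b); split.
  exact: (model_is_cochain hG hpi hmult hK br_dual oU wb (models_cochain b)).
move=> xi s hs p Up; rewrite mA//.
have md := models_d_G hG hpi hmult hK br_dual oU (weil_multilinear wb) (weil_alternating wb)
  (models_cochain b).
by rewrite md.
Qed.

Lemma dual_module_acyclic N b : wcochain N.+1 b -> (forall v, dW b v = 0) ->
  exists2 c, wcochain N c & forall v, b v = dW c v.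
Proof.
apply: (weil_module_acyclic hM oU).
- by move=> x; exact: (smooth_sharp_dual_form hG hpi K x oU).
- move=> a x y p; rewrite /sharp (dual_form_linear hG) linearD linearZ /=.
  by rewrite mulmxDl -scalemxAl.
- by move=> f x y p Up sf; exact: (dir_dual_form_bracket hG hpi hmult br_dual _ _ oU Up sf).
- exact: (br_linearr hG hpi hK br_dual).
- exact: (br_antisym hG hpi hK br_dual).
- exact: (br_jacobi hG hpi hmult hK br_dual).
Qed.

(** Both cocycles have primitives in the Weil complex, and the difference of the primitives models a
    primitive of the difference. *)
Lemma cocycle_coboundary N A A' : cocycle N.+1 A -> cocycle N.+1 A' ->
  coboundary N.+1 (fun xi s p => A xi s p - A' xi s p).
Proof.
move=> /cocycle_model[b [wb mA b0]] /cocycle_model[b' [wb' mA' b0']].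
have [c wc bE] := dual_module_acyclic wb b0; have [c' wc' bE'] := dual_module_acyclic wb' b0'.
apply: (@model_coboundary _ _ (fun v => (-1) *: c' v + c v)).
  exact: (weil_cochain_linear (@weil_hom0 _ _ _ _ _ _ P) (@weil_hom_linear _ _ _ _ hM _ oU _ P)
    (-1) wc' wc).
move=> xi s hs p Up; rewrite equiv_diff_linear -bE -bE' weil_valD weil_valZ mA// mA'//.
by rewrite mulN1r addrC.
Qed.

Lemma zero_cocycle N : cocycle N (fun _ _ _ => 0).
Proof.
apply: (@model_cocycle N _ (fun=> 0)) => [|xi s hs p Up|v].
- exact: (weil_cochain0 br Xo Do mo hom N).
- by rewrite weil_val0.
- exact: equiv_diff0.
Qed.

Lemma cohom_class_gt0 N A : cocycle N.+1 A -> cohom_class N.+1 A = cohom_class N.+1 (fun _ _ _ =>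
  0).
Proof.
move=> hA; apply/seteqP; split=> B [hB _]; split=> //; apply: cocycle_coboundary => //.
exact: zero_cocycle.
Qed.

Lemma degree0_model b v : wcochain 0 b -> v != [::] -> b v = 0.
Proof.
by case: v => // x v wb _; case: (weil_graded wb (x :: v)) => // -[j] /=; lia.
Qed.

(** The fields of the action kill [f], hence so does the differential, and the contraction has no
    slot to act on. The coadjoint part of invariance vanishes since [f] has polynomial degree 0. *)
Lemma function_cocycle f : invariant_functions C pi th U f -> cocycle 0 (function_cochain f).
Proof.
move=> [sf Xf].
have hF : hom_fun C U 0 (fun (_ : V) p => if `[< U p >] then f p else 0).
  exists (fun p => if `[< U p >] then f p else 0) => //; split.
    by apply: (smooth_ext hM oU) sf => p Up; rewrite asboolT.
  by move=> p nUp; rewrite asboolF.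
have [F FE] := weil_lift P (poly_hom hF).
have hF' : hom 0 F by rewrite /weil_hom FE.
pose b v : P := if v is [::] then F else 0.
have XF x : Xo x F = 0.
  apply: weil_ext => xi p Up; rewrite weil_val0 weil_dirE poly_dir_in// FE.
  rewrite -(Xf x p Up); apply: (dir_ext hM _ oU Up) => q Uq.
  by rewrite asboolT.
have lb x w v : (forall t, w t = 0) -> ce_lie br Xo x w v = 0.
  elim: v w => [|y v IH] w w0 /=; first by rewrite w0 linear0.
  by rewrite w0 subr0; apply: IH => t; exact: w0.
have wb : wcochain 0 b.
  split.
  - by case=> [|z s1] s2 a x y; rewrite /= scaler0 addr0.
  - by case.
  - by case=> [|x v]; [right; exists 0%N|left].
  - move=> z [|x v]; last by rewrite /= lb// sub0r oppr0 /coadjoint big1// => k _; rewrite !linear0.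
    by rewrite /= XF /coadjoint big1// => k _; rewrite (weil_hom_deriv0 _ hF') linear0.
apply: (model_cocycle wb).
  move=> xi [|a s] hs p Up /=; last by rewrite weil_val0.
  by rewrite FE asboolT.
have db v w : (forall t, w t = 0) -> ce_diff br Xo w v = 0.
  elim: v w => [|y v IH] w w0 //=; rewrite lb// sub0r IH ?oppr0// => t; exact: w0.
move=> v; rewrite /equiv_diff /ce_iota big1 ?subr0; last by move=> k _; rewrite linear0.
case: v => [|x v] //=; rewrite db// subr0.
case: v => [|y v] /=; first exact: XF.
by rewrite lb// subr0.
Qed.

Lemma degree0_cocycle A : cocycle 0 A ->
  invariant_functions C pi th U (A 0 [::]) /\
  cochain_eq C U A (function_cochain (A 0 [::])).
Proof.
move=> /cocycle_model[b [wb mA b0]].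
have hb : hom 0 (b [::]).
  case: (weil_graded wb [::]) => [->|[j /= j0]]; first exact: weil_hom0.
  by rewrite (_ : j = 0%N)//; lia.
have [f [sf _] fE] := hb.
have Af xi p : U p -> A xi [::] p = f p by move=> Up; rewrite mA//= fE.
split; last first.
  move=> xi [|a s] hs p Up /=; first by rewrite !Af.
  by rewrite mA// degree0_model// weil_val0.
split; first by apply: (smooth_ext hM oU) sf => p Up; rewrite Af.
move=> xi p Up.
(* On one argument the cocycle condition is the derivative of the function along the field of xi;
   the contraction term has exterior degree 2 and vanishes in total degree 0. *)
have := f_equal (fun g => val g 0 p) (b0 [:: xi]).
rewrite weil_val0 /equiv_diff /ce_iota big1 => [|k _]; last by rewrite degree0_model// linear0.
rewrite /= !subr0 weil_dirE poly_dir_in// => <-; apply: (dir_ext hM _ oU Up) => q Uq.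
by rewrite mA.
Qed.

Lemma cohom_class0 A A' : cochain_eq C U A A' -> cohom_class 0 A = cohom_class 0 A'.
Proof.
move=> AA'; apply/seteqP; split=> B [hB B0]; split=> // xi s hs p Up;
  rewrite -(B0 xi s hs p Up) AA' //.
Qed.

End Cohomology.

Theorem corollary4p20 (R : realType) (n : nat) (G Gs : poissonLieGroup R n)
    (K : 'M[R]_n) (U : set Gs)
    (hG : connected [set: G])
    (hdual : is_dual G Gs K)
    (hU : open U)
    (hinv : dressing_invariant (pl_atlas Gs) (@pl_pi R n Gs) (theta K) U) :
  let C := pl_atlas Gs in
  let pi := @pl_pi R n Gs in
  let H := eq_cohomology C pi (lie_bracket (pl_atlas G)) (theta K) U in
  let cls := cohom_class C pi (lie_bracket (pl_atlas G)) (theta K) U in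
  let CG := invariant_functions C pi (theta K) U in
  [/\ forall f, CG f ->
        cocycle C pi (lie_bracket (pl_atlas G)) (theta K) U 0
          (function_cochain f),
      H 0%N = [set cls 0%N (function_cochain f) | f in CG],
      (forall f h, CG f -> CG h ->
        cls 0%N (function_cochain f) = cls 0%N (function_cochain h) ->
        forall p, U p -> f p = h p)
    & forall N, (0 < N)%N -> H N = [set cls N (fun _ _ _ => 0)]].
Proof.
move=> C pi H cls CG.
have hL := pl_lie_group Gs; have hP := pl_poisson Gs; have hM : is_multiplicative C pi :=
  @pl_multiplicative R n Gs.
have hK := dual_perfect hdual; have hb := dual_bracketG hdual.
(* The forms [theta K x] and [dual_form C K x] are the same by definition, so the results above
   apply to [theta]. *)
have sX x : smooth_vfield C U (sharp pi (dual_form C K x)).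
  exact: (smooth_sharp_dual_form hL hP K x hU).
have [P] := weil_module_exists (lie_manifold hL) hU sX.
have fc f := @function_cocycle _ _ _ _ hL _ hP hM _ hK _ hb _ hU P f.
split.
- exact: fc.
- apply/seteqP; split=> [D [A hA <-]|D [f hf <-]]; last by exists (function_cochain f) => //;
  exact: fc.
  have [hf AE] := @degree0_cocycle _ _ _ _ hL _ hP hM _ hK _ hb _ hU P A hA.
  exists (A 0 [::]) => //; exact/esym/cohom_class0.
(* In degree 0 a coboundary vanishes on [U], so a class determines the values of its members and
   evaluation on the empty sequence recovers the function. *)
- move=> f h hf hh fh p Up.
  have : cls 0%N (function_cochain f) (function_cochain f).
    by split; [exact: fc|move=> xi s hs q Uq; exact: subrr].
  rewrite fh => -[_ /(_ 0 [::] (@smooth_forms_nil _ _ _ _ _) p Up)] /eqP.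
  by rewrite subr_eq0 => /eqP.
- case=> // N _; have gt0 A := @cohom_class_gt0 _ _ _ _ hL _ hP hM _ hK _ hb _ hU P N A.
  apply/seteqP; split=> [D [A hA <-]|D ->]; first exact: gt0.
  by exists (fun _ _ _ => 0) => //; exact: (zero_cocycle hL hP hM hK hb hU P).
Qed.
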